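(* Let $d=1$, $V=0$, $(x,v)\in\mathbb{T}\times\mathbb{R}$. There exists an explicit constant $C>0$ such that for every $f_0\in L^2(d\mu d\nu)$, the solution $f$ of $$\partial_t f+v\,\partial_x f=-(-\partial_v+v)\partial_v f,\qquad f|_{t=0}=f_0,$$ satisfies $f(t)\in H^1(d\mu d\nu)$ for all $t>0$, and for all $t\in(0,1]$, $$\|\partial_v f(t)\|\le \frac{C}{t^{1/2}}\|f_0\|\qquad\text{and}\qquad \|\partial_x f(t)\|\le\frac{C}{t^{3/2}}\|f_0\| .$$ (The constant $C$ is independent of $f_0$.)
   Context: $\mathbb{T}$ is the one-dimensional torus. $d\mu$ is the normalized (probability) Lebesgue measure on $\mathbb{T}$ and $d\nu=(2\pi)^{-1/2}e^{-v^2/2}\,dv$ is the standard Gaussian measure on $\mathbb{R}$. $\|\cdot\|$ is the norm of $L^2(d\mu d\nu)=L^2(\mathbb{T}\times\mathbb{R},d\mu\otimes d\nu)$, and $H^1(d\mu d\nu)$ is the space of $f\in L^2(d\mu d\nu)$ with $\partial_x f,\partial_v f\in L^2(d\mu d\nu)$. Solutions: let $P=v\partial_x+(-\partial_v+v)\partial_v$. It is a standing convention that $P$ is equipped with an appropriate domain $D(P)\subset L^2(d\mu d\nu)$ (for instance its closure from $C_c^\infty(\mathbb{T}\times\mathbb{R})$) to which the Hille–Yosida theorem applies; ''the solution with initial datum $f_0$'' means $f(t)=e^{-tP}f_0$. *)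

(* Defs.v *)
From HB Require Import structures.
From mathcomp Require Import all_boot all_order all_algebra.
From mathcomp Require Import all_classical all_reals all_analysis.

Set Implicit Arguments.
Unset Strict Implicit.
Unset Printing Implicit Defensive.

Import Order.TTheory GRing.Theory Num.Theory.
Import numFieldNormedType.Exports.

Local Open Scope classical_set_scope.
Local Open Scope ring_scope.

(* The torus is T = R/Z, with fundamental domain [0, 1].  A function on T x R
   is a function of p = (x, v) in R x R: an element of L^2 only matters almost
   everywhere on [0, 1] x R, while a smooth function is required to be
   1-periodic in x. *)

Section KineticFokkerPlanck.
Context {R : realType}.

Definition muT : probability (measurableTypeR R) R := uniform_prob (@ltr01 R).

Definition nuG : probability (measurableTypeR R) R := normal_prob 0 1.

Definition munu := (muT \x nuG)%E.

Definition dxdv := (muT \x @lebesgue_measure R)%E.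

(* Square-integrable functions, not quotiented: equality in L^2(dmu dnu) is
   equality munu-almost everywhere. *)
Definition L2 := LfunType munu (lee1n 2).

Definition L2norm (f : L2) : R := fine ('N[munu]_2%:R%:E [EFin \o f])%E.

Definition dx (phi : R * R -> R) : R * R -> R := 'D_(1, 0) phi.

Definition dv (phi : R * R -> R) : R * R -> R := 'D_(0, 1) phi.

Fixpoint Ck (k : nat) (phi : R * R -> R) : Prop :=
  continuous phi /\
  if k is k'.+1 then
    [/\ forall p, derivable phi p (1, 0), forall p, derivable phi p (0, 1),
        Ck k' (dx phi) & Ck k' (dv phi)]
  else True.

Record test_function (phi : R * R -> R) : Prop := TestFunction {
  test_smooth : forall k, Ck k phi ;
  test_periodic : forall x v, phi (x + 1, v) = phi (x, v) ;
  test_support : exists M : R, forall x v, M < `|v| -> phi (x, v) = 0 }.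

(* Distributional derivatives on T x R, tested against Lebesgue measure (the
   Gaussian weight is bounded below on the support of phi, so that f * phi is
   Lebesgue integrable). *)
Definition weak_dx (f g : L2) : Prop := forall phi, test_function phi ->
  \int[dxdv]_p (f p * dx phi p) = - \int[dxdv]_p (g p * phi p).

Definition weak_dv (f g : L2) : Prop := forall phi, test_function phi ->
  \int[dxdv]_p (f p * dv phi p) = - \int[dxdv]_p (g p * phi p).

Definition in_H1 (f : L2) : Prop :=
  (exists g, weak_dx f g) /\ (exists g, weak_dv f g).

Definition dv_adj (phi : R * R -> R) : R * R -> R :=
  fun p => - dv phi p + p.2 * phi p.

Definition P_smooth (phi : R * R -> R) : R * R -> R :=
  fun p => p.2 * dx phi p + dv_adj (dv phi) p.

(* The graph of P, closed from the smooth compactly supported functions: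
   [P_graph f g] means that f belongs to D(P) and P f = g. *)
Definition P_graph (f g : L2) : Prop := forall e : R, 0 < e ->
  exists phi Pphi : L2, [/\ test_function phi, Pphi =1 P_smooth phi,
    L2norm (f - phi) < e & L2norm (g - Pphi) < e].

Record contraction_semigroup (S : R -> L2 -> L2) : Prop := ContractionSemigroup {
  semigroup_linear : forall t, 0 <= t -> forall (a : R) (f g : L2),
    S t (a *: f + g) = a *: S t f + S t g %[ae munu] ;
  semigroup_contraction : forall t, 0 <= t -> forall f : L2,
    L2norm (S t f) <= L2norm f ;
  semigroup_0 : forall f : L2, S 0 f = f %[ae munu] ;
  semigroup_add : forall s t, 0 <= s -> 0 <= t -> forall f : L2,
    S (s + t) f = S s (S t f) %[ae munu] ;
  semigroup_continuous : forall f : L2,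
    L2norm (S h f - f) @[h --> 0^'+] --> (0 : R) }.

(* [generator S f g] means that f belongs to the domain of the infinitesimal
   generator of S, which maps f to g. *)
Definition generator (S : R -> L2 -> L2) (f g : L2) : Prop :=
  L2norm (h^-1 *: (S h f - f) - g) @[h --> 0^'+] --> (0 : R).

(* S is the semigroup t |-> e^{-tP}. *)
Definition exp_mtP (S : R -> L2 -> L2) : Prop :=
  contraction_semigroup S /\
  forall f g : L2, generator S f g <-> P_graph f (- g).

Definition solution (f0 : L2) (f : R -> L2) : Prop :=
  exists2 S, exp_mtP S & forall t, 0 <= t -> f t = S t f0 %[ae munu].

End KineticFokkerPlanck.

(* Main.v *)
(* Let T t be the Markov semigroup of the diffusion dX = V dt, dV = - V dt +
   sqrt 2 dB; its generator is minus the adjoint of P.  The diffusion is Gaussian,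
   with the law of (a X + b Y, d Y) around its mean, so T t is explicit on test
   functions and maps them to regular functions; testing the closed graph of P
   against T t psi and telescoping in time gives <S_t f, psi> = <f, T t psi>.
   Gaussian integration by parts writes T t (dx psi) and T t (dv psi) as averages
   of psi against linear functions of (X, Y) divided by a ~ t^(3/2) and
   d ~ t^(1/2), and Cauchy-Schwarz together with the invariance of munu under T t
   bounds these averages by |psi|.  By duality, psi |-> <S_t f, dx psi> is then a
   bounded functional on L2(munu), and the Riesz representation theorem provides
   the derivative in x; the one in v is obtained in the same way. *)

Require Import Defs.
From HB Require Import structures.
From mathcomp Require Import all_boot all_order all_algebra.
From mathcomp Require Import all_classical all_reals all_analysis.
From mathcomp Require Import measurable_realfun ring lra.

Set Implicit Arguments.
Unset Strict Implicit.
Unset Printing Implicit Defensive.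

Import Order.TTheory GRing.Theory Num.Theory.
Import numFieldNormedType.Exports.

Local Open Scope classical_set_scope.
Local Open Scope ring_scope.

(** * Semigroups on a Hilbert space *)

(** The exponents come from the triangular factor of the Gaussian noise: a^2 is the variance of the
    position given the velocity, 2 t - 4 tanh (t / 2) ~ t^3 / 6, while d^2 = 1 - exp (- 2 t) ~ 2 t.
    The ratio b / d = tanh (t / 2) is O(t), so the part of the v-derivative that passes through the
    x-derivative costs only t * t^(-3/2) = t^(-1/2). The v-derivative meets a further obstacle:
    minus the adjoint of d/dv in L2(munu) is d/dv - v, and multiplication by v is unbounded. An
    integration by parts bounds v (T t psi) by T t psi and its v-derivative. Two features of the
    setting shape the rest. For t > 0, [T t psi] is in general not compactly supported in v, so it
    is paired with the smooth functions defining the closed graph by a direct integration by parts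
    in a larger class. Elements of [L2] are functions, not classes: the inner product is only
    semi-definite, and identities between vectors are stated after pairing with an arbitrary
    vector. *)

Lemma telescoping_const (R : realType) (F : R -> R) (t : R) : 0 <= t ->
  (forall e, 0 < e -> exists2 d, 0 < d & forall s r, 0 <= s -> 0 < r -> r < d ->
    s + r <= t -> `|F (s + r) - F s| <= e * r) ->
  F t = F 0.
Proof.
rewrite le_eqVlt => /predU1P[<-//|t0] H.
apply/eqP; rewrite -subr_eq0 -normr_eq0 eq_le normr_ge0 andbT.
apply/ler_addgt0Pr => e e0; rewrite add0r.
(* Tolerance e / t per unit of time: the n increments over steps of length t / n < d add up to at
   most e. *)
have [d d0 Hd] := H (e / t) (divr_gt0 e0 t0).
pose n := (Num.trunc (t / d)).+1.
have n0 : 0 < n%:R :> R by rewrite ltr0n.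
have tn : t / n%:R < d.
  rewrite ltr_pdivrMr// mulrC -ltr_pdivrMr//; exact: truncnS_gt.
pose u (i : nat) := F (i%:R * (t / n%:R)).
have -> : F t - F 0 = \sum_(0 <= i < n) (u i.+1 - u i).
  by rewrite telescope_sumr// /u mul0r mulrC divfK ?gt_eqF.
have r0 : 0 < t / n%:R by rewrite divr_gt0.
apply: (le_trans (ler_norm_sum _ _ _)).
apply: (@le_trans _ _ (\sum_(0 <= i < n) (e / t * (t / n%:R)))); last first.
  rewrite sumr_const_nat subn0 -mulr_natr le_eqVlt; apply/orP; left; apply/eqP.
  by field; rewrite !gt_eqF.
rewrite big_nat [leRHS]big_nat; apply: ler_sum => i /andP[_ ilt].
rewrite /u -natr1 mulrDl mul1r; apply: Hd => //.
  by rewrite mulr_ge0// ltW.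
rewrite -[X in _ + X]mul1r -mulrDl natr1 -ler_pdivlMr// invf_div.
by rewrite mulrCA divff ?gt_eqF// mulr1 ler_nat.
Qed.

(** The integral starts at -1 so that 0 is an interior point and C has a two-sided derivative
    there. *)
Lemma antiderivative (R : realType) (c : R -> R) : continuous c ->
  forall h : R, exists C : R -> R,
    C 0 = 0 /\ forall x, -1 < x -> x < h -> is_derive x 1 C (c x).
Proof.
move=> cc h.
pose F x : R := (\int[lebesgue_measure]_(t in `[(-1), x]) c t)%R.
have dF x : -1 < x -> x < h -> is_derive x 1 F (c x).
  move=> x1 xh.
  have ic : lebesgue_measure.-integrable `[-1, h] (EFin \o c).
    apply: continuous_compact_integrable; first exact: segment_compact.
    exact: continuous_subspaceT.
  have [dF cF] := continuous_FTC1_closed xh ic x1 (cc x).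
  apply: DeriveDef; first exact: dF.
  by rewrite -derive1E.
exists (fun x => F x - F 0); split; first by rewrite subrr.
move=> x x1 xh; rewrite -[c x]subr0.
have := dF x x1 xh => dFx.
exact: is_deriveB.
Qed.

Lemma MVT_deriv (R : realType) (F f : R -> R) (a b : R) : a <= b ->
  (forall x, a <= x <= b -> is_derive x 1 F (f x)) ->
  exists2 c, a <= c <= b & F b - F a = f c * (b - a).
Proof.
move=> ab dF; have [||c] := @MVT_segment _ F f a b ab.
- by move=> x; rewrite in_itv/= => /andP[ax xb]; apply: dF; rewrite !ltW.
- apply: derivable_within_continuous => x; rewrite in_itv/= => xab.
  by case: (dF x xab).
by rewrite in_itv/= => cab ->; exists c.
Qed.

Section PreHilbert.
Context (R : realType) (H : lmodType R) (ip : H -> H -> R).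
Hypothesis ipC : forall f g, ip f g = ip g f.
Hypothesis ipP : forall a f g h, ip (a *: f + g) h = a * ip f h + ip g h.
Hypothesis ip_ge0 : forall f, 0 <= ip f f.

Let N f : R := Num.sqrt (ip f f).

Lemma ip0l h : ip 0 h = 0.
Proof.
have := ipP 1 0 0 h; rewrite scaler0 addr0 mul1r => /eqP.
by rewrite -subr_eq0 opprD addrA subrr add0r oppr_eq0 => /eqP.
Qed.

Lemma ipDl f g h : ip (f + g) h = ip f h + ip g h.
Proof. by rewrite -[f]scale1r ipP mul1r scale1r. Qed.

Lemma ipZl a f h : ip (a *: f) h = a * ip f h.
Proof. by rewrite -[a *: f]addr0 ipP ip0l addr0. Qed.

Lemma ipNl f h : ip (- f) h = - ip f h.
Proof. by rewrite -scaleN1r ipZl mulN1r. Qed.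

Lemma ipBl f g h : ip (f - g) h = ip f h - ip g h.
Proof. by rewrite ipDl ipNl. Qed.

Lemma ipDr f g h : ip h (f + g) = ip h f + ip h g.
Proof. by rewrite ipC ipDl !(ipC h). Qed.

Lemma ipZr a f h : ip h (a *: f) = a * ip h f.
Proof. by rewrite ipC ipZl (ipC h). Qed.

Lemma ipBr f g h : ip h (f - g) = ip h f - ip h g.
Proof. by rewrite ipC ipBl !(ipC h). Qed.

Lemma nrm_ge0 f : 0 <= N f. Proof. exact: sqrtr_ge0. Qed.

Lemma nrm_sqr f : N f ^+ 2 = ip f f. Proof. exact: sqr_sqrtr. Qed.

Lemma nrmZ a f : N (a *: f) = `|a| * N f.
Proof. by rewrite /N ipZl ipZr mulrA -expr2 sqrtrM ?sqr_ge0// sqrtr_sqr. Qed.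

Lemma nrmN f : N (- f) = N f.
Proof. by rewrite -scaleN1r nrmZ normrN1 mul1r. Qed.

Lemma nrmC f g : N (f - g) = N (g - f).
Proof. by rewrite -nrmN opprB. Qed.

Lemma nrm0 : N 0 = 0.
Proof. by rewrite -[0](scaler0 H 0) nrmZ normr0 mul0r. Qed.

Lemma cauchy_schwarz f g : `|ip f g| <= N f * N g.
Proof.
rewrite -(@ler_pXn2r _ 2)// ?nnegrE ?mulr_ge0 ?nrm_ge0//.
rewrite exprMn !nrm_sqr real_normK ?num_real//.
have q t : 0 <= ip f f + 2 * t * ip f g + t ^+ 2 * ip g g.
  have := ip_ge0 (f + t *: g).
  by rewrite ipDl !ipDr !ipZl !ipZr (ipC g f); congr (0 <= _); ring.
have ff := ip_ge0 f; have gg := ip_ge0 g.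
have [g0|g0] := eqVneq (ip g g) 0.
  have [fg|fg] := eqVneq (ip f g) 0; first by rewrite fg expr0n/= mulr_ge0.
  (* When g has norm zero the polynomial is affine in t; this t gives it the value -1. *)
  have := q (- (ip f f + 1) / (2 * ip f g)); rewrite g0 mulr0 addr0.
  have -> : 2 * (- (ip f f + 1) / (2 * ip f g)) * ip f g = - (ip f f + 1).
    by field.
  by lra.
have := q (- ip f g / ip g g).
have -> : ip f f + 2 * (- ip f g / ip g g) * ip f g +
    (- ip f g / ip g g) ^+ 2 * ip g g = (ip f f * ip g g - ip f g ^+ 2) / ip g g.
  by field.
rewrite pmulr_lge0 ?subr_ge0//.
by rewrite invr_gt0 lt_neqAle eq_sym g0.
Qed.

Lemma nrmD f g : N (f + g) <= N f + N g.
Proof.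
rewrite -(@ler_pXn2r _ 2)// ?nnegrE ?addr_ge0 ?nrm_ge0//.
rewrite nrm_sqr ipDl !ipDr sqrrD !nrm_sqr (ipC g f).
have := le_trans (ler_norm _) (cauchy_schwarz f g).
lra.
Qed.

Lemma nrmB f g : N (f - g) <= N f + N g.
Proof. by rewrite -[N g]nrmN; exact: nrmD. Qed.

Lemma nrm_tri g f h : N (f - h) <= N (f - g) + N (g - h).
Proof.
by have := nrmD (f - g) (g - h); rewrite addrA subrK.
Qed.

Lemma nrm_ip_le f M : 0 <= M -> (forall z, `|ip f z| <= M * N z) -> N f <= M.
Proof.
move=> M0 /(_ f) B; have := le_trans (ler_norm _) B.
rewrite -nrm_sqr expr2; have := nrm_ge0 f; rewrite le_eqVlt => /predU1P[<-//|f0].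
by rewrite ler_pM2r.
Qed.

(** Stands in for equality of vectors: the form is semi-definite, so two distinct functions may be
    indistinguishable by it. *)
Lemma nrm_eq f g : (forall z, ip f z = ip g z) -> N f = N g.
Proof. by move=> fg; rewrite /N fg ipC fg. Qed.

Hypothesis complete : forall u : nat -> H,
  (forall e : R, 0 < e -> exists n0, forall m n, (n0 <= m)%N -> (n0 <= n)%N ->
    N (u m - u n) < e) ->
  exists l, forall e : R, 0 < e -> exists n0, forall n, (n0 <= n)%N -> N (u n - l) < e.

Lemma natrV_small (e : R) : 0 < e -> exists n0, forall n, (n0 <= n)%N -> n.+1%:R^-1 < e.
Proof.
move=> e0; exists (Num.trunc e^-1) => n n0n.
rewrite invf_plt ?posrE// (lt_le_trans (truncnS_gt _))//.
by rewrite ler_nat.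
Qed.

(* A maximizing sequence of f |-> 2 l f - |f|^2 on D is Cauchy by the
   parallelogram law, and its limit represents l. *)
Lemma riesz (D : H -> Prop) (l : H -> R) (M : R) : 0 <= M ->
  D 0 -> (forall a f g, D f -> D g -> D (a *: f + g)) ->
  (forall a f g, D f -> D g -> l (a *: f + g) = a * l f + l g) ->
  (forall f, D f -> `|l f| <= M * N f) ->
  exists2 g, (forall f, D f -> ip g f = l f) & N g <= M.
Proof.
move=> M0 D0 DP lP lM.
pose J f := 2 * l f - ip f f.
pose E := [set x | exists2 f, D f & x = J f].
have JM f : D f -> J f <= M ^+ 2.
  move=> Df; rewrite /J -nrm_sqr; have := le_trans (ler_norm _) (lM f Df).
  have := sqr_ge0 (M - N f); rewrite sqrrB; lra.
have supE : has_sup E.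
  split; first by exists (J 0), 0.
  by exists (M ^+ 2) => x [f Df ->]; exact: JM.
pose s := sup E.
have Js f : D f -> J f <= s by move=> Df; apply: sup_upper_bound => //; exists f.
have /choice[u uP] (n : nat) : exists f, D f /\ s - n.+1%:R^-1 < J f.
  have [|x [f Df ->] ltx] := sup_adherent (_ : 0 < n.+1%:R^-1 :> R) supE.
    by rewrite invr_gt0.
  by exists f.
have para f g : D f -> D g -> N (f - g) ^+ 2 <= 4 * s - 2 * (J f + J g).
  move=> Df Dg; rewrite nrm_sqr.
  have Dg' : D (2^-1 *: g + 0) by exact: DP.
  have Dm : D (2^-1 *: f + (2^-1 *: g + 0)) by exact: DP.
  have := Js _ Dm; rewrite /J lP// lP// ipBl !ipBr !ipDl !ipDr !ipZl !ipZr !ip0l (ipC g f).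
  rewrite !(ipC _ 0) !ip0l.
  have -> : l 0 = 0.
    by have := lP 1 0 0 D0 D0; rewrite scaler0 addr0 mul1r; lra.
  by move=> h; lra.
have [|g gP] := complete (u := u).
  move=> e e0; have e4 : 0 < e ^+ 2 / 4 by rewrite divr_gt0 ?exprn_gt0.
  have [n0 n0P] := natrV_small e4; exists n0 => m n mn nn.
  rewrite -(@ltr_pXn2r _ 2)// ?nnegrE ?nrm_ge0 ?ltW//.
  have [Dm Jm] := uP m; have [Dn Jn] := uP n.
  move: (para _ _ Dm Dn) (n0P _ mn) (n0P _ nn) Jm Jn.
  by move: (m.+1%:R^-1) (n.+1%:R^-1) (J _) (J _) => *; lra.
have gl f : D f -> ip g f = l f.
  move=> Df.
  (* First-order optimality: compare J (t f + u n) <= s with J (u n) > s - 1 / (n + 1) and let n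
     grow. The limit g need not lie in D, so it cannot be inserted into J directly. *)
  have key t : 2 * t * (l f - ip g f) <= t ^+ 2 * ip f f.
    apply/ler_addgt0Pr => e e0.
    pose K := 2 * `|t| * N f + 1.
    have K0 : 0 < K by rewrite ltr_wpDl// !mulr_ge0 ?nrm_ge0.
    have [n1 n1P] := gP (e / 2 / K) (divr_gt0 (divr_gt0 e0 (ltr0Sn R 1)) K0).
    have [n2 n2P] := natrV_small (divr_gt0 e0 (ltr0Sn R 1) : 0 < e / 2).
    pose n := maxn n1 n2; have [Dn Jn] := uP n.
    have := Js _ (DP t _ _ Df Dn); move: Jn; rewrite /J lP//.
    rewrite !ipDl !ipDr !ipZl !ipZr (ipC (u n) f).
    have := n2P n (leq_maxr _ _).
    have := n1P n (leq_maxl _ _); rewrite ltr_pdivlMr// /K mulrDr mulr1.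
    have := ler_norm (2 * t * ip (u n - g) f).
    rewrite !normrM (ger0_norm (ler0n _ 2)).
    have := ler_wpM2l (_ : 0 <= 2 * `|t|) (cauchy_schwarz (u n - g) f).
    rewrite mulr_ge0// => /(_ isT).
    have := nrm_ge0 (u n - g).
    rewrite ipBl (ipC f (u n)).
    set A := N (u n - g); set B := N f; set C := `|ip (u n) f - ip g f|.
    have -> : 2 * `|t| * (A * B) = A * (2 * `|t| * B) by ring.
    by move: (n.+1%:R^-1) => *; lra.
  (* With x = l f - <g, f> and y = <f, f>, the choice t = x / (y + 1) gives (y + 2) / (y + 1)^2 x^2
     <= 0; the added 1 covers y = 0. *)
  have := key (l f - ip g f); have := key ((l f - ip g f) / (ip f f + 1)).
  have ff := ip_ge0 f; set x := l f - ip g f; set y := ip f f in ff *.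
  move=> h _; apply/eqP; rewrite -subr_eq0 -oppr_eq0 opprB -/x -sqrf_eq0.
  rewrite eq_le sqr_ge0 andbT.
  have y1 : 0 < y + 1 by lra.
  have : (y + 2) / (y + 1) ^+ 2 * x ^+ 2 <= 0.
    move: h; rewrite -subr_le0; apply: le_trans; rewrite le_eqVlt.
    by apply/orP; left; apply/eqP; field; rewrite gt_eqF.
  rewrite pmulr_rle0// divr_gt0 ?exprn_gt0//; lra.
exists g => //.
(* The bound on l is available only on D, so the norm is estimated on an approximant f = u n0 first:
   |f|^2 = <f - g, f> + l f <= (M + e / 2) |f|. *)
apply/ler_addgt0Pr => e e0.
have [n0 n0P] := gP (e / 2) (divr_gt0 e0 (ltr0Sn R 1)).
have := n0P n0 (leqnn _); set f := u n0; have [Df _] := uP n0.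
move=> fg.
have : N f <= M + e / 2.
  have ub : N f ^+ 2 <= (M + e / 2) * N f.
    have -> : N f ^+ 2 = ip (f - g) f + l f.
      by rewrite nrm_sqr ipBl gl//; ring.
    rewrite mulrDl addrC; apply: lerD.
      exact: le_trans (ler_norm _) (lM _ Df).
    apply: (le_trans (ler_norm _)); apply: (le_trans (cauchy_schwarz _ _)).
    by rewrite ler_wpM2r ?nrm_ge0// ltW.
  have := nrm_ge0 f; rewrite le_eqVlt => /predU1P[<-|f0].
    by rewrite addr_ge0// divr_ge0// ltW.
  by move: ub; rewrite expr2 ler_pM2r.
have := nrmB f (f - g); rewrite opprB addrC subrK; lra.
Qed.

Section Semigroup.
Variable S : R -> H -> H.
Hypothesis S_lin : forall t : R, 0 <= t -> forall a f g z,
  ip (S t (a *: f + g)) z = a * ip (S t f) z + ip (S t g) z.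
Hypothesis S_contr : forall t : R, 0 <= t -> forall f, N (S t f) <= N f.
Hypothesis S_0 : forall f z, ip (S 0 f) z = ip f z.
Hypothesis S_add : forall s t : R, 0 <= s -> 0 <= t -> forall f z,
  ip (S (s + t) f) z = ip (S s (S t f)) z.
Hypothesis S_cont : forall f (e : R), 0 < e -> exists2 d : R, 0 < d &
  forall h : R, 0 < h -> h < d -> N (S h f - f) < e.

(** The difference quotient is multiplied out by h: errors of size e * h are what a telescoping sum
    consumes. *)
Definition gen f g := forall e : R, 0 < e -> exists2 d : R, 0 < d &
  forall h : R, 0 < h -> h < d -> N (S h f - f - h *: g) <= e * h.

Lemma semigroupB t f g z : 0 <= t -> ip (S t (f - g)) z = ip (S t f) z - ip (S t g) z.
Proof.
move=> t0; have := S_lin t0 (-1) g f z; rewrite scaleN1r [- g + f]addrC => ->.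
by rewrite mulN1r addrC.
Qed.

(** Contractivity turns continuity at time 0 into a modulus of continuity uniform in s. *)
Lemma semigroup_diff s r f : 0 <= s -> 0 <= r ->
  N (S (s + r) f - S s f) <= N (S r f - f).
Proof.
move=> s0 r0; apply: le_trans (S_contr s0 _).
rewrite le_eqVlt; apply/orP; left; apply/eqP/nrm_eq => z.
by rewrite semigroupB// ipBl S_add.
Qed.

Lemma semigroup_cont0 f (e : R) : 0 < e -> exists2 d : R, 0 < d &
  forall h : R, 0 <= h -> h < d -> N (S h f - f) < e.
Proof.
move=> e0; have [d d0 dP] := S_cont f e0; exists d => // h.
rewrite le_eqVlt => /predU1P[<- _|]; last exact: dP.
suff -> : N (S 0 f - f) = 0 by [].
by rewrite -[RHS]nrm0; apply: nrm_eq => w; rewrite ipBl S_0 subrr ip0l.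
Qed.

Lemma semigroup_add_comm s r f z : 0 <= s -> 0 <= r ->
  ip (S s (S r f)) z = ip (S r (S s f)) z.
Proof. by move=> s0 r0; rewrite -!S_add// addrC. Qed.

(** S_s commutes with S_h and contracts, so the error in the definition of [gen] does not grow. *)
Lemma gen_semigroup s f g : 0 <= s -> gen f g -> gen (S s f) (S s g).
Proof.
move=> s0 fg e /fg[d d0 dP]; exists d => // h h0 hd.
apply: le_trans (dP h h0 hd); apply: le_trans (S_contr s0 _).
rewrite le_eqVlt; apply/orP; left; apply/eqP/nrm_eq => z.
have -> : S h f - f - h *: g = (- h) *: g + (S h f - f).
  by rewrite scaleNr addrC.
rewrite S_lin// semigroupB// !ipBl ipZl semigroup_add_comm ?(ltW h0)//; ring.
Qed.

Lemma genZ a f g : gen f g -> gen (a *: f) (a *: g).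
Proof.
move=> fg e e0; have a1 : 0 < `|a| + 1 by rewrite ltr_wpDl.
have [d d0 dP] := fg _ (divr_gt0 e0 a1); exists d => // h h0 hd.
have -> : N (S h (a *: f) - a *: f - h *: (a *: g)) = `|a| * N (S h f - f - h *: g).
  rewrite -nrmZ; apply: nrm_eq => z.
  have := S_lin (ltW h0) a f 0 z; have := S_lin (ltW h0) 1 0 0 z.
  rewrite scaler0 !addr0 mul1r => h00 E.
  rewrite !ipBl !ipZl !ipBl !ipZl E.
  have -> : ip (S h 0) z = 0 by move: h00; lra.
  by ring.
have := dP h h0 hd; have := nrm_ge0 (S h f - f - h *: g).
have := normr_ge0 a.
have -> : e * h = (`|a| + 1) * (e / (`|a| + 1) * h) by field; rewrite gt_eqF.
move: (N _) (e / _ * h) => u v *; nra.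
Qed.

(* The witness is the average h^-1 \int_0^h S_s f ds, defined weakly. *)
Lemma gen_dense f (e : R) : 0 < e -> exists y g, gen y g /\ N (y - f) < e.
Proof.
move=> e0; have e2 : 0 < e / 2 by rewrite divr_gt0.
have [h0 h00 h0P] := semigroup_cont0 f e2.
pose h := h0 / 2; have hh0 : 0 < h by rewrite divr_gt0.
have hlt : h < h0 by rewrite ltr_pdivrMr// ltr_pMr// ltr1n.
(* The absolute value extends the orbit evenly to negative times, which makes c z continuous on the
   whole line, as [antiderivative] requires. *)
pose c z (s : R) := ip (S `|s| f) z.
have cE z s : 0 <= s -> c z s = ip (S s f) z by move=> ?; rewrite /c ger0_norm.
have cdiff z s r : 0 <= s -> 0 <= r -> `|c z (s + r) - c z s| <= N (S r f - f) * N z.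
  move=> s0 r0; rewrite !cE ?addr_ge0// -ipBl (le_trans (cauchy_schwarz _ _))//.
  by rewrite ler_wpM2r ?nrm_ge0 ?semigroup_diff.
have c_cont z : continuous (c z).
  move=> s; apply/cvgrPdist_le => /= e' e'0.
  have Nz := nrm_ge0 z; have zz : 0 < N z + 1 by lra.
  have [d d0 dP] := semigroup_cont0 f (divr_gt0 e'0 zz).
  have {}dP r : 0 <= r -> r < d -> N (S r f - f) * N z <= e'.
    move=> r0 rd; have := dP r r0 rd; rewrite ltr_pdivlMr// mulrDr mulr1.
    have := nrm_ge0 (S r f - f); lra.
  have key (s1 s2 : R) : 0 <= s1 -> s1 <= s2 -> s2 - s1 < d -> `|c z s2 - c z s1| <= e'.
    move=> s10 s12 sd; have -> : s2 = s1 + (s2 - s1) by rewrite addrC subrK.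
    by rewrite (le_trans (cdiff _ _ _ _ _))// ?subr_ge0// dP// subr_ge0.
  near=> s'.
  have ss' : `|s - s'| < d by near: s'; apply: cvgr_dist_lt.
  have nn u : c z u = c z `|u| by rewrite /c normr_id.
  have nd := le_lt_trans (ler_dist_dist s s') ss'.
  rewrite (nn s) (nn s'); have [le|/ltW le] := leP `|s| `|s'|.
    rewrite distrC; apply: key => //.
    by rewrite (le_lt_trans (ler_norm _))// distrC.
  by apply: key => //; rewrite (le_lt_trans (ler_norm _)).
(* C z is evaluated up to h + r with r < h, hence the range beyond 2 h. *)
have /choice[C CP] z : exists C : R -> R, C 0 = 0 /\
    forall x, -1 < x -> x < 2 * h + 1 -> is_derive x 1 C (c z x).
  exact: antiderivative.
have dC z x : 0 <= x -> x <= 2 * h -> is_derive x 1 (C z) (c z x).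
  by move=> x0 x1; apply: (CP z).2; lra.
have C0 z : C z 0 = 0 by exact: (CP z).1.
have same (z1 z2 D1 D2 : R -> R) (b : R) : 0 <= b -> D1 0 = D2 0 ->
    (forall x : R, 0 <= x <= b -> is_derive x 1 D1 (z1 x)) ->
    (forall x : R, 0 <= x <= b -> is_derive x 1 D2 (z2 x)) ->
    (forall x : R, 0 <= x -> z1 x = z2 x) -> D1 b = D2 b.
  move=> b0 D12 dD1 dD2 z12.
  have [||x /andP[x0 _]] := @MVT_deriv R (D1 - D2) (fun x => z1 x - z2 x) 0 b.
  - exact: b0.
  - by move=> x xb; apply: is_deriveB; [exact: dD1|exact: dD2].
  - rewrite z12// subrr mul0r => /eqP; rewrite subr_eq0 => /eqP.
    by rewrite !fctE D12 subrr => /eqP; rewrite subr_eq0 => /eqP.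
have h20 : h <= 2 * h by lra.
(* y is the weak integral of S_s f over [0, h]: it represents z |-> C z h, a functional bounded by h
   |f|. *)
have [||||y yP _] := @riesz (fun=> True) (C^~ h) (h * N f) _ I.
- by rewrite mulr_ge0 ?nrm_ge0 ?ltW.
- by [].
- move=> a u w _ _.
  apply: (same (c (a *: u + w)) (fun x => a * c u x + c w x) _
    (fun x => a * C u x + C w x)).
  + exact: ltW.
  + by rewrite !C0 mulr0 addr0.
  + by move=> x /andP[x0 xh]; apply: dC => //; lra.
  + move=> x /andP[x0 xh]; have xh2 : x <= 2 * h by lra.
    have du := dC u x x0 xh2; have dw := dC w x x0 xh2.
    by apply: is_deriveD; apply: is_deriveZ.
  + by move=> x x0; rewrite /c ipDr ipZr.
- move=> z _; have [||x /andP[x0 xh]] := @MVT_deriv R (C z) (c z) 0 h.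
  + exact: ltW.
  + by move=> x /andP[x0 xh]; apply: dC => //; lra.
  + rewrite C0 !subr0 => ->; rewrite normrM (gtr0_norm hh0) mulrC -mulrA.
    rewrite ler_pM2l// cE// (le_trans (cauchy_schwarz _ _))//.
    by rewrite ler_wpM2r ?nrm_ge0// S_contr.
have {}yP z : ip y z = C z h by exact: yP.
exists (h^-1 *: y), (h^-1 *: (S h f - f)); split; first apply: genZ; last first.
  have -> : h^-1 *: y - f = h^-1 *: (y - h *: f).
    by rewrite scalerBr scalerA mulVf ?gt_eqF// scale1r.
  rewrite nrmZ ger0_norm ?invr_ge0 ?ltW// mulrC ltr_pdivrMr//.
  apply: (@le_lt_trans _ _ (e / 2 * h)); last by rewrite ltr_pM2r//; lra.
  apply: nrm_ip_le; first by rewrite mulr_ge0 ?ltW.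
  move=> z; rewrite ipBl ipZl yP.
  have [||x /andP[x0 xh]] := @MVT_deriv R (C z) (c z) 0 h.
  - exact: ltW.
  - by move=> x /andP[x0 xh]; apply: dC => //; lra.
  rewrite C0 !subr0 => ->.
  have -> : c z x * h - h * ip f z = h * (c z x - ip f z) by ring.
  rewrite normrM (gtr0_norm hh0).
  have -> : e / 2 * h * N z = h * (e / 2 * N z) by ring.
  rewrite ler_pM2l// cE//.
  rewrite -ipBl (le_trans (cauchy_schwarz _ _))//.
  rewrite ler_wpM2r ?nrm_ge0//.
  by apply: ltW; apply: h0P => //; exact: le_lt_trans hlt.
move=> e' e'0; have e'2 : 0 < e' / 2 by rewrite divr_gt0.
have [d d0 dP] := semigroup_cont0 f e'2.
exists (Num.min d h); first by rewrite lt_min d0.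
move=> r r0; rewrite lt_min => /andP[rd rh]; have r0' := ltW r0.
apply: nrm_ip_le; first by rewrite mulr_ge0 ?ltW.
move=> z.
(* z' plays the role of the adjoint S_r^* z; it moves S_r inside the weak integral, which is only
   known through its pairings. *)
have [||||z' z'P _] := @riesz (fun=> True) (fun w => ip (S r w) z) (N z) _ I.
- exact: nrm_ge0.
- by [].
- by move=> *; rewrite S_lin.
- move=> w _; rewrite (le_trans (cauchy_schwarz _ _))// mulrC.
  by rewrite ler_wpM2l ?nrm_ge0// S_contr.
have Sry : ip (S r y) z = C z (h + r) - C z r.
  rewrite -z'P// ipC yP.
  apply: (same (c z') (fun x => c z (x + r)) _ (fun x => C z (x + r) - C z r)).
  - exact: ltW.
  - by rewrite C0 add0r subrr.
  - by move=> x /andP[x0 xh]; apply: dC => //; lra.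
  - move=> x /andP[x0 xh].
    have xr : 0 <= x + r by lra.
    have xr2 : x + r <= 2 * h by lra.
    have dd := dC z _ xr xr2; rewrite -[c z _]subr0; apply: is_deriveB.
    have dr : is_derive x 1 (fun y : R => y + r) 1.
      by rewrite -[X in is_derive _ _ _ X]addr0; exact: is_deriveD.
    by have := @is_derive1_comp _ (C z) (fun y : R => y + r) x _ 1 dd dr;
      rewrite mulr1.
  - move=> x x0; rewrite !cE ?addr_ge0// ipC z'P// addrC S_add//.
rewrite !ipBl Sry ipZl yP ipBl.
have [|| x1 /andP[hx1 x1r] E1] := @MVT_deriv R (C z) (c z) h (h + r).
- lra.
- by move=> x /andP[x0 xh]; apply: dC; lra.
have [|| x2 /andP[hx2 x2r] E2] := @MVT_deriv R (C z) (c z) 0 r.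
- lra.
- by move=> x /andP[x0 xh]; apply: dC; lra.
have B1 : `|c z x1 - c z h| <= e' / 2 * N z.
  have -> : x1 = h + (x1 - h) by rewrite addrC subrK.
  have hx : 0 <= x1 - h by rewrite subr_ge0.
  apply: (le_trans (cdiff _ _ _ (ltW hh0) hx)).
  rewrite ler_wpM2r ?nrm_ge0// ltW//; apply: dP => //.
  by apply: le_lt_trans rd; lra.
have B2 : `|c z x2 - c z 0| <= e' / 2 * N z.
  rewrite -[x2]add0r; apply: (le_trans (cdiff _ _ _ (lexx _) hx2)).
  by rewrite ler_wpM2r ?nrm_ge0// ltW//; apply: dP => //; exact: le_lt_trans rd.
(* S_r y - y is the integral over [h, h + r] minus the integral over [0, r]; by the mean value
   theorem each is r times a value of c z close to the one at h, respectively at 0. *)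
have -> : C z (h + r) - C z r - C z h - r * (ip (S h f) z - ip f z) =
    r * ((c z x1 - c z h) - (c z x2 - c z 0)).
  rewrite -[ip f z]S_0 -!cE ?(ltW hh0)//.
  move: E1 E2; rewrite C0 !subr0 [h + r - h]addrAC subrr add0r => E1 E2.
  have -> : C z (h + r) = C z h + c z x1 * r by rewrite -E1; ring.
  by rewrite E2; ring.
rewrite normrM (gtr0_norm r0).
have -> : e' * r * N z = r * (e' * N z) by ring.
rewrite ler_pM2l//.
rewrite (le_trans (ler_normB _ _))//; lra.
Unshelve. all: by end_near. Qed.

(** Think of h as a solution of h' = k with k = A^* h, where A is the generator: then s |-> <S_s f,
    h (t - s)> is constant for f in the domain. A quadratic remainder uniform in time replaces
    differentiability of h, and the adjoint relation is asked only along this curve. *)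
Theorem semigroup_duality (h k : R -> H) (M K t : R) : 0 <= t -> 0 <= K ->
  (forall s, 0 <= s -> s <= t -> forall f g, gen f g -> ip g (h s) = ip f (k s)) ->
  (forall s, 0 <= s -> s <= t -> N (h s) <= M) ->
  (forall s r, 0 <= s -> 0 <= r -> s + r <= t ->
    N (h (s + r) - h s - r *: k s) <= K * r ^+ 2) ->
  forall f, ip (S t f) (h 0) = ip f (h t).
Proof.
move=> t0 K0 adj hM hk.
have M0 : 0 <= M by apply: le_trans (hM 0 _ _); rewrite ?nrm_ge0.
have main f g : gen f g -> ip (S t f) (h 0) = ip f (h t).
  move=> fg; pose F s := ip (S s f) (h (t - s)).
  have -> : ip (S t f) (h 0) = F t by rewrite /F subrr.
  have -> : ip f (h t) = F 0 by rewrite /F subr0 S_0.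
  apply: telescoping_const => // e e0.
  have M1 : 0 < M + 1 by lra.
  have e2 : 0 < e / 2 by rewrite divr_gt0.
  have Nf := nrm_ge0 f.
  have Kf : 0 < K * N f + 1 by rewrite ltr_wpDl// mulr_ge0.
  have [d d0 dP] := fg _ (divr_gt0 e2 M1).
  exists (Num.min d (e / 2 / (K * N f + 1))); first by rewrite lt_min d0 divr_gt0.
  move=> s r s0 r0; rewrite lt_min => /andP[rd rK] srt; have r0' := ltW r0.
  pose x := t - (s + r).
  have x0 : 0 <= x by rewrite subr_ge0.
  have xt : x <= t by rewrite lerBlDr lerDl addr_ge0.
  (* The first-order terms r <S_s g, h x> and r <S_s f, k x> cancel by [adj], because S_s f is still
     in the domain with image S_s g; only the two remainders are left. *)
  have -> : F (s + r) - F s = ip (S s (S r f - f - r *: g)) (h x) -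
      ip (S s f) (h (x + r) - h x - r *: k x).
    rewrite /F -/x; have -> : t - s = x + r by rewrite /x; ring.
    have -> : S r f - f - r *: g = (- r) *: g + (S r f - f).
      by rewrite scaleNr addrC.
    rewrite S_lin// semigroupB// S_add// !ipBr ipZr.
    rewrite (adj _ x0 xt _ _ (gen_semigroup s0 fg)); ring.
  rewrite (le_trans (ler_normB _ _))//.
  have A1 : `|ip (S s (S r f - f - r *: g)) (h x)| <= e / 2 * r.
    rewrite (le_trans (cauchy_schwarz _ _))//.
    apply: (@le_trans _ _ ((e / 2 / (M + 1) * r) * M)).
      apply: ler_pM; rewrite ?nrm_ge0 ?hM//.
      by rewrite (le_trans (S_contr _ _))// dP.
    have -> : e / 2 * r = e / 2 / (M + 1) * r * (M + 1) by field; rewrite gt_eqF.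
    by rewrite ler_wpM2l ?lerDl// mulr_ge0// ltW// divr_gt0.
  have A2 : `|ip (S s f) (h (x + r) - h x - r *: k x)| <= e / 2 * r.
    rewrite (le_trans (cauchy_schwarz _ _))//.
    apply: (@le_trans _ _ (N f * (K * r ^+ 2))).
      apply: ler_pM; rewrite ?nrm_ge0 ?S_contr ?hk//.
      by rewrite /x; lra.
    move: rK; rewrite ltr_pdivlMr// => rK.
    have -> : N f * (K * r ^+ 2) = (r * (K * N f)) * r by ring.
    rewrite ler_pM2r//; move: rK; rewrite mulrDr mulr1; lra.
  lra.
(* Both sides are Lipschitz in f with constant M, so the identity extends from the dense domain to
   every f. *)
move=> f; apply/eqP; rewrite -subr_eq0 -normr_eq0 eq_le normr_ge0 andbT.
apply/ler_addgt0Pr => e e0; rewrite add0r.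
have M1 : 0 < 2 * M + 1 by lra.
have [y [g [yg yf]]] := gen_dense f (divr_gt0 e0 M1).
have -> : ip (S t f) (h 0) - ip f (h t) =
    ip (y - f) (h t) - ip (S t (y - f)) (h 0).
  rewrite semigroupB// ipBl (main _ _ yg); ring.
have := cauchy_schwarz (y - f) (h t).
have := cauchy_schwarz (S t (y - f)) (h 0).
have := S_contr t0 (y - f).
have := hM t t0 (lexx _); have := hM 0 (lexx _) t0.
have := nrm_ge0 (h 0); have := nrm_ge0 (h t).
have := nrm_ge0 (S t (y - f)); have := nrm_ge0 (y - f).
move: yf; rewrite ltr_pdivlMr//.
have := ler_normB (ip (y - f) (h t)) (ip (S t (y - f)) (h 0)).
move: (N (y - f)) (N (S t (y - f))) (N (h 0)) (N (h t)) => n1 n2 n3 n4 *.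
have : n1 * n4 <= n1 * M by apply: ler_wpM2l.
have : n2 * n3 <= n1 * M by apply: ler_pM.
lra.
Qed.

End Semigroup.
End PreHilbert.

(** * The space L2 of a measure *)

Section L2space.
Context d (T : measurableType d) (R : realType) (mu : {measure set T -> \bar R}).
Local Notation L := (LfunType mu (lee1n 2)).
Implicit Types f g h : L.

Definition L2ip f g : R := \int[mu]_x (f x * g x).

Local Notation N := (fun f : L => Num.sqrt (L2ip f f)).

Lemma L2_measurable f : measurable_fun [set: T] f.
Proof. exact: measurable_funPT. Qed.
Hint Resolve L2_measurable : core.

Lemma L2_mul_integrable f g : mu.-integrable [set: T] (EFin \o (fun x => f x * g x)).
Proof. by apply/Lfun1_integrable; apply: Lfun2_mul_Lfun1; exact: LfunP. Qed.

Lemma L2ipC f g : L2ip f g = L2ip g f.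
Proof. by apply: eq_Rintegral => x _; rewrite mulrC. Qed.

Lemma L2ipP a f g h : L2ip (a *: f + g) h = a * L2ip f h + L2ip g h.
Proof.
rewrite /L2ip -RintegralZl ?L2_mul_integrable// -RintegralD//.
- by apply: eq_Rintegral => x _ /=; rewrite mulrDl mulrA.
- have := L2_mul_integrable (a *: f) h.
  by apply: eq_integrable => // x _ /=; rewrite mulrA.
- exact: L2_mul_integrable.
Qed.

Lemma L2ip_ge0 f : 0 <= L2ip f f.
Proof. by apply: Rintegral_ge0 => x _; rewrite -expr2 sqr_ge0. Qed.

Lemma L2ipE f : (L2ip f f)%:E = (\int[mu]_x ((f x) ^+ 2)%:E)%E.
Proof.
rewrite /L2ip /Rintegral fineK; last first.
  by apply: integrable_fin_num => //; exact: L2_mul_integrable.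
by apply: eq_integral => x _ /=; rewrite expr2.
Qed.

Lemma LnormE (f : T -> R) :
  ('N[mu]_2%:R%:E [EFin \o f] = (\int[mu]_x ((f x) ^+ 2)%:E) `^ 2^-1)%E.
Proof.
rewrite unlock; congr (_ `^ _)%E; apply: eq_integral => x _ /=.
by rewrite powR_mulrn// real_normK ?num_real.
Qed.

Lemma Lnorm_sqrt f : fine ('N[mu]_2%:R%:E [EFin \o f])%E = N f.
Proof. by rewrite LnormE -L2ipE /= powR12_sqrt ?L2ip_ge0. Qed.

Lemma Lfun2P (f : T -> R) : measurable_fun [set: T] f ->
  (\int[mu]_x ((f x) ^+ 2)%:E < +oo)%E -> f \in Lfun mu 2%:E.
Proof.
move=> mf fi; apply/andP; split; first by rewrite inE.
by rewrite inE /finLfun /= /finite_norm LnormE poweR_lty.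
Qed.

Lemma L2ip_ae f g h : f = g %[ae mu] -> L2ip f h = L2ip g h.
Proof.
move=> fg; rewrite /L2ip /Rintegral; congr fine.
apply: ae_eq_integral => //; last exact: (ae_eq_comp2 (fun x y => (y * h x)%:E) fg).
- exact/measurable_EFinP/measurable_funM.
- exact/measurable_EFinP/measurable_funM.
Qed.

Let NB f g : N (f - g) = N (g - f).
Proof. exact: (nrmC L2ipC L2ipP). Qed.

Let msq (f g : T -> R) : measurable_fun [set: T] f -> measurable_fun [set: T] g ->
  measurable_fun [set: T] (fun x => (f x - g x) ^+ 2).
Proof. by move=> mf mg; apply: measurable_funX; exact: measurable_funB. Qed.

(** Riesz-Fischer: a subsequence with geometrically small increments converges almost everywhere,
    and Fatou's lemma makes the pointwise limit an L2 limit. *)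
Lemma L2_complete (u : nat -> L) :
  (forall e : R, 0 < e -> exists n0, forall m n, (n0 <= m)%N -> (n0 <= n)%N ->
    N (u m - u n) < e) ->
  exists l : L, forall e : R, 0 < e -> exists n0, forall n, (n0 <= n)%N ->
    N (u n - l) < e.
Proof.
move=> uC.
pose q : R := 4^-1.
have q0 : 0 < q by rewrite invr_gt0.
have /choice[k kP] (j : nat) : exists n0, forall m n, (n0 <= m)%N -> (n0 <= n)%N ->
    N (u m - u n) < q ^+ j by apply: uC; rewrite exprn_gt0.
(* The running maximum makes the extracted indices monotone. *)
pose n := fix n (j : nat) := if j is j'.+1 then maxn (n j') (k j'.+1) else k 0%N.
have kn j : (k j <= n j)%N by case: j => //= j; exact: leq_maxr.
have nS i j : (i <= j)%N -> (n i <= n j)%N.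
  elim: j => [|j IH]; first by rewrite leqn0 => /eqP->.
  rewrite leq_eqVlt => /predU1P[->//|/IH h]; apply: leq_trans h _.
  exact: leq_maxl.
pose v j := u (n j).
have vP i j : (i <= j)%N -> N (v j - v i) <= q ^+ i.
  by move=> ij; apply/ltW/kP; rewrite ?kn// (leq_trans (kn i))// nS.
(* The weight 4^j leaves integrals of size at most 4^j * 16^(-j) = 4^(-j), and a finite sum at x
   forces increments O(2^(-j)) at x. *)
pose w (j : nat) x := (4 ^+ j * (v j.+1 x - v j x) ^+ 2)%:E.
have mw j : measurable_fun [set: T] (w j).
  by apply/measurable_EFinP/measurable_funM => //; exact: msq.
have w0 j x : (0 <= w j x)%E by rewrite lee_fin mulr_ge0 ?sqr_ge0 ?exprn_ge0.
have iw : (\int[mu]_x \sum_(0 <= j <oo) w j x < +oo)%E.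
  rewrite integral_nneseries//.
  apply: (@le_lt_trans _ _ (\sum_(0 <= j <oo) (geometric 1 q j)%:E)%E).
    apply: lee_nneseries => [j _ _|j _]; first exact: integral_ge0.
    under eq_integral do rewrite /w EFinM.
    rewrite ge0_integralZl//; last 2 first.
    - by apply/measurable_EFinP; exact: msq.
    - by move=> x _; rewrite lee_fin sqr_ge0.
    have -> : (\int[mu]_x ((v j.+1 x - v j x) ^+ 2)%:E)%E = (N (v j.+1 - v j) ^+ 2)%:E.
      by rewrite sqr_sqrtr ?L2ip_ge0// L2ipE.
    rewrite -EFinM lee_fin /geometric /= mul1r.
    have := vP j j.+1 (leqnSn j); set a := N _ => aj.
    apply: (@le_trans _ _ (4 ^+ j * (q ^+ j) ^+ 2)).
      by rewrite ler_wpM2l ?exprn_ge0// ler_pXn2r// ?nnegrE ?sqrtr_ge0// exprn_ge0// ltW.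
    by rewrite [(q ^+ j) ^+ 2]expr2 mulrA -exprMn divff// expr1n mul1r.
  have q1 : `|q| < 1 by rewrite gtr0_norm// invf_lt1// ltr1n.
  rewrite (_ : (\sum_(0 <= j <oo) _)%E = (limn (series (geometric 1 q)))%:E) ?ltry//.
  rewrite -EFin_lim; last exact: is_cvg_geometric_series.
  by apply: congr_lim; apply/funext => m /=; rewrite sumEFin.
have cv : {ae mu, forall x, cvgn (fun j => v j x)}.
  have : mu.-integrable [set: T] (fun x => \sum_(0 <= j <oo) w j x)%E.
    apply/integrableP; split; first exact: ge0_emeasurable_sum.
    by under eq_integral do rewrite gee0_abs ?nneseries_ge0//.
  move=> /integrable_ae -/(_ measurableT); apply: filterS => x /(_ I) fx.
  pose C := fine (\sum_(0 <= j <oo) w j x)%E.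
  have wC j : 4 ^+ j * (v j.+1 x - v j x) ^+ 2 <= C.
    rewrite -lee_fin /C fineK//.
    apply: le_trans (nneseries_lim_ge j.+1 _) => [|i _ _]; last exact: w0.
    by rewrite big_nat_recr//= leeDr// sume_ge0.
  have C0 : 0 <= C by apply: le_trans (wC 0%N); rewrite mulr_ge0 ?sqr_ge0.
  have dC j : `|telescope (fun j => v j x) j| <= geometric (Num.sqrt C) 2^-1 j.
    rewrite /telescope /geometric /= -(@ler_pXn2r _ 2)// ?nnegrE ?mulr_ge0 ?sqrtr_ge0 ?exprn_ge0//.
    rewrite real_normK ?num_real// exprMn sqr_sqrtr// exprAC exprVn -natrX.
    by rewrite exprVn ler_pdivlMr ?exprn_gt0// mulrC.
  have : cvgn (series (telescope (fun j => v j x))).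
    apply: normed_cvg; apply: (series_le_cvg _ _ dC) => [j|j|].
    - exact: normr_ge0.
    - by rewrite /geometric/= mulr_ge0 ?sqrtr_ge0 ?exprn_ge0.
    - by apply: is_cvg_geometric_series; rewrite gtr0_norm// invf_lt1// ltr1n.
  rewrite telescopeK => cs.
  have -> : (fun j => v j x) = (fun j => [sequence v n0 x - v 0%N x]_n0 j + v 0%N x).
    by apply/funext => j /=; rewrite subrK.
  by apply: is_cvgD => //; exact: is_cvg_cst.
(* The upper limit is defined and measurable everywhere, and it is the limit wherever the
   subsequence converges. *)
pose l x : R := fine (limn_esup (fun j => (v j x)%:E)).
have ml : measurable_fun [set: T] l.
  apply: measurableT_comp => //.
  by apply: measurable_fun_limn_esup => j; exact/measurable_EFinP.
have vl : {ae mu, forall x, v j x @[j --> \oo] --> l x}.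
  move: cv; apply: filterS => x cx.
  have ex : (v j x)%:E @[j --> \oo] --> (limn (fun j => v j x))%:E by apply: cvg_EFin; [exact: nearW|].
  by rewrite /l (cvg_limn_einf_sup ex).2.
have fat i : (\int[mu]_x ((l x - v i x) ^+ 2)%:E <= ((q ^+ i) ^+ 2)%:E)%E.
  pose g j x := ((v (j + i)%N x - v i x) ^+ 2)%:E.
  have mg j : measurable_fun [set: T] (g j).
    rewrite /g.
    by apply/measurable_EFinP; exact: msq.
  have g0 j x : [set: T] x -> (0 <= g j x)%E by rewrite lee_fin sqr_ge0.
  have -> : (\int[mu]_x ((l x - v i x) ^+ 2)%:E = \int[mu]_x limn_einf (g^~ x))%E.
    apply: ae_eq_integral => //.
    - by apply/measurable_EFinP; exact: msq.
    - rewrite (_ : (fun x => _) = (fun x => - limn_esup (fun j => - g j x)))%E.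
        apply: measurableT_comp => //; apply: measurable_fun_limn_esup => j.
        exact: measurableT_comp.
      apply/funext => x; rewrite -limn_einfN; congr limn_einf.
      by apply/funext => j; rewrite [RHS]oppeK.
    - move: vl; apply: filterS => x vlx _; apply/esym.
      apply: (cvg_limn_einf_sup _).1; apply: cvg_EFin; first exact: nearW.
      apply: (@cvg_comp _ _ _ (fun j => v (j + i)%N x - v i x) (fun y => y ^+ 2) _ (nbhs (l x - v i x))).
        by apply: cvgB; [rewrite (cvg_shiftn i (fun j => v j x))|exact: cvg_cst].
      exact: exprn_continuous.
  apply: le_trans (fatou mu measurableT mg g0) _.
  rewrite limn_einf_lim; apply: lime_le; first exact: is_cvg_einfs.
  apply: nearW => j; apply: (@le_trans _ _ (\int[mu]_x g j x)%E).
    apply: ereal_inf_lbound; exists j => //=.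
  have -> : (\int[mu]_x g j x)%E = (N (v (j + i)%N - v i) ^+ 2)%:E.
    by rewrite sqr_sqrtr ?L2ip_ge0// L2ipE.
  by rewrite lee_fin ler_pXn2r// ?nnegrE ?sqrtr_ge0// ?exprn_ge0 ?vP ?leq_addl// ltW.
(* Fatou controls only differences l - v i, so membership in L2 is obtained for l - v 0 and v 0 is
   added back. *)
have lv0 : (fun x => l x - v 0%N x) \in Lfun mu 2%:E.
  apply: Lfun2P; first exact: measurable_funB.
  exact: le_lt_trans (fat 0%N) (ltry _).
pose h : L := Lfun_Sub (lee1n 2) lv0 + v 0%N.
have hE x : h x = l x by rewrite /h /= subrK.
have hv i : N (v i - h) <= q ^+ i.
  rewrite NB -(@ler_pXn2r _ 2)// ?nnegrE ?sqrtr_ge0// ?exprn_ge0 ?(ltW q0)//.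
  rewrite sqr_sqrtr ?L2ip_ge0//.
  suff : ((L2ip (h - v i) (h - v i))%:E <= ((q ^+ i) ^+ 2)%:E)%E by rewrite lee_fin.
  rewrite L2ipE.
  rewrite (_ : (\int[mu]_x _)%E = (\int[mu]_x ((l x - v i x) ^+ 2)%:E)%E)//.
  apply: eq_integral => x _.
  by have -> : (h - v i) x = h x - v i x by []; rewrite hE.
exists h => e e0.
have e2 : 0 < e / 2 by rewrite divr_gt0.
have [i qi] : exists i, q ^+ i < e / 2.
  have : q ^+ i @[i --> \oo] --> (0 : R).
    by apply: cvg_expr; rewrite gtr0_norm// invf_lt1// ltr1n.
  move=> /cvgrPdist_lt /(_ _ e2)[i _ iP]; exists i.
  by have := iP i (leqnn i); rewrite /= sub0r normrN gtr0_norm// exprn_gt0.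
exists (n i) => m nm.
apply: (le_lt_trans (nrm_tri L2ipC L2ipP L2ip_ge0 (v i) _ _)).
rewrite [e]splitr ltrD//; last exact: le_lt_trans (hv i) qi.
apply: lt_trans qi; apply: kP; last exact: kn.
exact: leq_trans (kn i) nm.
Qed.

End L2space.

(** * Measurability of continuous functions for the product sigma-algebra *)

Section ContinuousMeasurable.
Context {R : realType}.
Local Notation T2 := (measurableTypeR R * measurableTypeR R)%type.

Lemma open_measurable2 (U : set (R * R)) : open U -> measurable (U : set T2).
Proof.
move=> oU.
pose box (a b c d : rat) : set (R * R) :=
  [set p | [/\ ratr a < p.1, p.1 < ratr b, ratr c < p.2 & p.2 < ratr d]].
(* Boxes not contained in U are replaced by the empty set, so that U is a union over all rational
   quadruples. *)
pose F a b c d := if `[< box a b c d `<=` U >] then box a b c d else set0.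
have mF a b c d : measurable (F a b c d : set T2).
  rewrite /F; case: ifP => _; last exact: measurable0.
  rewrite (_ : box a b c d = `]ratr a, ratr b[ `*` `]ratr c, ratr d[).
    exact: measurableX.
  apply/seteqP; split=> -[x v] /=; rewrite !in_itv/=.
    by move=> [-> -> -> ->].
  by move=> [/andP[? ?] /andP[? ?]].
have -> : U = \bigcup_a \bigcup_b \bigcup_c \bigcup_d F a b c d.
  apply/seteqP; split => [[x v] Uxv|p [a _ [b _ [c _ [d _]]]]]; last first.
    by rewrite /F; case: ifPn => // /asboolP; exact.
  have [[A B] [/= /nbhs_ballP[e1 /= e10 A1] /nbhs_ballP[e2 /= e20 B1] AB]] :
    nbhs (x, v) U by exact: open_nbhs_nbhs.
  have [a /itvP ax] := @rat_in_itvoo R (x - e1) x ltac:(by rewrite ltrBlDr ltrDl).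
  have [b /itvP bx] := @rat_in_itvoo R x (x + e1) ltac:(by rewrite ltrDl).
  have [c /itvP cx] := @rat_in_itvoo R (v - e2) v ltac:(by rewrite ltrBlDr ltrDl).
  have [d /itvP dx] := @rat_in_itvoo R v (v + e2) ltac:(by rewrite ltrDl).
  exists a => //; exists b => //; exists c => //; exists d => //.
  rewrite /F ifT; first by split; rewrite /= ?ax ?bx ?cx ?dx.
  apply/asboolP => -[y w] [/= y1 y2 w1 w2]; apply: AB; split => /=.
    apply: A1; rewrite /ball/= ltr_distlC.
    by rewrite (lt_trans _ y1) ?ax// (lt_trans y2)// bx.
  apply: B1; rewrite /ball/= ltr_distlC.
  by rewrite (lt_trans _ w1) ?cx// (lt_trans w2)// dx.
by do 4! apply: bigcupT_measurable_rat => ?.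
Qed.

Lemma continuous_measurable2 (f : R * R -> R) :
  continuous f -> measurable_fun [set: T2] (f : T2 -> R).
Proof.
move=> /continuousP cf; apply: (measurability _ (RGenOpens.measurableE R)).
move=> _ [_ [a [b ->] <-]]; rewrite setTI.
apply: open_measurable2; apply: cf; exact: interval_open.
Qed.

End ContinuousMeasurable.

(** * Smooth functions of two variables, differentiated along one-variable slices *)

Section SmoothFunctions.
Context {R : realType}.
Implicit Types f g phi : R * R -> R.

Lemma quotient_dx phi x v :
  (fun h => h^-1 *: ((phi \o shift (x, v)) (h *: (1, 0)) - phi (x, v))) =
  (fun h : R => h^-1 *: (((fun s => phi (s, v)) \o shift x) (h *: (1 : R)) - phi (x, v))).
Proof.
apply/funext => h /=; congr (_ *: (phi _ - _)).
by apply/pair_equal_spec; split; rewrite /= ?scaler0 ?add0r.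
Qed.

Lemma quotient_dv phi x v :
  (fun h => h^-1 *: ((phi \o shift (x, v)) (h *: (0, 1)) - phi (x, v))) =
  (fun h : R => h^-1 *: (((fun s => phi (x, s)) \o shift v) (h *: (1 : R)) - phi (x, v))).
Proof.
apply/funext => h /=; congr (_ *: (phi _ - _)).
by apply/pair_equal_spec; split; rewrite /= ?scaler0 ?add0r.
Qed.

Lemma is_derive_dx phi x v l :
  is_derive (x : R) 1 (fun s => phi (s, v)) l <->
  derivable phi (x, v) (1, 0) /\ dx phi (x, v) = l.
Proof.
split=> [[d1 d2]|[d1 d2]]; last split.
- by rewrite /dx /derive /derivable quotient_dx.
- by move: d1; rewrite /derivable quotient_dx.
- by move: d2; rewrite /dx /derive quotient_dx.
Qed.

Lemma is_derive_dv phi x v l :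
  is_derive (v : R) 1 (fun s => phi (x, s)) l <->
  derivable phi (x, v) (0, 1) /\ dv phi (x, v) = l.
Proof.
split=> [[d1 d2]|[d1 d2]]; last split.
- by rewrite /dv /derive /derivable quotient_dv.
- by move: d1; rewrite /derivable quotient_dv.
- by move: d2; rewrite /dv /derive quotient_dv.
Qed.

Lemma CkS_dx k phi : Ck k.+1 phi -> forall x v,
  is_derive (x : R) 1 (fun s => phi (s, v)) (dx phi (x, v)).
Proof. by move=> [_ [d1 _ _ _]] x v; apply/is_derive_dx. Qed.

Lemma CkS_dv k phi : Ck k.+1 phi -> forall x v,
  is_derive (v : R) 1 (fun s => phi (x, s)) (dv phi (x, v)).
Proof. by move=> [_ [_ d1 _ _]] x v; apply/is_derive_dv. Qed.

Lemma Ck_continuous k phi : Ck k phi -> continuous phi.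
Proof. by case: k => [|k] []. Qed.

(** One criterion gives both the regularity and the formulas for the partial derivatives, so that
    each closure property needs only its one-variable differentiation rule. *)
Lemma CkS_intro k phi gx gv : continuous phi ->
  (forall x v, is_derive (x : R) 1 (fun s => phi (s, v)) (gx (x, v))) ->
  (forall x v, is_derive (v : R) 1 (fun s => phi (x, s)) (gv (x, v))) ->
  Ck k gx -> Ck k gv -> [/\ Ck k.+1 phi, dx phi = gx & dv phi = gv].
Proof.
move=> cphi dgx dgv cgx cgv.
have Ex : dx phi = gx.
  by apply/funext => -[x v]; have /is_derive_dx[] := dgx x v.
have Ev : dv phi = gv.
  by apply/funext => -[x v]; have /is_derive_dv[] := dgv x v.
split; [|exact: Ex|exact: Ev]; split; first exact: cphi.
rewrite Ex Ev; split; [| |exact: cgx|exact: cgv] => -[x v].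
  by have /is_derive_dx[] := dgx x v.
by have /is_derive_dv[] := dgv x v.
Qed.

Lemma CkW k phi : Ck k.+1 phi -> Ck k phi.
Proof.
elim: k phi => [|k IH] phi [c [d1 d2 C1 C2]]; first by split.
exact: (conj c (And4 d1 d2 (IH _ C1) (IH _ C2))).
Qed.

Lemma Ck_dx k phi : Ck k.+1 phi -> Ck k (dx phi).
Proof. by move=> [_ [_ _ C _]]; exact: C. Qed.

Lemma Ck_dv k phi : Ck k.+1 phi -> Ck k (dv phi).
Proof. by move=> [_ [_ _ _ C]]; exact: C. Qed.

Lemma dxD k f g : Ck k.+1 f -> Ck k.+1 g ->
  dx (fun p => f p + g p) = fun p => dx f p + dx g p.
Proof.
move=> Cf Cg; apply/funext => -[x v].
have d1 := CkS_dx Cf x v; have d2 := CkS_dx Cg x v.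
by have [] := (is_derive_dx (fun p => f p + g p) x v _).1 (is_deriveD d1 d2).
Qed.

Lemma dvD k f g : Ck k.+1 f -> Ck k.+1 g ->
  dv (fun p => f p + g p) = fun p => dv f p + dv g p.
Proof.
move=> Cf Cg; apply/funext => -[x v].
have d1 := CkS_dv Cf x v; have d2 := CkS_dv Cg x v.
by have [] := (is_derive_dv (fun p => f p + g p) x v _).1 (is_deriveD d1 d2).
Qed.

Lemma CkD k f g : Ck k f -> Ck k g -> Ck k (fun p => f p + g p).
Proof.
elim: k f g => [|k IH] f g Cf Cg; have cfg : continuous (fun p => f p + g p).
- by move=> p; apply: continuousD; [exact: (Ck_continuous Cf)|exact: (Ck_continuous Cg)].
- by split.
- by move=> p; apply: continuousD; [exact: (Ck_continuous Cf)|exact: (Ck_continuous Cg)].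
have [||||//] := @CkS_intro k (fun p => f p + g p) (fun p => dx f p + dx g p)
  (fun p => dv f p + dv g p) cfg.
- by move=> x v; exact: (is_deriveD (CkS_dx Cf x v) (CkS_dx Cg x v)).
- by move=> x v; exact: (is_deriveD (CkS_dv Cf x v) (CkS_dv Cg x v)).
- exact: (IH _ _ (Ck_dx Cf) (Ck_dx Cg)).
- exact: (IH _ _ (Ck_dv Cf) (Ck_dv Cg)).
Qed.

Lemma is_deriveM1 (f g : R -> R) (x a b : R) : is_derive x 1 f a -> is_derive x 1 g b ->
  is_derive x 1 (fun s => f s * g s) (a * g x + f x * b).
Proof.
move=> df dg; have := is_deriveM df dg.
by rewrite addrC /GRing.scale /= [g x * a]mulrC.
Qed.

Lemma CkM k f g : Ck k f -> Ck k g ->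
  Ck k (fun p => f p * g p).
Proof.
elim: k f g => [|k IH] f g Cf Cg; have cfg : continuous (fun p => f p * g p).
- by move=> p; apply: continuousM; [exact: (Ck_continuous Cf)|exact: (Ck_continuous Cg)].
- by split.
- by move=> p; apply: continuousM; [exact: (Ck_continuous Cf)|exact: (Ck_continuous Cg)].
have [||||//] := @CkS_intro k (fun p => f p * g p) (fun p => dx f p * g p + f p * dx g p)
  (fun p => dv f p * g p + f p * dv g p) cfg.
- by move=> x v; exact: (is_deriveM1 (CkS_dx Cf x v) (CkS_dx Cg x v)).
- by move=> x v; exact: (is_deriveM1 (CkS_dv Cf x v) (CkS_dv Cg x v)).
- exact: (CkD (IH _ _ (Ck_dx Cf) (CkW Cg)) (IH _ _ (CkW Cf) (Ck_dx Cg))).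
- exact: (CkD (IH _ _ (Ck_dv Cf) (CkW Cg)) (IH _ _ (CkW Cf) (Ck_dv Cg))).
Qed.

Lemma dxM k f g : Ck k.+1 f -> Ck k.+1 g ->
  dx (fun p => f p * g p) = fun p => dx f p * g p + f p * dx g p.
Proof.
move=> Cf Cg; apply/funext => -[x v].
have d1 := CkS_dx Cf x v; have d2 := CkS_dx Cg x v.
by have [] := (is_derive_dx (fun p => f p * g p) x v _).1 (is_deriveM1 d1 d2).
Qed.

Lemma dvM k f g : Ck k.+1 f -> Ck k.+1 g ->
  dv (fun p => f p * g p) = fun p => dv f p * g p + f p * dv g p.
Proof.
move=> Cf Cg; apply/funext => -[x v].
have d1 := CkS_dv Cf x v; have d2 := CkS_dv Cg x v.
by have [] := (is_derive_dv (fun p => f p * g p) x v _).1 (is_deriveM1 d1 d2).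
Qed.

Lemma Ck_cst k (c : R) : Ck k (fun=> c).
Proof.
elim: k c => [|k IH] c; have cc : continuous (fun _ : R * R => c) by exact: cst_continuous.
  by split.
by have [C _ _] := @CkS_intro k (fun=> c) (fun=> 0) (fun=> 0) cc
  (fun x v => is_derive_cst _ _ _) (fun x v => is_derive_cst _ _ _) (IH 0) (IH 0).
Qed.

Lemma Ck_snd k : Ck k (fun p : R * R => p.2).
Proof.
have cs : continuous (fun p : R * R => p.2) by move=> p; exact: cvg_snd.
case: k => [|k]; first by split.
by have [C _ _] := @CkS_intro k (fun p => p.2) (fun=> 0) (fun=> 1) cs
  (fun x v => is_derive_cst _ _ _) (fun x v => is_derive_id _ _)
  (Ck_cst k 0) (Ck_cst k 1).
Qed.

End SmoothFunctions.

(** * Test functions *)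

Lemma addKl (V : zmodType) (x y : V) : x + y - x = y.
Proof. by rewrite addrAC subrr add0r. Qed.

Section OneVariable.
Context {R : realType}.
Implicit Types f g : R -> R.

Lemma MVT_any f f' (a b : R) : (forall x : R, is_derive x 1 f (f' x)) ->
  exists2 c, `|c - a| <= `|b - a| & f b - f a = f' c * (b - a).
Proof.
move=> df; have [ab|/ltW ba] := leP a b.
  have [c /andP[ac cb] E] := MVT_deriv ab (fun x _ => df x).
  by exists c => //; rewrite !ger0_norm ?subr_ge0// lerB.
have [c /andP[ac cb] E] := MVT_deriv ba (fun x _ => df x).
exists c; first by rewrite !ler0_norm ?subr_le0// lerN2 lerB.
by rewrite -opprB E; ring.
Qed.

(** Differentiates Taylor remainders: g will be a sum of squared increments, which vanishes to
    second order at x. *)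
Lemma is_derive_dominated (r g : R -> R) (x K : R) : is_derive x 1 g 0 ->
  g x = 0 -> r x = 0 -> (forall s, `|r s| <= K * `|g s|) -> is_derive x 1 r 0.
Proof.
move=> [dg g'0] gx rx rg.
have g0 : (h^-1 *: ((g \o shift x) (h *: (1 : R)) - g x)) @[h --> 0^'] --> (0 : R).
  have : (h^-1 *: ((g \o shift x) (h *: (1 : R)) - g x)) @[h --> 0^'] --> 'D_1 g x.
    exact: dg.
  by rewrite g'0.
have r0 : (h^-1 *: ((r \o shift x) (h *: (1 : R)) - r x)) @[h --> 0^'] --> (0 : R).
  apply/cvgr0Pnorm_le => e e0.
  have K1 : 0 < `|K| + 1 by rewrite ltr_wpDl.
  move/cvgr0Pnorm_le : g0 => /(_ _ (divr_gt0 e0 K1)); apply: filterS => h.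
  rewrite gx rx !subr0 /= !normrM ler_pdivlMr// => H; apply: le_trans H.
  rewrite -mulrA ler_wpM2l// (le_trans (rg _))// mulrC ler_wpM2l//.
  by rewrite (le_trans (ler_norm _))// lerDl.
apply: DeriveDef; first by apply/cvg_ex; exists 0.
by apply: cvg_lim.
Qed.

End OneVariable.

Section TestFunctions.
Context {R : realType}.
Implicit Types f g phi : R * R -> R.

Lemma test_Ck1 phi : test_function phi -> Ck 1 phi.
Proof. by move/test_smooth; apply. Qed.

Lemma test_dxE phi x v : test_function phi ->
  is_derive (x : R) 1 (fun s => phi (s, v)) (dx phi (x, v)).
Proof. by move=> /test_Ck1/CkS_dx. Qed.

Lemma test_dvE phi x v : test_function phi ->
  is_derive (v : R) 1 (fun s => phi (x, s)) (dv phi (x, v)).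
Proof. by move=> /test_Ck1/CkS_dv. Qed.

Lemma test_continuous phi : test_function phi -> continuous phi.
Proof. by move=> /test_Ck1/Ck_continuous. Qed.

Lemma test_dx phi : test_function phi -> test_function (dx phi).
Proof.
move=> T; split=> [k|x v|].
- exact/Ck_dx/test_smooth.
- rewrite /dx /derive !quotient_dx.
  rewrite (_ : (fun h : R => _) = (fun h : R => h^-1 *:
    (((fun s => phi (s, v)) \o shift x) (h *: (1 : R)) - phi (x, v))))//.
  by apply/funext => h /=; rewrite addrA !(test_periodic T).
- have [M MP] := test_support T; exists M => x v Mv.
  have E : (fun s => phi (s, v)) = cst 0 by apply/funext => s; exact: MP.
  have d0 : is_derive (x : R) 1 (fun s => phi (s, v)) 0 by rewrite E; exact: is_derive_cst.
  exact: ((is_derive_dx phi x v 0).1 d0).2.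
Qed.

Lemma test_dv phi : test_function phi -> test_function (dv phi).
Proof.
move=> T; split=> [k|x v|].
- exact/Ck_dv/test_smooth.
- rewrite /dv /derive !quotient_dv.
  rewrite (_ : (fun h : R => _) = (fun h : R => h^-1 *:
    (((fun s => phi (x, s)) \o shift v) (h *: (1 : R)) - phi (x, v))))//.
  by apply/funext => h /=; rewrite !(test_periodic T).
- have [M MP] := test_support T; exists M => x v Mv.
  have [_ <-] := test_dvE x v T.
  rewrite (@near_eq_derive _ _ _ _ (cst 0)) ?derive_cst//.
  near=> s; apply: MP; near: s.
  by apply: (cvgr_gt _ (cvg_norm cvg_id)).
Unshelve. all: by end_near. Qed.

Lemma test_add f g : test_function f -> test_function g ->
  test_function (fun p => f p + g p).
Proof.
move=> Tf Tg; split=> [k|x v|].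
- by apply: CkD; exact: test_smooth.
- by rewrite !test_periodic.
- have [M MP] := test_support Tf; have [M' MP'] := test_support Tg.
  exists (Num.max M M') => x v; rewrite gt_max => /andP[? ?].
  by rewrite MP// MP'// addr0.
Qed.

Lemma test_mul g f : (forall k, Ck k g) -> (forall x v, g (x + 1, v) = g (x, v)) ->
  test_function f -> test_function (fun p => g p * f p).
Proof.
move=> Cg Pg Tf; split=> [k|x v|].
- by apply: CkM => //; exact: test_smooth.
- by rewrite Pg test_periodic.
- have [M MP] := test_support Tf.
  by exists M => x v Mv; rewrite MP// mulr0.
Qed.

Lemma test_scale c f : test_function f -> test_function (fun p => c * f p).
Proof. by apply: test_mul => // k; exact: Ck_cst. Qed.

Lemma test_snd f : test_function f -> test_function (fun p => p.2 * f p).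
Proof. by apply: test_mul => // k; exact: Ck_snd. Qed.

Lemma test_sqr f : test_function f -> test_function (fun p => f p * f p).
Proof.
by move=> Tf; apply: test_mul => //; [exact: test_smooth|exact: test_periodic].
Qed.

Lemma test0 : test_function (fun _ : R * R => 0).
Proof.
split=> [k|//|]; first exact: Ck_cst.
by exists 0.
Qed.

Lemma dx_scale c f : test_function f -> dx (fun p => c * f p) = fun p => c * dx f p.
Proof.
move=> /test_Ck1 Tf; rewrite (dxM (Ck_cst 1 c) Tf); apply/funext => p.
have [_ -> _] := @CkS_intro R 0 (fun=> c) (fun=> 0) (fun=> 0)
  (Ck_continuous (Ck_cst 0 c)) (fun x v => is_derive_cst _ _ _)
  (fun x v => is_derive_cst _ _ _) (Ck_cst 0 0) (Ck_cst 0 0).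
by rewrite mul0r add0r.
Qed.

Lemma dv_scale c f : test_function f -> dv (fun p => c * f p) = fun p => c * dv f p.
Proof.
move=> /test_Ck1 Tf; rewrite (dvM (Ck_cst 1 c) Tf); apply/funext => p.
have [_ _ ->] := @CkS_intro R 0 (fun=> c) (fun=> 0) (fun=> 0)
  (Ck_continuous (Ck_cst 0 c)) (fun x v => is_derive_cst _ _ _)
  (fun x v => is_derive_cst _ _ _) (Ck_cst 0 0) (Ck_cst 0 0).
by rewrite mul0r add0r.
Qed.

(* - P^*, with the adjoint taken in L2(munu). *)
Definition Lop phi : R * R -> R :=
  fun p => p.2 * dx phi p + dv (dv phi) p - p.2 * dv phi p.

Lemma test_Lop phi : test_function phi -> test_function (Lop phi).
Proof.
move=> T; rewrite (_ : Lop phi = fun p => (p.2 * dx phi p + dv (dv phi) p) +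
  (-1) * (p.2 * dv phi p)); last by apply/funext => p; rewrite /Lop mulN1r.
apply: test_add; first by apply: test_add; [exact/test_snd/test_dx|exact/test_dv/test_dv].
by apply: test_scale; apply: test_snd; exact: test_dv.
Qed.

Lemma test_periodicn phi (n : nat) x v : test_function phi ->
  phi (x + n%:R, v) = phi (x, v).
Proof.
move=> T; elim: n => [|n IH]; first by rewrite addr0.
by rewrite -natr1 addrA test_periodic.
Qed.

Lemma test_periodicz phi (z : int) x v : test_function phi ->
  phi (x + z%:~R, v) = phi (x, v).
Proof.
move=> T; case: z => n; first exact: test_periodicn.
by rewrite NegzE mulrNz -[LHS](test_periodicn n.+1 _ _ T) subrK.
Qed.

Lemma test_bounded phi : test_function phi ->
  exists2 K, 0 <= K & forall p, `|phi p| <= K.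
Proof.
move=> T; have [M MP] := test_support T.
(* One period in x is enough. The absolute value keeps the rectangle nonempty when M is negative. *)
pose A : set (R * R) := `[0, 1] `*` `[(- `|M|), `|M| ].
have cA : compact A by apply: compact_setX; exact: segment_compact.
have A0 : A !=set0.
  by exists (0, 0); split; rewrite /= in_itv/= ?lexx ?ler01// oppr_le0 normr_ge0.
have [|c _ cP] := @compact_EVT_max (R * R)%type R (fun p => `|phi p|) A A0 cA.
  apply: continuous_subspaceT => p; apply: cvg_norm; exact: (test_continuous T).
exists `|phi c| => // -[x v].
have [Mv|vM] := ltP M `|v|; first by rewrite MP// normr0.
have -> : phi (x, v) = phi (x - (Num.floor x)%:~R, v).
  by rewrite -[RHS](test_periodicz (Num.floor x) _ _ T) subrK.
apply: cP; rewrite inE; split; rewrite /= in_itv/=.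
  by rewrite subr_ge0 floor_le_tmp lerBlDl ltW// -[1]/(1%:~R) -intrD floorD1_gt.
by rewrite -ler_norml (le_trans vM)// ler_norm.
Qed.

Lemma test_lipschitz phi : test_function phi ->
  exists2 K, 0 <= K & forall x v a b,
    `|phi (x + a, v + b) - phi (x, v)| <= K * (`|a| + `|b|).
Proof.
move=> T; have [K1 K10 K1P] := test_bounded (test_dx T).
have [K2 K20 K2P] := test_bounded (test_dv T).
exists (K1 + K2); first exact: addr_ge0.
move=> x v a b.
have [c1 _ E1] := @MVT_any R (fun s => phi (s, v + b)) (fun s => dx phi (s, v + b)) x (x + a)
  (fun s => test_dxE s (v + b) T).
have [c2 _ E2] := @MVT_any R (fun s => phi (x, s)) (fun s => dv phi (x, s)) v (v + b)
  (fun s => test_dvE x s T).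
have -> : phi (x + a, v + b) - phi (x, v) = dx phi (c1, v + b) * a + dv phi (x, c2) * b.
  move: E1 E2; rewrite !addKl => <- <-; ring.
rewrite (le_trans (ler_normD _ _))// !normrM.
have := K1P (c1, v + b); have := K2P (x, c2).
have := normr_ge0 a; have := normr_ge0 b.
move: `|dx _ _| `|dv _ _| `|a| `|b| => n1 n2 A B *.
have : n1 * A <= K1 * A by rewrite ler_wpM2r.
have : n2 * B <= K2 * B by rewrite ler_wpM2r.
have : 0 <= K1 * B by rewrite mulr_ge0.
have : 0 <= K2 * A by rewrite mulr_ge0.
lra.
Qed.

Let taylor_bound (K1 K2 A B C D n1 n2 : R) : 0 <= K1 -> 0 <= K2 -> 0 <= A -> 0 <= B ->
  C <= A -> D <= B -> n1 <= K1 * (C + B) -> n2 <= K2 * D ->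
  A * n1 + B * n2 <= (K1 + K2) * (A + B) ^+ 2.
Proof.
move=> K10 K20 A0 B0 CA DB n1P n2P.
have h1 : A * n1 <= A * (K1 * (A + B)).
  by rewrite ler_wpM2l// (le_trans n1P)// ler_wpM2l// lerD2r.
have h2 : B * n2 <= B * (K2 * B).
  by rewrite ler_wpM2l// (le_trans n2P)// ler_wpM2l.
have h3 : 0 <= K1 * (B * (A + B)) + K2 * (A * A + 2 * A * B).
  by rewrite addr_ge0// !mulr_ge0// ?addr_ge0// !mulr_ge0.
clear -h1 h2 h3; lra.
Qed.

(** The first derivatives are globally Lipschitz, so K depends neither on the point nor on the
    increment. This uniformity lets the expansion be integrated against a Gaussian. *)
Lemma test_taylor phi : test_function phi ->
  exists2 K, 0 <= K & forall x v a b,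
    `|phi (x + a, v + b) - phi (x, v) - (a * dx phi (x, v) + b * dv phi (x, v))|
    <= K * (`|a| + `|b|) ^+ 2.
Proof.
move=> T; have [K1 K10 K1P] := test_lipschitz (test_dx T).
have [K2 K20 K2P] := test_lipschitz (test_dv T).
exists (K1 + K2); first exact: addr_ge0.
move=> x v a b.
have [c1 c1P E1] := @MVT_any R (fun s => phi (s, v + b)) (fun s => dx phi (s, v + b)) x (x + a)
  (fun s => test_dxE s (v + b) T).
have [c2 c2P E2] := @MVT_any R (fun s => phi (x, s)) (fun s => dv phi (x, s)) v (v + b)
  (fun s => test_dvE x s T).
move: E1 E2 c1P c2P; rewrite !addKl => E1 E2 c1P c2P.
have -> : phi (x + a, v + b) - phi (x, v) - (a * dx phi (x, v) + b * dv phi (x, v)) =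
   a * (dx phi (x + (c1 - x), v + b) - dx phi (x, v)) +
   b * (dv phi (x + 0, v + (c2 - v)) - dv phi (x, v)).
  have -> : x + (c1 - x) = c1 by ring.
  have -> : v + (c2 - v) = c2 by ring.
  have -> : phi (x + a, v + b) = phi (x, v + b) + dx phi (c1, v + b) * a.
    by rewrite -E1; ring.
  have -> : phi (x, v + b) = phi (x, v) + dv phi (x, c2) * b.
    by rewrite -E2; ring.
  rewrite addr0.
  ring.
apply: le_trans (ler_normD _ _) _; rewrite !normrM.
have h1 := K1P x v (c1 - x) b; have h2 := K2P x v 0 (c2 - v).
rewrite normr0 add0r in h2.
exact: (taylor_bound K10 K20 (normr_ge0 a) (normr_ge0 b) c1P c2P h1 h2).
Qed.

Let schwarz_bound (K1 K2 h a b c d X Y Z : R) : 0 <= K1 -> 0 <= K2 ->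
  a <= h -> b <= h -> c <= h -> d <= h ->
  `|X - Y| <= K2 * (a + b) -> `|X - Z| <= K1 * (c + d) -> 0 <= h ->
  `|Y - Z| <= (2 * (K1 + K2) + 1) * h.
Proof.
move=> K10 K20 ah bh ch dh XY XZ h0.
have h1 : `|Y - Z| <= `|X - Y| + `|X - Z|.
  by rewrite [`|X - Y|]distrC; have := ler_normD (Y - X) (X - Z); rewrite addrA subrK.
have h2 : K2 * (a + b) <= K2 * (h + h) by apply: ler_wpM2l => //; exact: lerD.
have h3 : K1 * (c + d) <= K1 * (h + h) by apply: ler_wpM2l => //; exact: lerD.
clear -h0 h1 h2 h3 XY XZ; lra.
Qed.

(** Schwarz's theorem: the second difference over a square of side h equals h^2 times either mixed
    derivative at some point of the square, and both mixed derivatives are Lipschitz. *)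
Lemma dx_dvC phi p : test_function phi -> dx (dv phi) p = dv (dx phi) p.
Proof.
case: p => x v T.
have Txv := test_dv (test_dx T); have Tvx := test_dx (test_dv T).
have [K1 K10 K1P] := test_lipschitz Txv.
have [K2 K20 K2P] := test_lipschitz Tvx.
apply/eqP; rewrite -subr_eq0 -normr_eq0 eq_le normr_ge0 andbT.
apply/ler_addgt0Pr => e e0; rewrite add0r.
pose K := 2 * (K1 + K2) + 1.
have KK : 0 < K by rewrite /K; lra.
pose h := e / K; have h0 : 0 < h by rewrite divr_gt0.
have [c1 c1P E1] := @MVT_any R (fun s => phi (s, v + h) - phi (s, v))
  (fun s => dx phi (s, v + h) - dx phi (s, v)) x (x + h)
  (fun s => is_deriveB (test_dxE s (v + h) T) (test_dxE s v T)).
have [c2 c2P E2] := @MVT_any R (fun s => phi (x + h, s) - phi (x, s))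
  (fun s => dv phi (x + h, s) - dv phi (x, s)) v (v + h)
  (fun s => is_deriveB (test_dvE (x + h) s T) (test_dvE x s T)).
have [c3 c3P E3] := @MVT_any R (fun s => dx phi (c1, s)) (fun s => dv (dx phi) (c1, s))
  v (v + h) (fun s => test_dvE c1 s (test_dx T)).
have [c4 c4P E4] := @MVT_any R (fun s => dv phi (s, c2)) (fun s => dx (dv phi) (s, c2))
  x (x + h) (fun s => test_dxE s c2 (test_dv T)).
move: E1 E2 E3 E4 c1P c2P c3P c4P.
rewrite !addKl (gtr0_norm h0) => E1 E2 E3 E4 h1 h2 h3 h4.
(* Both sides times h^2 are the same second difference, taken first in x or first in v. *)
have E : dv (dx phi) (c1, c3) = dx (dv phi) (c4, c2).
  have hh : h != 0 by rewrite gt_eqF.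
  rewrite E3 in E1; rewrite E4 in E2.
  move: (dv (dx phi) (c1, c3)) (dx (dv phi) (c4, c2)) E1 E2 => X Y E1 E2.
  apply: (mulIf hh); apply: (mulIf hh); rewrite -E1 -E2.
  by move: (phi (x + h, v + h)) (phi (x + h, v)) => *; ring.
have H1 := K1P x v (c1 - x) (c3 - v); have H2 := K2P x v (c4 - x) (c2 - v).
have addBK (y z : R) : y + (z - y) = z by ring.
rewrite !addBK E in H1 H2.
have -> : e = K * h by rewrite /h mulrC divfK ?gt_eqF.
exact: (schwarz_bound K10 K20 h4 h2 h1 h3 H2 H1 (ltW h0)).
Qed.

End TestFunctions.

(** * Gaussian integration by parts *)

Lemma measurable_EFin_comp d (T : measurableType d) (R : realType) (h : T -> R) :
  measurable_fun [set: T] h -> measurable_fun [set: T] (fun x => (h x)%:E).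
Proof. by move=> mh; apply: measurableT_comp. Qed.

Section GaussianMeasure.
Context {R : realType}.
Local Notation leb := (@lebesgue_measure R).
Local Notation nuG := (@nuG R).

Definition gauss (y : R) : R := normal_pdf 0 1 y.

Lemma gaussE y : gauss y = normal_peak 1 * expR (- (y ^+ 2 / 2)).
Proof.
rewrite /gauss normal_pdfE ?oner_neq0//; congr (_ * expR _).
by rewrite subr0 expr1n mulNr.
Qed.

Lemma gauss_gt0 y : 0 < gauss y.
Proof. by rewrite gaussE mulr_gt0 ?expR_gt0// normal_peak_gt0 ?oner_neq0. Qed.

Lemma continuous_gauss : continuous gauss.
Proof. by apply: continuous_normal_pdf; exact: oner_neq0. Qed.

Lemma measurable_gauss : measurable_fun [set: measurableTypeR R] gauss.
Proof. exact: measurable_normal_pdf. Qed.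

Lemma measurable_gaussE :
  measurable_fun [set: measurableTypeR R] (fun y : measurableTypeR R => (gauss y)%:E).
Proof. by apply: measurableT_comp => //; exact: measurable_gauss. Qed.

Lemma is_derive_gauss (y : R) : is_derive y 1 gauss (- y * gauss y).
Proof.
have d0 := is_deriveM1 (is_derive_id (y : R) 1) (is_derive_id (y : R) 1).
have d1 : is_derive y 1 (fun z : R => - 2^-1 * (z * z)) (- y).
  have := is_deriveZ (- 2^-1 : R) d0; rewrite /GRing.scale /=.
  by have -> : - 2^-1 * (1 * y + y * 1) = - y by field.
have d2 := @is_derive1_comp R expR (fun z : R => - 2^-1 * (z * z)) y _ _
  (is_derive_expR (- 2^-1 * (y * y))) d1.
have E : gauss = fun z => normal_peak 1 * expR (- 2^-1 * (z * z)).
  by apply/funext => z; rewrite gaussE; congr (_ * expR _); field.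
have d3 := is_deriveM1 (is_derive_cst (normal_peak 1 : R) (y : R) 1) d2.
by rewrite E; apply: (is_derive_eq d3); rewrite /=; ring.
Qed.

(** Both functions have the same integral over every measurable set. This makes the density in the
    change of variables explicit. *)
Let RN_gauss : ae_eq leb setT (Radon_Nikodym_SigmaFinite.f nuG leb) (EFin \o gauss).
Proof.
have dom := @normal_prob_dominates R 0 1.
apply: integral_ae_eq => //.
- exact: (Radon_Nikodym_SigmaFinite.f_integrable dom).
- exact: measurable_gaussE.
- by move=> E _ mE; rewrite -Radon_Nikodym_SigmaFinite.f_integral.
Qed.

Lemma ge0_integral_nuG (f : measurableTypeR R -> \bar R) : measurable_fun setT f ->
  (forall y, 0 <= f y)%E ->
  (\int[nuG]_y f y = \int[leb]_y (f y * (gauss y)%:E))%E.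
Proof.
move=> mf f0; have dom := @normal_prob_dominates R 0 1.
rewrite -(Radon_Nikodym_SigmaFinite.change_of_variables dom)//.
apply: ae_eq_integral => //.
- apply: emeasurable_funM => //; apply: (measurable_int leb).
  exact: (Radon_Nikodym_SigmaFinite.f_integrable dom).
- by apply: emeasurable_funM => //; exact: measurable_gaussE.
- exact: ae_eqe_mul2l RN_gauss.
Qed.

Lemma integral_nuG (f : measurableTypeR R -> \bar R) : measurable_fun setT f ->
  (\int[nuG]_y f y = \int[leb]_y (f y * (gauss y)%:E))%E.
Proof.
move=> mf; rewrite integralE [RHS]integralE.
rewrite !ge0_integral_nuG//; last 2 first.
- exact: measurable_funeneg.
- exact: measurable_funepos.
have g0 y := ltW (gauss_gt0 y).
congr (_ - _)%E; apply: eq_integral => y _.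
  transitivity ((fun z => (gauss y)%:E * f z)^\+ y)%E.
    by rewrite ge0_funeposM// muleC.
  by rewrite !funeposE muleC.
transitivity ((fun z => (gauss y)%:E * f z)^\- y)%E.
  by rewrite ge0_funenegM// muleC.
by rewrite !funenegE muleC.
Qed.

Lemma square_le_expR (y : R) : y ^+ 2 <= 4 * expR (y ^+ 2 / 4).
Proof.
by have := expR_ge1Dx (y ^+ 2 / 4); lra.
Qed.

(** Since y^2 <= 4 exp (y^2 / 4), the integrand is dominated by a multiple of the Gaussian density
    of variance 2. *)
Lemma integrable_sqr_nuG : nuG.-integrable [set: measurableTypeR R]
  (fun y => (y ^+ 2)%:E).
Proof.
have s2 : Num.sqrt 2 != 0 :> R by rewrite sqrtr_eq0 -ltNge.
apply/integrableP; split.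
  by apply: measurable_EFin_comp; exact: measurable_funX.
rewrite ge0_integral_nuG//; last first.
  by apply: measurableT_comp => //; apply: measurable_EFin_comp; exact: measurable_funX.
pose C : R := 4 * (normal_peak 1 / normal_peak (Num.sqrt 2)).
have C0 : 0 <= C by rewrite mulr_ge0// divr_ge0// normal_peak_ge0.
apply: (@le_lt_trans _ _ (\int[leb]_y (C%:E * (normal_pdf 0 (Num.sqrt 2) y)%:E))%E).
  apply: ge0_le_integral => //.
  - by move=> y _; rewrite mule_ge0// lee_fin ltW// gauss_gt0.
  - apply: emeasurable_funM; last exact: measurable_gaussE.
    by apply: measurableT_comp => //; apply: measurable_EFin_comp; exact: measurable_funX.
  - by apply: emeasurable_funM => //; apply: measurableT_comp => //;
      exact: measurable_normal_pdf.
  - move=> y _; rewrite -!EFinM lee_fin ger0_norm ?sqr_ge0// gaussE normal_pdfE//.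
    rewrite /normal_fun subr0 sqr_sqrtr// /C.
    have P0 : 0 < normal_peak (Num.sqrt 2) :> R by rewrite normal_peak_gt0.
    have -> : 4 * (normal_peak 1 / normal_peak (Num.sqrt 2)) *
      (normal_peak (Num.sqrt 2) * expR (- y ^+ 2 / (2 *+ 2))) =
      normal_peak 1 * (4 * expR (- y ^+ 2 / 4)).
      have -> : 2 *+ 2 = 4 :> R by rewrite -mulr_natr; ring.
      by field; rewrite gt_eqF.
    rewrite mulrCA ler_wpM2l ?normal_peak_ge0//.
    have -> : - y ^+ 2 / 4 = y ^+ 2 / 4 - y ^+ 2 / 2 by field.
    by rewrite expRD mulrA ler_wpM2r ?expR_ge0// square_le_expR.
rewrite ge0_integralZl//.
- by rewrite integral_normal_pdf mule1 ltry.
- by apply: measurableT_comp => //; exact: measurable_normal_pdf.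
- by move=> y _; rewrite lee_fin normal_pdf_ge0.
Qed.

Lemma integrable_nuG (h : measurableTypeR R -> R) (C : R) : measurable_fun setT h ->
  (forall y, `|h y| <= C * (1 + y ^+ 2)) -> nuG.-integrable setT (EFin \o h).
Proof.
move=> mh hC.
have i1 : nuG.-integrable [set: measurableTypeR R] (fun y => (C * (1 + y ^+ 2))%:E).
  have iD : nuG.-integrable [set: measurableTypeR R] (fun y => 1%:E + (y ^+ 2)%:E)%E.
    apply: integrableD => //; last exact: integrable_sqr_nuG.
    exact: finite_measure_integrable_cst.
  by have := integrableZl measurableT C iD; apply: eq_integrable.
apply: (le_integrable measurableT _ _ i1); first exact: measurable_EFin_comp.
by move=> y _; rewrite /= lee_fin (le_trans (hC y))// ler_norm.
Qed.

Lemma continuous_measurableR (f : R -> R) : continuous f ->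
  measurable_fun [set: measurableTypeR R] (f : measurableTypeR R -> R).
Proof. exact: continuous_measurable_fun. Qed.

Lemma is_derive_continuous (f f' : R -> R) :
  (forall y : R, is_derive y 1 f (f' y)) -> continuous f.
Proof.
move=> df y; apply: differentiable_continuous; apply/derivable1_diffP.
by case: (df y).
Qed.

Lemma integrable_nuG_id (f : R -> R) C : continuous f ->
  (forall y, `|f y| <= C * (1 + `|y|)) ->
  nuG.-integrable [set: measurableTypeR R] (fun y => (y * f y)%:E).
Proof.
move=> cf fC; apply: (@integrable_nuG _ (2 * C)).
  by apply: measurable_funM => //; exact: continuous_measurableR.
move=> y; rewrite normrM.
have := fC y; have := fC 0; rewrite normr0 addr0 mulr1 => /(le_trans (normr_ge0 _)).
rewrite -[y ^+ 2]real_normK ?num_real//.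
have := normr_ge0 y; move: `|y| `|f y| => a b a0 C0 bC.
have : a * b <= a * (C * (1 + a)) by rewrite ler_wpM2l.
have : 0 <= C * (1 - a) ^+ 2 by rewrite mulr_ge0 ?sqr_ge0.
have : 0 <= C * (1 + a ^+ 2) by rewrite mulr_ge0 ?addr_ge0 ?sqr_ge0.
by rewrite !expr2; lra.
Qed.

Lemma integrable_nuG_lin (f : R -> R) C : continuous f ->
  (forall y, `|f y| <= C * (1 + `|y|)) ->
  nuG.-integrable [set: measurableTypeR R] (fun y => (f y)%:E).
Proof.
move=> cf fC; apply: (@integrable_nuG _ (2 * C)); first exact: continuous_measurableR.
move=> y; apply: (le_trans (fC y)).
have := fC 0; rewrite normr0 addr0 mulr1 => /(le_trans (normr_ge0 _)).
rewrite -[y ^+ 2]real_normK ?num_real//.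
move: `|y| => a C0.
have : 0 <= C * (1 - a) ^+ 2 by rewrite mulr_ge0 ?sqr_ge0.
have : 0 <= C * (1 + a ^+ 2) by rewrite mulr_ge0 ?addr_ge0 ?sqr_ge0.
have : 0 <= C * (a ^+ 2) by rewrite mulr_ge0 ?sqr_ge0.
by rewrite !expr2; lra.
Qed.

(** For the boundary terms of the integration by parts: (1 + |y|)^2 <= 4 exp (y^2 / 2) trades the
    linear growth of f for decay. *)
Lemma gauss_decay (f : R -> R) C y : (forall y, `|f y| <= C * (1 + `|y|)) ->
  `|f y * gauss y| <= 4 * C * normal_peak 1 / (1 + `|y|).
Proof.
move=> fC; rewrite normrM (gtr0_norm (gauss_gt0 y)) gaussE.
have C0 : 0 <= C.
  by have := fC 0; rewrite normr0 addr0 mulr1 => /(le_trans (normr_ge0 _)).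
have y1 : 0 < 1 + `|y| by rewrite ltr_pwDl.
rewrite ler_pdivlMr// expRN.
apply: (@le_trans _ _ (C * (1 + `|y|) * (normal_peak 1 * (expR (y ^+ 2 / 2))^-1) * (1 + `|y|))).
  rewrite ler_wpM2r ?(ltW y1)// ler_wpM2r//.
  by rewrite mulr_ge0 ?normal_peak_ge0 ?invr_ge0 ?expR_ge0.
have -> : C * (1 + `|y|) * (normal_peak 1 * (expR (y ^+ 2 / 2))^-1) * (1 + `|y|) =
  C * normal_peak 1 * ((1 + `|y|) ^+ 2 / expR (y ^+ 2 / 2)) by ring.
have -> : 4 * C * normal_peak 1 = C * normal_peak 1 * 4 by ring.
rewrite ler_wpM2l ?mulr_ge0 ?normal_peak_ge0// ler_pdivrMr ?expR_gt0//.
have := expR_ge1Dx (y ^+ 2 / 2); have := sqr_ge0 (`|y| - 1).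
rewrite -[y ^+ 2]real_normK ?num_real// !expr2; lra.
Qed.

(** Stein's identity: (f gauss)' = (f' - y f) gauss is integrated over bounded intervals, the
    boundary terms vanish in the limit, and dominated convergence gives the whole line. *)
Lemma gauss_ibp (f f' : R -> R) C : (forall y : R, is_derive y 1 f (f' y)) ->
  continuous f' -> (forall y, `|f y| <= C * (1 + `|y|)) ->
  (forall y, `|f' y| <= C * (1 + `|y|)) ->
  (\int[nuG]_y (y * f y) = \int[nuG]_y f' y)%R.
Proof.
move=> df cf' fC f'C; have cf := is_derive_continuous df.
have i1 := integrable_nuG_id cf fC; have i2 := integrable_nuG_lin cf' f'C.
apply/eqP; rewrite eq_sym -subr_eq0 -RintegralB//; apply/eqP.
pose h y := f' y - y * f y.
have ch : continuous h.
  by move=> y; apply: cvgB; [exact: cf'|apply: cvgM; [exact: cvg_id|exact: cf]].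
have ih : nuG.-integrable [set: measurableTypeR R] (fun y => (h y)%:E).
  by have := integrableB measurableT i2 i1; apply: eq_integrable.
(* The index is shifted by one so that the interval is nondegenerate already for n = 0. *)
pose K n : set (measurableTypeR R) :=
  [set` `[- (n.+1%:R : R), n.+1%:R]%R].
pose hn n y := (h y * \1_(K n) y)%:E.
have mhn n : measurable_fun [set: measurableTypeR R] (hn n).
  apply: measurable_EFin_comp; apply: measurable_funM.
    exact: continuous_measurableR.
  by apply: measurable_indic; exact: measurable_itv.
have hcv : {ae nuG, forall y, setT y -> hn n y @[n --> \oo] --> (h y)%:E}.
  apply: aeW => y _; apply: cvg_EFin; first exact: nearW.
  apply: (@cvg_trans _ ((fun=> h y) @ \oo)); last exact: cvg_cst.
  apply: near_eq_cvg; near=> n.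
  have yn : `|y| <= n.+1%:R.
    apply: ltW; near: n; exists (Num.trunc `|y|) => // n /= nn.
    by rewrite (lt_le_trans (truncnS_gt _))// ler_nat ltnS.
  rewrite /= indicE mem_set ?mulr1//.
  by rewrite /K /= in_itv/= -ler_norml.
have ia : nuG.-integrable [set: measurableTypeR R] (fun y => `|h y|%:E).
  by have := integrable_norm ih; apply: eq_integrable.
have dom : {ae nuG, forall y n, setT y -> (`|hn n y| <= `|h y|%:E)%E}.
  apply: aeW => y n _; rewrite /hn /= lee_fin normrM ler_piMr//.
  by rewrite indicE; case: (_ \in _); rewrite ?normr1 ?normr0.
have [_ _ hlim] := @dominated_convergence _ _ _ nuG setT measurableT hn
  (fun y => (h y)%:E) (fun y => `|h y|%:E) mhn (measurable_int _ ih) hcv ia dom.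
have E n : (\int[nuG]_y hn n y = (f n.+1%:R * gauss n.+1%:R -
    f (- n.+1%:R) * gauss (- n.+1%:R))%:E)%E.
  rewrite integral_nuG//.
  have nn : - n.+1%:R < n.+1%:R :> R by rewrite gtrN.
  have dF (y : R) : is_derive y 1 (fun y => f y * gauss y) (h y * gauss y).
    apply: (is_derive_eq (is_deriveM1 (df y) (is_derive_gauss y))).
    by rewrite /h; ring.
  have cF : continuous (fun y => f y * gauss y) by exact: is_derive_continuous dF.
  have chg : continuous (fun y => h y * gauss y).
    by move=> y; apply: continuousM; [exact: ch|exact: continuous_gauss].
  rewrite EFinB -(@continuous_FTC2 R (fun y => h y * gauss y) (fun y => f y * gauss y) _ _ nn).
  - rewrite [RHS]integral_mkcond; apply: eq_integral => y _.
    rewrite /hn patchE indicE; case: ifPn => yK; last by rewrite mulr0 mul0e.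
    by rewrite mulr1 -EFinM.
  - exact: continuous_subspaceT.
  - split.
    + by move=> y _; case: (dF y).
    + exact/cvg_at_right_filter/cF.
    + exact/cvg_at_left_filter/cF.
  - by move=> y _; rewrite derive1E; case: (dF y).
have lim0 : (\int[nuG]_y hn n y)%E @[n --> \oo] --> 0%:E.
  rewrite (_ : (fun n => _) = (fun n => (f n.+1%:R * gauss n.+1%:R -
    f (- n.+1%:R) * gauss (- n.+1%:R))%:E)); last by apply/funext => n; exact: E.
  apply: cvg_EFin; first exact: nearW.
  (* Two boundary terms, each at most 4 C [normal_peak 1] / (n + 1). *)
  pose c := 8 * C * normal_peak 1.
  apply: (@squeeze_cvgr _ _ _ _ (fun n => - (c * harmonic n)) (fun n => c * harmonic n)).
  - apply: nearW => n; rewrite /= -ler_norml (le_trans (ler_normB _ _))//.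
    have := gauss_decay n.+1%:R fC; have := gauss_decay (- n.+1%:R) fC.
    rewrite normrN [`|n.+1%:R|]ger0_norm//.
    set u := `|_|; set w := `|_| => uP wP.
    have P0 : 0 <= 4 * C * normal_peak 1.
      rewrite !mulr_ge0 ?normal_peak_ge0//.
      by have := fC 0; rewrite normr0 addr0 mulr1 => /(le_trans (normr_ge0 _)).
    have : 4 * C * normal_peak 1 / (1 + n.+1%:R) <= 4 * C * normal_peak 1 / n.+1%:R.
      by rewrite ler_wpM2l// lef_pV2 ?posrE// ?ltr_pwDl// lerDr.
    rewrite /c /harmonic /=; move: ((1 + n.+1%:R)^-1) (n.+1%:R^-1) uP wP.
    by move=> r1 r2 uP wP *; lra.
  - rewrite -oppr0; apply: cvgN; rewrite -(mulr0 c).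
    by apply: cvgM; [exact: cvg_cst|exact: cvg_harmonic].
  - rewrite -(mulr0 c).
    by apply: cvgM; [exact: cvg_cst|exact: cvg_harmonic].
have : (\int[nuG]_y (h y)%:E = 0)%E by exact: (cvg_unique _ hlim lim0).
by rewrite /Rintegral => ->.
Unshelve. all: by end_near. Qed.

End GaussianMeasure.

(** * Fubini and integration by parts in one coordinate *)

Section ProductMeasures.
Context {R : realType}.
Local Notation R1 := (measurableTypeR R).
Local Notation T2 := (measurableTypeR R * measurableTypeR R)%type.
Local Notation nuG := (@nuG R).

Section Fubini.
Variables m1 m2 : probability (measurableTypeR R) R.

(** Integrability is asked on every slice, so that the real-valued inner integral is the extended
    one at each x. *)
Lemma Rfubini12 (F : T2 -> R) :
  (m1 \x m2)%E.-integrable setT (fun p => (F p)%:E) ->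
  (forall x, m2.-integrable setT (fun y => (F (x, y))%:E)) ->
  (\int[(m1 \x m2)%E]_p F p = \int[m1]_x \int[m2]_y F (x, y))%R.
Proof.
move=> iF iFx; rewrite /Rintegral; congr fine.
rewrite -(integral12_prod_meas1 iF); apply: eq_integral => x _.
by rewrite /fubini_F fineK//; exact: integrable_fin_num.
Qed.

Lemma Rfubini21 (F : T2 -> R) :
  (m1 \x m2)%E.-integrable setT (fun p => (F p)%:E) ->
  (forall y, m1.-integrable setT (fun x => (F (x, y))%:E)) ->
  (\int[(m1 \x m2)%E]_p F p = \int[m2]_y \int[m1]_x F (x, y))%R.
Proof.
move=> iF iFx; rewrite /Rintegral; congr fine.
rewrite -(integral21_prod_meas1 iF); apply: eq_integral => x _.
by rewrite /fubini_G fineK//; exact: integrable_fin_num.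
Qed.

End Fubini.

Lemma measurable_fst_sqr : measurable_fun [set: T2] (fun p : T2 => p.1 ^+ 2).
Proof. by apply: measurable_funX; exact: measurable_fst. Qed.

Lemma measurable_snd_sqr : measurable_fun [set: T2] (fun p : T2 => p.2 ^+ 2).
Proof. by apply: measurable_funX; exact: measurable_snd. Qed.

Lemma integrable_snd_sqr (m1 : probability (measurableTypeR R) R) :
  (m1 \x nuG)%E.-integrable [set: T2] (fun p => (p.2 ^+ 2)%:E).
Proof.
apply/integrable12ltyP; first by apply: measurable_EFin_comp; exact: measurable_snd_sqr.
have := @integrable_sqr_nuG R => /integrableP[_]; set K := integral _ _ _ => lty.
rewrite (_ : integral _ _ _ = \int[m1]_x cst K x)%E//.
rewrite integral_cst//.
by have P1 := probability_setT m1; rewrite [X in (_ * X)%E]P1 mule1.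
Qed.

Lemma integrable_fst_sqr :
  (nuG \x nuG)%E.-integrable [set: T2] (fun p => (p.1 ^+ 2)%:E).
Proof.
apply/integrable21ltyP; first by apply: measurable_EFin_comp; exact: measurable_fst_sqr.
have := @integrable_sqr_nuG R => /integrableP[_]; set K := integral _ _ _ => lty.
rewrite (_ : integral _ _ _ = \int[nuG]_x cst K x)%E//.
rewrite integral_cst//.
by have P1 := probability_setT nuG; rewrite [X in (_ * X)%E]P1 mule1.
Qed.

Lemma integrable_growth2 (F : T2 -> R) (C : R) : measurable_fun setT F ->
  (forall p, `|F p| <= C * (1 + p.1 ^+ 2 + p.2 ^+ 2)) ->
  (nuG \x nuG)%E.-integrable setT (fun p => (F p)%:E).
Proof.
move=> mF FC.
have i1 : (nuG \x nuG)%E.-integrable [set: T2] (fun p => (C * (1 + p.1 ^+ 2 + p.2 ^+ 2))%:E).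
  have iD := integrableD measurableT (integrableD measurableT
    (@finite_measure_integrable_cst _ T2 R ((nuG \x nuG)%E : probability T2 R) setT 1%R measurableT)
    integrable_fst_sqr) (integrable_snd_sqr nuG).
  by have := integrableZl measurableT C iD; apply: eq_integrable.
apply: (le_integrable measurableT _ _ i1); first exact: measurable_EFin_comp.
by move=> y _; rewrite /= lee_fin (le_trans (FC y))// ler_norm.
Qed.

Lemma integrable_growth_snd (m1 : probability (measurableTypeR R) R)
    (F : T2 -> R) (C : R) : measurable_fun setT F ->
  (forall p, `|F p| <= C * (1 + p.2 ^+ 2)) ->
  (m1 \x nuG)%E.-integrable setT (fun p => (F p)%:E).
Proof.
move=> mF FC.
have i1 : (m1 \x nuG)%E.-integrable [set: T2] (fun p => (C * (1 + p.2 ^+ 2))%:E).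
  have iD := integrableD measurableT
    (@finite_measure_integrable_cst _ T2 R ((m1 \x nuG)%E : probability T2 R) setT 1%R measurableT)
    (integrable_snd_sqr m1).
  by have := integrableZl measurableT C iD; apply: eq_integrable.
apply: (le_integrable measurableT _ _ i1); first exact: measurable_EFin_comp.
by move=> y _; rewrite /= lee_fin (le_trans (FC y))// ler_norm.
Qed.

Lemma slice1_continuous (F : R * R -> R) x : continuous F -> continuous (fun y : R => F (x, y)).
Proof.
move=> cF y; apply: (@cvg_comp _ _ _ (fun y : R => (x, y)) F _ (nbhs (x, y))).
  by apply: (@cvg_pair _ _ _ _ (nbhs x) (nbhs y) _ _ _ (fun=> x) id); [exact: cvg_cst|exact: cvg_id].
exact: cF.
Qed.

Lemma slice2_continuous (F : R * R -> R) y : continuous F -> continuous (fun x : R => F (x, y)).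
Proof.
move=> cF x; apply: (@cvg_comp _ _ _ (fun x : R => (x, y)) F _ (nbhs (x, y))).
  by apply: (@cvg_pair _ _ _ _ (nbhs x) (nbhs y) _ _ _ id (fun=> y)); [exact: cvg_id|exact: cvg_cst].
exact: cF.
Qed.

Lemma lin_growth_ge0 (f : R -> R) (C : R) : (forall y, `|f y| <= C * (1 + `|y|)) -> 0 <= C.
Proof. by move=> /(_ 0); rewrite normr0 addr0 mulr1 => /(le_trans (normr_ge0 _)). Qed.

Lemma lin_growth_sqr (C a b : R) : 0 <= C -> `|a| <= C * (1 + `|b|) ->
  `|a| <= 2 * C * (1 + b ^+ 2) /\ `|b * a| <= 2 * C * (1 + b ^+ 2).
Proof.
move=> C0; rewrite normrM -[b ^+ 2]real_normK ?num_real//.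
have := normr_ge0 b; move: `|b| `|a| => u w u0 wC.
have h1 : 0 <= C * (1 - u) ^+ 2 by rewrite mulr_ge0 ?sqr_ge0.
have h2 : 0 <= C * (u ^+ 2) by rewrite mulr_ge0 ?sqr_ge0.
have h3 : u * w <= u * (C * (1 + u)) by rewrite ler_wpM2l.
by rewrite !expr2 in h1 h2 *; split; lra.
Qed.

(** The first marginal is arbitrary because the identity serves both in phase space ([muT]) and for
    the Gaussian noise ([nuG]); linear growth in v accommodates integrands such as v h^2. *)
Lemma gauss_ibp_snd (m1 : probability (measurableTypeR R) R) (F F' : R * R -> R) C :
  continuous F -> continuous F' ->
  (forall x v : R, is_derive v 1 (fun s => F (x, s)) (F' (x, v))) ->
  (forall x v, `|F (x, v)| <= C * (1 + `|v|)) ->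
  (forall x v, `|F' (x, v)| <= C * (1 + `|v|)) ->
  (\int[(m1 \x nuG)%E]_p (p.2 * F p) = \int[(m1 \x nuG)%E]_p F' p)%R.
Proof.
move=> cF cF' dF FC F'C; have C0 := lin_growth_ge0 (FC 0).
have mF := continuous_measurable2 cF; have mF' := continuous_measurable2 cF'.
rewrite !Rfubini12.
- apply: eq_Rintegral => x _ /=.
  exact: (gauss_ibp (dF x) (slice1_continuous (x := x) cF') (FC x) (F'C x)).
- apply: (@integrable_growth_snd _ _ (2 * C)) => // -[x v].
  exact: (lin_growth_sqr C0 (F'C x v)).1.
- by move=> x; apply: (@integrable_nuG_lin _ _ C) => //; exact: slice1_continuous.
- apply: (@integrable_growth_snd _ _ (2 * C)) => [|[x v]].
    by apply: measurable_funM => //; exact: measurable_snd.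
  exact: (lin_growth_sqr C0 (FC x v)).2.
- by move=> x; apply: (@integrable_nuG_id _ _ C) => //; exact: slice1_continuous.
Qed.

Lemma gauss_ibp_fst (F F' : R * R -> R) C :
  continuous F -> continuous F' ->
  (forall x v : R, is_derive x 1 (fun s => F (s, v)) (F' (x, v))) ->
  (forall p, `|F p| <= C) -> (forall p, `|F' p| <= C) ->
  (\int[(nuG \x nuG)%E]_p (p.1 * F p) = \int[(nuG \x nuG)%E]_p F' p)%R.
Proof.
move=> cF cF' dF FC F'C; have C0 : 0 <= C by exact: le_trans (FC (0, 0)).
have CL (x : R) : C <= C * (1 + `|x|) by rewrite ler_peMr// lerDl.
have mF := continuous_measurable2 cF; have mF' := continuous_measurable2 cF'.
have gr (C' a b : R) : 0 <= C' -> C' * (1 + a ^+ 2) <= C' * (1 + a ^+ 2 + b ^+ 2).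
  by move=> ?; rewrite ler_wpM2l// lerDl sqr_ge0.
have C2 : 0 <= 2 * C by rewrite mulr_ge0.
rewrite !Rfubini21.
- apply: eq_Rintegral => y _ /=.
  apply: (gauss_ibp (fun x => dF x y) (slice2_continuous (y := y) cF')) => x.
    exact: le_trans (FC _) (CL x).
  exact: le_trans (F'C _) (CL x).
- apply: (@integrable_growth2 _ (2 * C)) => // -[x v].
  exact: le_trans (lin_growth_sqr C0 (le_trans (F'C (x, v)) (CL x))).1 (gr _ _ _ C2).
- move=> y; apply: (@integrable_nuG_lin _ _ C); first exact: slice2_continuous.
  by move=> x; exact: le_trans (F'C _) (CL x).
- apply: (@integrable_growth2 _ (2 * C)) => [|[x v]].
    by apply: measurable_funM => //; exact: measurable_fst.
  exact: le_trans (lin_growth_sqr C0 (le_trans (FC (x, v)) (CL x))).2 (gr _ _ _ C2).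
- move=> y; apply: (@integrable_nuG_id _ _ C); first exact: slice2_continuous.
  by move=> x; exact: le_trans (FC _) (CL x).
Qed.

Lemma integrable_muT (f : R -> R) : continuous f ->
  muT.-integrable [set: R1] (fun x => (f x)%:E).
Proof.
move=> cf; apply/integrableP; split.
  by apply: measurable_EFin_comp; exact: continuous_measurableR.
rewrite integral_uniform//; last first.
  by apply: measurableT_comp => //; apply: measurable_EFin_comp; exact: continuous_measurableR.
rewrite subr0 invr1 mul1e.
have : lebesgue_measure.-integrable `[0, 1] (EFin \o f).
  by apply: continuous_compact_integrable; [exact: segment_compact|exact: continuous_subspaceT].
by move=> /integrableP[].
Qed.

Lemma Rintegral_muT_derive (f f' : R -> R) : (forall x : R, is_derive x 1 f (f' x)) ->
  continuous f' -> f 1 = f 0 -> (\int[muT]_x f' x = 0)%R.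
Proof.
move=> df cf' f10; have cf := is_derive_continuous df.
have mf' := continuous_measurableR cf'.
have E : (\int[muT]_x (f' x)%:E = \int[lebesgue_measure]_(x in `[0%R, 1%R]) (f' x)%:E)%E.
  rewrite [RHS]integralE [LHS]integralE.
  have mE : measurable_fun [set: R1] (fun x => (f' x)%:E) by exact: measurable_EFin_comp.
  rewrite !integral_uniform ?subr0 ?invr1 ?mul1e//.
    exact: measurable_funeneg.
  exact: measurable_funepos.
rewrite /Rintegral E (@continuous_FTC2 R f' f 0 1 ltr01).
- by rewrite f10 -EFinB subrr.
- exact: continuous_subspaceT.
- split.
  + by move=> y _; case: (df y).
  + exact/cvg_at_right_filter/cf.
  + exact/cvg_at_left_filter/cf.
- by move=> y _; rewrite derive1E; case: (df y).
Qed.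

Lemma Rintegral_dx (F F' : R * R -> R) C :
  continuous F' ->
  (forall x v : R, is_derive x 1 (fun s => F (s, v)) (F' (x, v))) ->
  (forall v, F (1, v) = F (0, v)) ->
  (forall x v, `|F' (x, v)| <= C * (1 + `|v|)) ->
  (\int[munu]_p F' p = 0)%R.
Proof.
move=> cF' dF F10 F'C; have C0 := lin_growth_ge0 (F'C 0).
have mF' := continuous_measurable2 cF'.
rewrite Rfubini21.
- transitivity (\int[nuG]_v (cst 0 v))%R; last first.
    by rewrite Rintegral_cst// mul0r.
  apply: eq_Rintegral => v _.
  exact: (Rintegral_muT_derive (fun x => dF x v) (slice2_continuous (y := v) cF')).
- apply: (@integrable_growth_snd _ _ (2 * C)) => // -[x v].
  exact: (lin_growth_sqr C0 (F'C x v)).1.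
- by move=> v; apply: integrable_muT; exact: slice2_continuous.
Qed.

End ProductMeasures.

(** * The chain rule along curves *)

Section CurveDerivatives.
Context {R : realType}.

Lemma is_derive_sqr_center (f : R -> R) (s l : R) : is_derive s 1 f l ->
  is_derive s 1 (fun u => (f u - f s) ^+ 2) 0.
Proof.
move=> df; have d1 := is_deriveB df (is_derive_cst (f s) s 1).
apply: (is_derive_eq (is_deriveM1 d1 d1)).
by rewrite !fctE /= subrr mulr0 mul0r addr0.
Qed.

(** f is replaced by its linearization h: the difference is dominated by a function with vanishing
    value and derivative at s. *)
Lemma is_derive_approx (f h g : R -> R) (s l K : R) : is_derive s 1 h l ->
  is_derive s 1 g 0 -> g s = 0 -> f s = h s ->
  (forall u, `|f u - h u| <= K * `|g u|) -> is_derive s 1 f l.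
Proof.
move=> dh dg gs fs fh.
have dr : is_derive s 1 (fun u => f u - h u) 0.
  by apply: (is_derive_dominated dg gs _ fh); rewrite fs subrr.
have -> : f = (fun u => (f u - h u) + h u) by apply/funext => u; rewrite subrK.
by apply: (is_derive_eq (is_deriveD dr dh)); rewrite add0r.
Qed.

Lemma sqr_sum2_le (a b : R) : (a + b) ^+ 2 <= 2 * (a ^+ 2 + b ^+ 2).
Proof. by have := sqr_ge0 (a - b); rewrite sqrrB sqrrD; lra. Qed.

(** [Ck] speaks of partial derivatives only; the uniform Taylor expansion supplies the total
    differentiability that a chain rule needs. *)
Lemma test_curve (phi : R * R -> R) (al be : R -> R) (s a b : R) : test_function phi ->
  is_derive s 1 al a -> is_derive s 1 be b ->
  is_derive s 1 (fun u => phi (al u, be u))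
    (a * dx phi (al s, be s) + b * dv phi (al s, be s)).
Proof.
move=> T da db; have [K K0 KP] := test_taylor T.
pose x := al s; pose v := be s.
apply: (@is_derive_approx _
  (fun u => phi (x, v) + ((al u - x) * dx phi (x, v) + (be u - v) * dv phi (x, v)))
  (fun u => (al u - x) ^+ 2 + (be u - v) ^+ 2) s _ (K * 2)).
- have d1 := is_deriveB da (is_derive_cst x s 1).
  have d2 := is_deriveB db (is_derive_cst v s 1).
  have d3 := is_deriveD (is_deriveM1 d1 (is_derive_cst (dx phi (x, v)) s 1))
                        (is_deriveM1 d2 (is_derive_cst (dv phi (x, v)) s 1)).
  apply: (is_derive_eq (is_deriveD (is_derive_cst (phi (x, v)) s 1) d3)).
  by rewrite /cst /=; ring.
- apply: (is_derive_eq (is_deriveD (is_derive_sqr_center da) (is_derive_sqr_center db))).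
  by rewrite addr0.
- by rewrite /x /v !subrr expr0n addr0.
- by rewrite /x /v !subrr !mul0r !addr0.
- move=> u; have := KP x v (al u - x) (be u - v).
  have -> : x + (al u - x) = al u by ring.
  have -> : v + (be u - v) = be u by ring.
  move=> H; rewrite opprD addrA; apply: (le_trans H).
  rewrite -mulrA ler_wpM2l//.
  rewrite [X in 2 * X]ger0_norm ?addr_ge0 ?sqr_ge0//.
  apply: le_trans (sqr_sum2_le _ _) _.
  by rewrite !real_normK ?num_real.
Qed.

End CurveDerivatives.

(** * Expectation over two independent standard Gaussians *)

Section GaussianAverage.
Context {R : realType}.
Local Notation T2 := (measurableTypeR R * measurableTypeR R)%type.
Local Notation gam := (@nuG R \x @nuG R)%E.
Implicit Types phi psi : R * R -> R.

Definition E2 (F : R * R -> R) : R := (\int[gam]_z F z)%R.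

(** A class stable under the linear operations on which [E2] is linear and monotone; second-order
    Taylor remainders grow quadratically in the noise. *)
Definition quad_growth (F : R * R -> R) := measurable_fun [set: T2] (F : T2 -> R) /\
  exists C, forall z, `|F z| <= C * (1 + z.1 ^+ 2 + z.2 ^+ 2).

Lemma quad_growth_integrable F : quad_growth F ->
  gam.-integrable [set: T2] (fun z => (F z)%:E).
Proof. by move=> [mF [C FC]]; exact: integrable_growth2 FC. Qed.

Lemma quad_growthD F G : quad_growth F -> quad_growth G ->
  quad_growth (fun z => F z + G z).
Proof.
move=> [mF [C FC]] [mG [D GD]]; split; first exact: measurable_funD.
exists (C + D) => z; rewrite (le_trans (ler_normD _ _))//.
by have := FC z; have := GD z; lra.
Qed.

Lemma quad_growthZ c F : quad_growth F -> quad_growth (fun z => c * F z).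
Proof.
move=> [mF [C FC]]; split; first by apply: measurable_funM => //.
exists (`|c| * C) => z; rewrite normrM -mulrA.
by rewrite ler_wpM2l.
Qed.

Lemma quad_growthN F : quad_growth F -> quad_growth (fun z => - F z).
Proof.
by move=> /(quad_growthZ (-1)); rewrite (_ : (fun z => _) = (fun z => - F z))//;
  apply/funext => z; rewrite mulN1r.
Qed.

Lemma quad_growthB F G : quad_growth F -> quad_growth G ->
  quad_growth (fun z => F z - G z).
Proof. by move=> qF qG; apply: quad_growthD => //; exact: quad_growthN. Qed.

Lemma E2D F G : quad_growth F -> quad_growth G ->
  E2 (fun z => F z + G z) = E2 F + E2 G.
Proof. by move=> qF qG; apply: RintegralD => //; exact: quad_growth_integrable. Qed.

Lemma E2B F G : quad_growth F -> quad_growth G ->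
  E2 (fun z => F z - G z) = E2 F - E2 G.
Proof. by move=> qF qG; apply: RintegralB => //; exact: quad_growth_integrable. Qed.

Lemma E2Z c F : quad_growth F -> E2 (fun z => c * F z) = c * E2 F.
Proof. by move=> qF; apply: RintegralZl => //; exact: quad_growth_integrable. Qed.

Lemma E2_le F G : quad_growth F -> quad_growth G -> (forall z, F z <= G z) -> E2 F <= E2 G.
Proof. by move=> qF qG FG; apply: le_Rintegral => //; exact: quad_growth_integrable. Qed.

Lemma E2_cst c : E2 (fun=> c) = c.
Proof.
have := @Rintegral_cst _ T2 R (gam : probability T2 R) setT measurableT c.
rewrite /E2 => ->.
by have P1 := @probability_setT _ T2 R (gam : probability T2 R); rewrite [X in c * X](congr1 fine P1) mulr1.
Qed.

Lemma quad_growth_bounded (F : R * R -> R) C : continuous F -> (forall z, `|F z| <= C) ->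
  quad_growth F.
Proof.
move=> cF FC; split; first exact: continuous_measurable2.
have C0 : 0 <= C by exact: le_trans (FC (0, 0)).
exists C => z; apply: (le_trans (FC z)).
by rewrite ler_peMr// -addrA lerDl addr_ge0 ?sqr_ge0.
Qed.

Lemma quad_growth_mul_bounded (L F : R * R -> R) C D : continuous F ->
  (forall z, `|F z| <= C) ->
  measurable_fun [set: T2] (L : T2 -> R) ->
  (forall z, `|L z| <= D * (1 + z.1 ^+ 2 + z.2 ^+ 2)) ->
  quad_growth (fun z => L z * F z).
Proof.
move=> cF FC mL LD; split.
  by apply: measurable_funM => //; exact: continuous_measurable2.
have C0 : 0 <= C by exact: le_trans (FC (0, 0)).
exists (D * C) => z; rewrite normrM mulrAC.
by apply: ler_pM.
Qed.

Let abs_quad (a : R) : `|a| <= 1 + a ^+ 2.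
Proof.
rewrite -[a ^+ 2]real_normK ?num_real//.
have := sqr_ge0 (`|a| - 1); rewrite sqrrB; have := normr_ge0 a; lra.
Qed.

Lemma quad_growth_fst (F : R * R -> R) C : continuous F -> (forall z, `|F z| <= C) ->
  quad_growth (fun z => z.1 * F z).
Proof.
move=> cF FC; apply: (quad_growth_mul_bounded (L := fun z => z.1) (D := 1) cF FC).
  exact: measurable_fst.
by move=> z; rewrite mul1r (le_trans (abs_quad _))// lerDl sqr_ge0.
Qed.

Lemma quad_growth_snd (F : R * R -> R) C : continuous F -> (forall z, `|F z| <= C) ->
  quad_growth (fun z => z.2 * F z).
Proof.
move=> cF FC; apply: (quad_growth_mul_bounded (L := fun z => z.2) (D := 1) cF FC).
  exact: measurable_snd.
by move=> z; rewrite mul1r (le_trans (abs_quad _))// addrAC lerDl sqr_ge0.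
Qed.

Lemma quad_growth_quad : quad_growth (fun z => 1 + z.1 ^+ 2 + z.2 ^+ 2).
Proof.
split.
  apply: measurable_funD; last exact: measurable_snd_sqr.
  by apply: measurable_funD => //; exact: measurable_fst_sqr.
by exists 1 => z; rewrite mul1r ger0_norm// !addr_ge0 ?sqr_ge0.
Qed.

Lemma E2_bound F c : quad_growth F ->
  (forall z, `|F z| <= c * (1 + z.1 ^+ 2 + z.2 ^+ 2)) ->
  `|E2 F| <= c * E2 (fun z => 1 + z.1 ^+ 2 + z.2 ^+ 2).
Proof.
move=> qF Fc; rewrite -E2Z; last exact: quad_growth_quad.
have qq := quad_growthZ c quad_growth_quad.
rewrite ler_norml; apply/andP; split.
  rewrite lerNl -mulN1r -E2Z//; apply: E2_le => // [|z]; first exact: quad_growthZ.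
  by rewrite mulN1r lerNl; have := Fc z; rewrite ler_norml => /andP[].
by apply: E2_le => // z; exact: le_trans (ler_norm _) (Fc z).
Qed.

Lemma E2_bounded F C : continuous F -> (forall z, `|F z| <= C) -> `|E2 F| <= C.
Proof.
move=> cF FC; have qF := quad_growth_bounded cF FC.
have qc c : quad_growth (fun=> c).
  by apply: (@quad_growth_bounded _ `|c|) => //; exact: cst_continuous.
rewrite ler_norml; apply/andP; split.
  rewrite -[X in X <= _](E2_cst (- C)); apply: E2_le => // z.
  by have := FC z; rewrite ler_norml => /andP[].
rewrite -[X in _ <= X](E2_cst C); apply: E2_le => // z.
exact: le_trans (ler_norm _) (FC z).
Qed.

End GaussianAverage.

(** * Gaussian averages along affine maps and their derivatives in the parameters *)

Section GaussianShift.
Context {R : realType}.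
Implicit Types phi psi : R * R -> R.

Definition aff (x v a b d : R) (z : R * R) : R * R :=
  (x + a * z.1 + b * z.2, v + d * z.2).

(** The mean and the noise coefficients are five free parameters, so the derivatives of the
    semigroup in x, in v and in time are all instances of one chain rule. *)
Definition W psi (x v a b d : R) : R := E2 (fun z => psi (aff x v a b d z)).

Lemma continuous_aff x v a b d : continuous (aff x v a b d).
Proof.
move=> z; apply: (@cvg_pair _ _ _ _ (nbhs (aff x v a b d z).1) (nbhs (aff x v a b d z).2) _ _ _
  (fun z => x + a * z.1 + b * z.2) (fun z => v + d * z.2)).
  apply: cvgD; last by apply: cvgM; [exact: cvg_cst|exact: cvg_snd].
  apply: cvgD; first exact: cvg_cst.
  by apply: cvgM; [exact: cvg_cst|exact: cvg_fst].
apply: cvgD; first exact: cvg_cst.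
by apply: cvgM; [exact: cvg_cst|exact: cvg_snd].
Qed.

Lemma continuous_test_aff psi x v a b d : test_function psi ->
  continuous (fun z => psi (aff x v a b d z)).
Proof.
move=> T z; apply: (@cvg_comp _ _ _ (aff x v a b d) psi _ (nbhs (aff x v a b d z))).
  exact: continuous_aff.
exact: test_continuous.
Qed.

Lemma quad_growth_test psi x v a b d : test_function psi ->
  quad_growth (fun z => psi (aff x v a b d z)).
Proof.
move=> T; have [K _ KP] := test_bounded T.
by apply: (@quad_growth_bounded _ _ K) => //; exact: continuous_test_aff.
Qed.

Lemma quad_growth_test1 psi x v a b d : test_function psi ->
  quad_growth (fun z => z.1 * psi (aff x v a b d z)).
Proof.
move=> T; have [K _ KP] := test_bounded T.
by apply: (@quad_growth_fst _ _ K) => //; exact: continuous_test_aff.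
Qed.

Lemma quad_growth_test2 psi x v a b d : test_function psi ->
  quad_growth (fun z => z.2 * psi (aff x v a b d z)).
Proof.
move=> T; have [K _ KP] := test_bounded T.
by apply: (@quad_growth_snd _ _ K) => //; exact: continuous_test_aff.
Qed.

Lemma WD f g x v a b d : test_function f -> test_function g ->
  W (fun p => f p + g p) x v a b d = W f x v a b d + W g x v a b d.
Proof. by move=> Tf Tg; apply: E2D; exact: quad_growth_test. Qed.

Lemma WZ c f x v a b d : test_function f ->
  W (fun p => c * f p) x v a b d = c * W f x v a b d.
Proof. by move=> Tf; apply: E2Z; exact: quad_growth_test. Qed.

Lemma W_bounded f C x v a b d : test_function f -> (forall p, `|f p| <= C) ->
  `|W f x v a b d| <= C.
Proof. by move=> T fC; apply: E2_bounded => //; exact: continuous_test_aff. Qed.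

Lemma is_derive_affine (c e s : R) : is_derive s 1 (fun u => c + e * u) e.
Proof.
have d1 := is_deriveM1 (is_derive_cst e s 1) (is_derive_id s 1).
apply: (is_derive_eq (is_deriveD (is_derive_cst c s 1) d1)).
by rewrite /cst mul0r !add0r mulr1.
Qed.

(** Read from right to left it removes a derivative from psi, which is the smoothing effect; read
    from left to right it turns the derivative of [W] in a noise coefficient into second derivatives
    of psi. *)
Lemma W_fst psi x v a b d : test_function psi ->
  E2 (fun z => z.1 * psi (aff x v a b d z)) = a * W (dx psi) x v a b d.
Proof.
move=> T; have Tx := test_dx T.
have [K1 K10 K1P] := test_bounded T; have [K2 K20 K2P] := test_bounded Tx.
rewrite -E2Z; last exact: quad_growth_test.
apply: (@gauss_ibp_fst R (fun z => psi (aff x v a b d z))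
  (fun z => a * dx psi (aff x v a b d z)) (K1 + `|a| * K2)).
- exact: continuous_test_aff.
- move=> z; apply: cvgM; [exact: cvg_cst|exact: continuous_test_aff].
- move=> z1 z2.
  have d1 : is_derive z1 1 (fun u : R => x + a * u + b * z2) a.
    rewrite (_ : (fun u => _) = (fun u => (x + b * z2) + a * u)).
      exact: is_derive_affine.
    by apply/funext => u; ring.
  have d2 := test_curve T d1 (is_derive_cst (v + d * z2) z1 1).
  by apply: (is_derive_eq d2); rewrite mul0r addr0.
- by move=> z; rewrite (le_trans (K1P _))// lerDl mulr_ge0.
- by move=> z; rewrite normrM (@le_trans _ _ (`|a| * K2))// ?ler_wpM2l// lerDr.
Qed.

Lemma W_snd psi x v a b d : test_function psi ->
  E2 (fun z => z.2 * psi (aff x v a b d z)) =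
  b * W (dx psi) x v a b d + d * W (dv psi) x v a b d.
Proof.
move=> T; have Tx := test_dx T; have Tv := test_dv T.
have [K1 K10 K1P] := test_bounded T; have [K2 K20 K2P] := test_bounded Tx.
have [K3 K30 K3P] := test_bounded Tv.
rewrite -!E2Z; try exact: quad_growth_test.
rewrite -E2D; try by apply: quad_growthZ; exact: quad_growth_test.
pose C := K1 + (`|b| * K2 + `|d| * K3).
have C0 : 0 <= C by rewrite !addr_ge0// !mulr_ge0.
have CL (y : R) : C <= C * (1 + `|y|) by rewrite ler_peMr// lerDl.
apply: (@gauss_ibp_snd R (@nuG R) (fun z => psi (aff x v a b d z))
  (fun z => b * dx psi (aff x v a b d z) + d * dv psi (aff x v a b d z)) C).
- exact: continuous_test_aff.
- by move=> z; apply: cvgD; apply: cvgM; try exact: cvg_cst; exact: continuous_test_aff.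
- move=> z1 z2.
  have d1 := is_derive_affine (x + a * z1) b z2.
  exact: (test_curve T d1 (is_derive_affine v d z2)).
- move=> z1 z2; apply: le_trans (CL z2); rewrite (le_trans (K1P _))// lerDl.
  by rewrite addr_ge0// mulr_ge0.
- move=> z1 z2; apply: le_trans (CL z2); rewrite (le_trans (ler_normD _ _))//.
  rewrite !normrM; apply: ler_wpDl; first exact: K10.
  apply: lerD; apply: ler_wpM2l; [exact: normr_ge0|exact: K2P|exact: normr_ge0|exact: K3P].
Qed.

Definition comb5 (c1 c2 c3 c4 c5 w1 w2 w3 w4 w5 : R) :=
  c1 * w1 + c2 * w2 + c3 * w3 + c4 * w4 + c5 * w5.

(** The differential of [W]: the entries for a, b, d are the averages of X dx psi, Y dx psi and Y dv
    psi, already rewritten by [W_fst] and [W_snd]. *)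
Definition W_gradient psi (x v a b d ex ev ea eb ed : R) :=
  comb5 ex ev ea eb ed (W (dx psi) x v a b d) (W (dv psi) x v a b d)
    (a * W (dx (dx psi)) x v a b d)
    (b * W (dx (dx psi)) x v a b d + d * W (dv (dx psi)) x v a b d)
    (b * W (dx (dv psi)) x v a b d + d * W (dv (dv psi)) x v a b d).

Let is_derive_comb5 (f1 f2 f3 f4 f5 : R -> R) (s l1 l2 l3 l4 l5 w1 w2 w3 w4 w5 : R) :
  is_derive s 1 f1 l1 -> is_derive s 1 f2 l2 -> is_derive s 1 f3 l3 ->
  is_derive s 1 f4 l4 -> is_derive s 1 f5 l5 -> forall c : R,
  is_derive s 1 (fun u => c + comb5 (f1 u - f1 s) (f2 u - f2 s) (f3 u - f3 s)
    (f4 u - f4 s) (f5 u - f5 s) w1 w2 w3 w4 w5) (comb5 l1 l2 l3 l4 l5 w1 w2 w3 w4 w5).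
Proof.
move=> d1 d2 d3 d4 d5 c.
have dB (f : R -> R) (l : R) : is_derive s 1 f l -> forall k : R,
    is_derive s 1 (fun u => (f u - f s) * k) (l * k).
  move=> df k; have e := is_deriveB df (is_derive_cst (f s) s 1).
  apply: (is_derive_eq (is_deriveM1 e (is_derive_cst k s 1))).
  by rewrite /cst mulr0 addr0 subr0.
have dd := is_deriveD (is_deriveD (is_deriveD (is_deriveD
  (dB _ _ d1 w1) (dB _ _ d2 w2)) (dB _ _ d3 w3)) (dB _ _ d4 w4)) (dB _ _ d5 w5).
by apply: (is_derive_eq (is_deriveD (is_derive_cst c s 1) dd)); rewrite add0r.
Qed.

Let comb5_0 w1 w2 w3 w4 w5 : comb5 0 0 0 0 0 w1 w2 w3 w4 w5 = 0.
Proof. by rewrite /comb5; ring. Qed.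

Let quad_bound (ex ev ea eb ed u w : R) :
  2 * ((ex + ea * u + eb * w) ^+ 2 + (ev + ed * w) ^+ 2) <=
  6 * (ex ^+ 2 + ev ^+ 2 + ea ^+ 2 + eb ^+ 2 + ed ^+ 2) * (1 + u ^+ 2 + w ^+ 2).
Proof.
have := sqr_ge0 (ex - ea * u); have := sqr_ge0 (ex - eb * w).
have := sqr_ge0 (ea * u - eb * w); have := sqr_ge0 (ev - ed * w).
rewrite !expr2.
have nn (s t : R) : 0 <= (s * s) * (t * t) by rewrite -!expr2 mulr_ge0 ?sqr_ge0.
have n1 (s : R) : 0 <= s * s by rewrite -expr2 sqr_ge0.
have := nn ex u; have := nn ex w; have := nn ea w; have := nn eb u.
have := nn ev u; have := nn ev w; have := nn ed u; have := nn ed w.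
have := nn ea u; have := nn eb w.
have := n1 ex; have := n1 ev; have := n1 ea; have := n1 eb; have := n1 ed.
clear nn n1; lra.
Qed.

Lemma E2_comb5 (f1 f2 f3 f4 f5 : R * R -> R) (c1 c2 c3 c4 c5 : R) :
  quad_growth f1 -> quad_growth f2 -> quad_growth f3 -> quad_growth f4 ->
  quad_growth f5 ->
  let F z := comb5 c1 c2 c3 c4 c5 (f1 z) (f2 z) (f3 z) (f4 z) (f5 z) in
  quad_growth F /\
  E2 F = comb5 c1 c2 c3 c4 c5 (E2 f1) (E2 f2) (E2 f3) (E2 f4) (E2 f5).
Proof.
move=> q1 q2 q3 q4 q5 F.
have g1 := quad_growthZ c1 q1; have g2 := quad_growthZ c2 q2.
have g3 := quad_growthZ c3 q3; have g4 := quad_growthZ c4 q4.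
have g5 := quad_growthZ c5 q5.
have g12 := quad_growthD g1 g2; have g123 := quad_growthD g12 g3.
have g1234 := quad_growthD g123 g4.
split; first exact: quad_growthD.
rewrite (E2D g1234 g5) (E2D g123 g4) (E2D g12 g3) (E2D g1 g2).
by rewrite (E2Z _ q1) (E2Z _ q2) (E2Z _ q3) (E2Z _ q4) (E2Z _ q5).
Qed.

Let E2_remainder (G f0 F : R * R -> R) : quad_growth G -> quad_growth f0 ->
  quad_growth F -> let H z := G z - (f0 z + F z) in
  quad_growth H /\ E2 H = E2 G - (E2 f0 + E2 F).
Proof.
move=> qG q0 qF H; have q0F := quad_growthD q0 qF.
by split; [exact: quad_growthB|rewrite (E2B qG q0F) (E2D q0 qF)].
Qed.

(** The Taylor expansion of psi is averaged with its remainder, so that nothing has to be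
    differentiated under the integral. *)
Lemma W_taylor psi : test_function psi ->
  exists2 K, 0 <= K & forall x v a b d ex ev ea eb ed,
  `|W psi (x + ex) (v + ev) (a + ea) (b + eb) (d + ed) -
    (W psi x v a b d + W_gradient psi x v a b d ex ev ea eb ed)| <=
  K * (ex ^+ 2 + ev ^+ 2 + ea ^+ 2 + eb ^+ 2 + ed ^+ 2).
Proof.
move=> T; have Tx := test_dx T; have Tv := test_dv T.
have [K K0 KP] := test_taylor T.
pose M := E2 (fun z : R * R => 1 + z.1 ^+ 2 + z.2 ^+ 2).
have M0 : 0 <= M.
  rewrite -[0]E2_cst; apply: E2_le => [||z].
  - by apply: (@quad_growth_bounded _ _ 0) => [|z]; [exact: cst_continuous|rewrite normr0].
  - exact: quad_growth_quad.
  - by rewrite !addr_ge0 ?sqr_ge0.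
(* The 6 is that of [quad_bound]: 2 from the square of |a| + |b|, 3 from the square of a sum of
   three terms; M is the mean of 1 + X^2 + Y^2. *)
exists (K * 6 * M); first by rewrite !mulr_ge0.
move=> x v a b d ex ev ea eb ed.
pose P z := aff x v a b d z.
pose F z := psi (aff (x + ex) (v + ev) (a + ea) (b + eb) (d + ed) z) -
  (psi (P z) + comb5 ex ev ea eb ed (dx psi (P z)) (dv psi (P z))
    (z.1 * dx psi (P z)) (z.2 * dx psi (P z)) (z.2 * dv psi (P z))).
have [qc Ec] := E2_comb5 ex ev ea eb ed
  (quad_growth_test x v a b d Tx) (quad_growth_test x v a b d Tv)
  (quad_growth_test1 x v a b d Tx) (quad_growth_test2 x v a b d Tx)
  (quad_growth_test2 x v a b d Tv).
have [qF EF] := E2_remainder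
  (quad_growth_test (x + ex) (v + ev) (a + ea) (b + eb) (d + ed) T)
  (quad_growth_test x v a b d T) qc.
have W1 := W_fst x v a b d Tx; have W2 := W_snd x v a b d Tx.
have W3 := W_snd x v a b d Tv.
rewrite Ec [X in comb5 _ _ _ _ _ _ _ X]W1 [X in comb5 _ _ _ _ _ _ _ _ X]W2
  [X in comb5 _ _ _ _ _ _ _ _ _ X]W3 in EF.
have -> : W psi (x + ex) (v + ev) (a + ea) (b + eb) (d + ed) -
    (W psi x v a b d + W_gradient psi x v a b d ex ev ea eb ed) = E2 F.
  by rewrite EF.
set Q := (X in _ * X).
have := @E2_bound _ F (K * (6 * Q)) qF _; rewrite -/M.
have -> : K * 6 * M * Q = K * (6 * Q) * M by ring.
apply => z.
have := KP (P z).1 (P z).2 (ex + ea * z.1 + eb * z.2) (ev + ed * z.2).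
rewrite /= => H; rewrite (le_trans _ (le_trans H _))//.
  rewrite le_eqVlt; apply/orP; left; apply/eqP; congr `|_|; rewrite /F /P /aff /comb5 /=.
  have -> : x + a * z.1 + b * z.2 + (ex + ea * z.1 + eb * z.2) =
    x + ex + (a + ea) * z.1 + (b + eb) * z.2 by ring.
  have -> : v + d * z.2 + (ev + ed * z.2) = v + ev + (d + ed) * z.2 by ring.
  by ring.
rewrite -!mulrA ler_wpM2l//.
apply: le_trans (sqr_sum2_le _ _) _; rewrite !real_normK ?num_real//.
by rewrite mulrA; exact: quad_bound.
Qed.

Lemma W_curve psi (fx fv fa fb fd : R -> R) (s ex ev ea eb ed : R) :
  test_function psi ->
  is_derive s 1 fx ex -> is_derive s 1 fv ev -> is_derive s 1 fa ea ->
  is_derive s 1 fb eb -> is_derive s 1 fd ed ->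
  is_derive s 1 (fun u => W psi (fx u) (fv u) (fa u) (fb u) (fd u))
    (W_gradient psi (fx s) (fv s) (fa s) (fb s) (fd s) ex ev ea eb ed).
Proof.
move=> T dfx dfv dfa dfb dfd; have [K K0 KP] := W_taylor T.
pose Q u := (fx u - fx s) ^+ 2 + (fv u - fv s) ^+ 2 + (fa u - fa s) ^+ 2 +
  (fb u - fb s) ^+ 2 + (fd u - fd s) ^+ 2.
apply: (@is_derive_approx _ _ (fun u => W psi (fx s) (fv s) (fa s) (fb s) (fd s) +
  W_gradient psi (fx s) (fv s) (fa s) (fb s) (fd s)
    (fx u - fx s) (fv u - fv s) (fa u - fa s) (fb u - fb s) (fd u - fd s)) Q s _ K).
- exact: is_derive_comb5.
- have dQ := is_deriveD (is_deriveD (is_deriveD (is_deriveD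
    (is_derive_sqr_center dfx) (is_derive_sqr_center dfv)) (is_derive_sqr_center dfa))
    (is_derive_sqr_center dfb)) (is_derive_sqr_center dfd).
  by apply: (is_derive_eq dQ); rewrite !addr0.
- by rewrite /Q !subrr expr0n !addr0.
- by rewrite !subrr /W_gradient comb5_0 addr0.
- move=> u; have := KP (fx s) (fv s) (fa s) (fb s) (fd s)
    (fx u - fx s) (fv u - fv s) (fa u - fa s) (fb u - fb s) (fd u - fd s).
  have e (y z : R) : y + (z - y) = z by ring.
  rewrite !e => H; apply: (le_trans H); rewrite ler_wpM2l//.
  exact: ler_norm.
Qed.

End GaussianShift.

(** * The noise coefficients as functions of time *)

Section Coefficients.
Context {R : realType}.
Implicit Types t : R.

(* (at_ t * X + bt t * Y, dt t * Y), for independent standard Gaussian X and Y,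
   has the covariance matrix of the diffusion with generator Lop at time t;
   qt t is tanh (t / 2). *)
Definition mt t := 1 - expR (- t).

Definition qt t := mt t / (2 - mt t).

Definition at_ t := Num.sqrt (2 * t - 4 * qt t).

Definition bt t := mt t * Num.sqrt (qt t).

Definition dt t := (2 - mt t) * Num.sqrt (qt t).

Lemma mt_lt1 t : mt t < 1.
Proof. by rewrite /mt ltrBlDr ltrDl expR_gt0. Qed.

Lemma mt0 : mt 0 = 0. Proof. by rewrite /mt oppr0 expR0 subrr. Qed.

Lemma mt_ge0 t : 0 <= t -> 0 <= mt t.
Proof. by move=> t0; rewrite subr_ge0 -expR0 ler_expR oppr_le0. Qed.

Lemma mt_gt0 t : 0 < t -> 0 < mt t.
Proof. by move=> t0; rewrite subr_gt0 -expR0 ltr_expR oppr_lt0. Qed.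

Lemma mt_le t : mt t <= t.
Proof. by rewrite /mt; have := expR_ge1Dx (- t); lra. Qed.

Lemma mt_ge_half t : 0 < t -> t <= 1 -> t / 2 <= mt t.
Proof.
move=> t0 t1; rewrite /mt expRN.
have e1 : 1 + t <= expR t by exact: expR_ge1Dx.
have e2 : (expR t)^-1 <= (1 + t)^-1 by rewrite lef_pV2 ?posrE ?expR_gt0//; lra.
suff : (1 + t)^-1 <= 1 - t / 2 by lra.
rewrite -[leLHS]mul1r ler_pdivrMr; last by lra.
nra.
Qed.

Lemma two_mt_gt0 t : 0 < 2 - mt t.
Proof. by have := mt_lt1 t; lra. Qed.

Lemma qt_ge0 t : 0 <= t -> 0 <= qt t.
Proof. by move=> t0; rewrite divr_ge0 ?mt_ge0// ltW// two_mt_gt0. Qed.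

Lemma qt_gt0 t : 0 < t -> 0 < qt t.
Proof. by move=> t0; rewrite divr_gt0 ?mt_gt0// two_mt_gt0. Qed.

Lemma qt_le t : 0 <= t -> qt t <= mt t.
Proof.
move=> t0; rewrite ler_pdivrMr ?two_mt_gt0//.
have := mt_ge0 t0; have := mt_lt1 t; nra.
Qed.

Lemma is_derive_mt t : is_derive t 1 mt (1 - mt t).
Proof.
have d1 := is_derive_affine (0 : R) (-1) t.
have d2 := @is_derive1_comp R expR (fun u => 0 + -1 * u) t _ _
  (is_derive_expR (0 + -1 * t)) d1.
have -> : mt = fun u => cst 1 u - (expR \o (fun u => 0 + -1 * u)) u.
  by apply/funext => u; rewrite /mt /= add0r mulN1r.
apply: (is_derive_eq (is_deriveB (is_derive_cst (1 : R) t 1) d2)).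
by rewrite /= add0r mulN1r; ring.
Qed.

Lemma is_derive_qt t : is_derive t 1 qt (2 * (1 - mt t) / (2 - mt t) ^+ 2).
Proof.
have m2 : 2 - mt t != 0 by rewrite gt_eqF// two_mt_gt0.
have d1 : is_derive t 1 (fun u => 2 - mt u) (0 - (1 - mt t)) :=
  is_deriveB (is_derive_cst (2 : R) t 1) (is_derive_mt t).
have d2 : is_derive t 1 (fun u => (2 - mt u)^-1) (- (2 - mt t) ^- 2 * (0 - (1 - mt t))).
  exact: (@is_deriveV _ (fun u => 2 - mt u) t _ 1 m2 d1).
by apply: (is_derive_eq (is_deriveM1 (is_derive_mt t) d2)); field.
Qed.

Lemma is_derive_sqrt_comp (f : R -> R) t l : 0 < f t -> is_derive t 1 f l ->
  is_derive t 1 (fun u => Num.sqrt (f u)) (l / (2 * Num.sqrt (f t))).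
Proof.
move=> ft df; have := @is_derive1_comp R Num.sqrt f t _ _ (is_derive1_sqrt ft) df.
by rewrite mulrC.
Qed.

Lemma continuous_mt : continuous mt.
Proof. exact: (is_derive_continuous is_derive_mt). Qed.

Lemma continuous_qt : continuous qt.
Proof. exact: (is_derive_continuous is_derive_qt). Qed.

Lemma continuous_at : continuous at_.
Proof.
move=> t; apply: (@cvg_comp _ _ _ (fun t => 2 * t - 4 * qt t) Num.sqrt _ (nbhs (2 * t - 4 * qt t))).
  apply: cvgB; apply: cvgM; try exact: cvg_cst; first exact: cvg_id.
  exact: continuous_qt.
exact: sqrt_continuous.
Qed.

Lemma continuous_sqrt_qt : continuous (fun t => Num.sqrt (qt t)).
Proof.
move=> t; apply: (@cvg_comp _ _ _ qt Num.sqrt _ (nbhs (qt t))).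
  exact: continuous_qt.
exact: sqrt_continuous.
Qed.

Lemma continuous_bt : continuous bt.
Proof. by move=> t; apply: cvgM; [exact: continuous_mt|exact: continuous_sqrt_qt]. Qed.

Lemma continuous_dt : continuous dt.
Proof.
move=> t; apply: cvgM; last exact: continuous_sqrt_qt.
by apply: cvgB; [exact: cvg_cst|exact: continuous_mt].
Qed.

Lemma qt0 : qt 0 = 0. Proof. by rewrite /qt mt0 mul0r. Qed.
Lemma at0 : at_ 0 = 0. Proof. by rewrite /at_ qt0 !mulr0 subrr sqrtr0. Qed.
Lemma bt0 : bt 0 = 0. Proof. by rewrite /bt mt0 mul0r. Qed.
Lemma dt0 : dt 0 = 0. Proof. by rewrite /dt qt0 sqrtr0 mulr0. Qed.

(** The covariance of position and velocity; [dt_sqr] is the variance of the velocity, 1 - exp (- 2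
    t). *)
Lemma bt_dt t : 0 <= t -> bt t * dt t = mt t ^+ 2.
Proof.
move=> t0; rewrite /bt /dt mulrACA -expr2 sqr_sqrtr ?qt_ge0// /qt.
by field; rewrite gt_eqF// two_mt_gt0.
Qed.

Lemma dt_sqr t : 0 <= t -> dt t ^+ 2 = mt t * (2 - mt t).
Proof.
move=> t0; rewrite /dt exprMn sqr_sqrtr ?qt_ge0// /qt.
by field; rewrite gt_eqF// two_mt_gt0.
Qed.

Let at_arg t := 2 * t - 4 * qt t.

(** As q = tanh (t / 2) satisfies 2 q' = 1 - q^2, the derivative is 2 - 2 (1 - q^2). It is small
    because q is, which makes the conditional variance cubic in time. *)
Let is_derive_at_arg t : is_derive t 1 at_arg (2 * qt t ^+ 2).
Proof.
have d1 := is_deriveM1 (is_derive_cst (2 : R) t 1) (is_derive_id t 1).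
have d2 := is_deriveM1 (is_derive_cst (4 : R) t 1) (is_derive_qt t).
apply: (is_derive_eq (is_deriveB d1 d2)); rewrite /cst /qt.
by field; rewrite gt_eqF// two_mt_gt0.
Qed.

(* The key estimate: 2 t - 4 tanh (t / 2) is of order t^3 near 0. *)
Lemma at_arg_lower t : 0 < t -> t <= 1 -> t ^+ 3 / 24 <= 2 * t - 4 * qt t.
Proof.
move=> t0 t1.
have d1 (u : R) : is_derive u 1 (fun u => u * (u * u) / 24) (u ^+ 2 / 8).
  have e1 := is_deriveM1 (is_derive_id u 1) (is_derive_id u 1).
  have e2 := is_deriveM1 (is_derive_id u 1) e1.
  apply: (is_derive_eq (is_deriveM1 e2 (is_derive_cst (24^-1 : R) u 1))).
  by rewrite /cst; field.
have [c /andP[c0 ct]] := @MVT_deriv R (fun u => at_arg u - u * (u * u) / 24)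
  (fun u => 2 * qt u ^+ 2 - u ^+ 2 / 8) 0 t (ltW t0)
  (fun (x : R) _ => is_deriveB (is_derive_at_arg x) (d1 x)).
rewrite /at_arg qt0 !mulr0 !mul0r !subr0 => E.
suff : 0 <= (2 * qt c ^+ 2 - c ^+ 2 / 8) * t.
  rewrite -E; lra.
rewrite mulr_ge0 ?(ltW t0)// subr_ge0.
move: c0; rewrite le_eqVlt => /predU1P[<-|c0].
  by rewrite qt0 expr0n mul0r mulr0.
have c1 : c <= 1 by lra.
have h1 := mt_ge_half c0 c1.
(* Then 2 q^2 >= c^2 / 8, the derivative of c^3 / 24; the bound holds since q >= m / 2 and m >= c /
   2. *)
have h2 : c / 4 <= qt c.
  rewrite ler_pdivlMr ?two_mt_gt0//; have := mt_gt0 c0; nra.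
rewrite expr2 expr2; nra.
Qed.

(** Beyond time 1 positivity persists because the derivative 2 q^2 is nonnegative. *)
Lemma at_arg_gt0 t : 0 < t -> 0 < 2 * t - 4 * qt t.
Proof.
move=> t0; have [t1|t1] := leP t 1.
  by apply: lt_le_trans (at_arg_lower t0 t1); rewrite divr_gt0 ?exprn_gt0.
have h : 0 < at_arg 1.
  by apply: lt_le_trans (at_arg_lower ltr01 (lexx 1)); rewrite divr_gt0 ?exprn_gt0.
have [c _ E] := MVT_deriv (ltW t1) (fun (x : R) _ => is_derive_at_arg x).
suff : 0 <= 2 * qt c ^+ 2 * (t - 1) by rewrite -E -/(at_arg t); lra.
by rewrite mulr_ge0 ?subr_ge0 ?(ltW t1)// mulr_ge0 ?sqr_ge0.
Qed.

Lemma at_gt0 t : 0 < t -> 0 < at_ t.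
Proof. by move=> t0; rewrite sqrtr_gt0 at_arg_gt0. Qed.

Lemma dt_gt0 t : 0 < t -> 0 < dt t.
Proof. by move=> t0; rewrite mulr_gt0 ?two_mt_gt0// sqrtr_gt0 qt_gt0. Qed.

(** The regression coefficient of the position on the velocity. *)
Lemma bt_ratio t : 0 < t -> bt t / dt t = qt t.
Proof.
move=> t0; rewrite /bt /dt.
have : 0 < Num.sqrt (qt t) by rewrite sqrtr_gt0 qt_gt0.
move: (Num.sqrt (qt t)) => s s0.
by rewrite /qt; field; rewrite !gt_eqF// two_mt_gt0.
Qed.

(* Time derivatives of the entries of the covariance matrix
   [[a^2 + b^2, b d], [b d, d^2]]. *)
Lemma covariance_derivatives t : 0 < t -> exists a' b' d',
  [/\ is_derive t 1 at_ a', is_derive t 1 bt b', is_derive t 1 dt d',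
    a' * at_ t + b' * bt t = mt t ^+ 2 &
    b' * dt t + d' * bt t = 2 * mt t * (1 - mt t) /\
    d' * dt t = (1 - mt t) ^+ 2].
Proof.
move=> t0; have q0 := qt_gt0 t0; have A0 := at_arg_gt0 t0.
have m2 := two_mt_gt0 t.
pose s := Num.sqrt (qt t); have s0 : 0 < s by rewrite sqrtr_gt0.
have sE : s ^+ 2 = qt t by rewrite sqr_sqrtr// ltW.
have ds := is_derive_sqrt_comp q0 (is_derive_qt t).
have da := @is_derive_sqrt_comp at_arg t _ A0 (is_derive_at_arg t).
have db := is_deriveM1 (is_derive_mt t) ds.
have dd := is_deriveM1 (is_deriveB (is_derive_cst (2 : R) t 1) (is_derive_mt t)) ds.
have a0 : 0 < Num.sqrt (2 * t - 4 * qt t) by rewrite sqrtr_gt0.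
exists (2 * qt t ^+ 2 / (2 * Num.sqrt (2 * t - 4 * qt t))).
exists ((1 - mt t) * s + mt t * (2 * (1 - mt t) / (2 - mt t) ^+ 2 / (2 * s))).
exists ((0 - (1 - mt t)) * s + (2 - mt t) * (2 * (1 - mt t) / (2 - mt t) ^+ 2 / (2 * s))).
split; [exact: da|exact: db|exact: dd| |split].
- rewrite /at_ /bt -/s.
  have -> : 2 * qt t ^+ 2 / (2 * Num.sqrt (2 * t - 4 * qt t)) *
     Num.sqrt (2 * t - 4 * qt t) = qt t ^+ 2 by field; rewrite gt_eqF.
  have -> : ((1 - mt t) * s + mt t * (2 * (1 - mt t) / (2 - mt t) ^+ 2 / (2 * s))) *
      (mt t * s) = (1 - mt t) * mt t * s ^+ 2 +
      mt t ^+ 2 * (1 - mt t) / (2 - mt t) ^+ 2 by field; rewrite !gt_eqF.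
  by rewrite sE /qt; field; rewrite gt_eqF.
- rewrite /dt /bt -/s.
  have -> : ((1 - mt t) * s + mt t * (2 * (1 - mt t) / (2 - mt t) ^+ 2 / (2 * s))) *
     ((2 - mt t) * s) +
     ((0 - (1 - mt t)) * s + (2 - mt t) * (2 * (1 - mt t) / (2 - mt t) ^+ 2 / (2 * s))) *
     (mt t * s) = (1 - mt t) * (2 - mt t - mt t) * s ^+ 2 +
      2 * mt t * (1 - mt t) / (2 - mt t) by field; rewrite !gt_eqF.
  by rewrite sE /qt; field; rewrite gt_eqF.
- rewrite /dt -/s.
  have -> : ((0 - (1 - mt t)) * s +
      (2 - mt t) * (2 * (1 - mt t) / (2 - mt t) ^+ 2 / (2 * s))) * ((2 - mt t) * s) =
      - (1 - mt t) * (2 - mt t) * s ^+ 2 + (1 - mt t) by field; rewrite !gt_eqF.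
  by rewrite sE /qt; field; rewrite gt_eqF.
Qed.

End Coefficients.

(** * The adjoint semigroup *)

Lemma cvg_of_le (R : realType) (X : Type) (F : set_system X) {FF : Filter F}
    (f g : X -> R) (l : R) : (forall x, `|f x - l| <= g x) ->
  g x @[x --> F] --> (0 : R) -> f x @[x --> F] --> l.
Proof.
move=> fg g0; apply/cvgrPdist_lt => e e0; near=> x.
rewrite distrC (le_lt_trans (fg x))// (le_lt_trans (ler_norm _))//.
by near: x; apply: cvgr0_norm_lt.
Unshelve. all: by end_near. Qed.

Section AdjointSemigroup.
Context {R : realType}.
Implicit Types (psi : R * R -> R) (t x v : R).

Lemma W0 psi x v : W psi x v 0 0 0 = psi (x, v).
Proof.
rewrite -[RHS]E2_cst; congr E2; apply/funext => z.
by rewrite /aff !mul0r !addr0.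
Qed.

Let comb5_1 w1 w2 w3 w4 w5 : comb5 (1 : R) 0 0 0 0 w1 w2 w3 w4 w5 = w1.
Proof. by rewrite /comb5; ring. Qed.

Let comb5_2 (c1 c2 : R) w1 w2 w3 w4 w5 :
  comb5 c1 c2 0 0 0 w1 w2 w3 w4 w5 = c1 * w1 + c2 * w2.
Proof. by rewrite /comb5; ring. Qed.

(* T t = exp (- t P^* ) on test functions: T t psi (x, v) is the expectation of
   psi (X_t, V_t) for the diffusion dX = V dt, dV = - V dt + sqrt 2 dB started
   at (x, v). *)
Definition T t psi : R * R -> R := fun p =>
  W psi (p.1 + mt t * p.2) ((1 - mt t) * p.2) (at_ t) (bt t) (dt t).

Lemma T0 psi : T 0 psi = psi.
Proof.
by apply/funext => -[x v]; rewrite /T at0 bt0 dt0 W0 mt0 mul0r addr0 subr0 mul1r.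
Qed.

Lemma T_bounded t psi K p : test_function psi -> (forall q, `|psi q| <= K) ->
  `|T t psi p| <= K.
Proof. by move=> Tp psiK; exact: W_bounded. Qed.

Lemma T_periodic t psi x v : test_function psi -> T t psi (x + 1, v) = T t psi (x, v).
Proof.
move=> Tp; rewrite /T /W /=; congr E2; apply/funext => z.
rewrite /aff -[RHS](test_periodic Tp); congr (psi (_, _)); ring.
Qed.

Lemma TD t f g p : test_function f -> test_function g ->
  T t (fun q => f q + g q) p = T t f p + T t g p.
Proof. by move=> Tf Tg; exact: WD. Qed.

Lemma TZ t c f p : test_function f -> T t (fun q => c * f q) p = c * T t f p.
Proof. by move=> Tf; exact: WZ. Qed.

Lemma is_derive_T_dx t psi x v : test_function psi ->
  is_derive x 1 (fun s => T t psi (s, v)) (T t (dx psi) (x, v)).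
Proof.
move=> Tp.
have d1 : is_derive x 1 (fun s => s + mt t * v) 1.
  apply: (is_derive_eq (is_deriveD (is_derive_id x 1) (is_derive_cst (mt t * v) x 1))).
  by rewrite addr0.
have d0 (c : R) := is_derive_cst c x 1.
have := W_curve Tp d1 (d0 ((1 - mt t) * v)) (d0 (at_ t)) (d0 (bt t)) (d0 (dt t)).
by rewrite /W_gradient comb5_1.
Qed.

(** A unit change of the initial velocity moves the mean by (m, 1 - m) and leaves the noise
    unchanged. *)
Lemma is_derive_T_dv t psi x v : test_function psi ->
  is_derive v 1 (fun s => T t psi (x, s))
    (mt t * T t (dx psi) (x, v) + (1 - mt t) * T t (dv psi) (x, v)).
Proof.
move=> Tp; have d0 (c : R) := is_derive_cst c v 1.
have d2 : is_derive v 1 (fun s => (1 - mt t) * s) (1 - mt t).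
  apply: (is_derive_eq (is_deriveM1 (d0 (1 - mt t)) (is_derive_id v 1))).
  by rewrite /cst mul0r add0r mulr1.
have := W_curve Tp (is_derive_affine x (mt t) v) d2 (d0 (at_ t)) (d0 (bt t)) (d0 (dt t)).
by rewrite /W_gradient comb5_2.
Qed.

Definition T_dv t psi : R * R -> R := fun p =>
  mt t * T t (dx psi) p + (1 - mt t) * T t (dv psi) p.

Let is_derive_lin2 (f g : R -> R) (s c1 c2 l1 l2 : R) :
  is_derive s 1 f l1 -> is_derive s 1 g l2 ->
  is_derive s 1 (fun u => c1 * f u + c2 * g u) (c1 * l1 + c2 * l2).
Proof.
move=> df dg; have d0 (c : R) := is_derive_cst c s 1.
apply: (is_derive_eq (is_deriveD (is_deriveM1 (d0 c1) df) (is_deriveM1 (d0 c2) dg))).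
by rewrite /cst !mul0r !add0r.
Qed.

Definition T_dvv t psi : R * R -> R := fun p =>
  mt t * T_dv t (dx psi) p + (1 - mt t) * T_dv t (dv psi) p.

Lemma is_derive_T_dvv t psi x v : test_function psi ->
  is_derive v 1 (fun s => T_dv t psi (x, s)) (T_dvv t psi (x, v)).
Proof.
move=> Tp; apply: is_derive_lin2; first exact: (is_derive_T_dv t x v (test_dx Tp)).
exact: (is_derive_T_dv t x v (test_dv Tp)).
Qed.

(** With these values of the covariance entries, [T t] commutes with [Lop]. *)
Let Lop_algebra (m a b d V Wx Wv Wxx X Wvv : R) :
  b * d = m ^+ 2 -> d ^+ 2 = m * (2 - m) ->
  comb5 ((1 - m) * V) (- ((1 - m) * V)) d (- d) 1 Wx Wv (b * Wxx + d * X)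
    (b * X + d * Wvv) Wvv =
  V * Wx + (m * (m * Wxx + (1 - m) * X) + (1 - m) * (m * X + (1 - m) * Wvv)) -
    V * (m * Wx + (1 - m) * Wv).
Proof.
move=> bd dd; rewrite /comb5.
have -> : d * (b * Wxx + d * X) = (b * d) * Wxx + d ^+ 2 * X by ring.
have -> : - d * (b * X + d * Wvv) = - (b * d) * X - d ^+ 2 * Wvv by ring.
by rewrite bd dd; ring.
Qed.

(* The right-hand side is Lop (T t psi). *)
Lemma T_Lop t psi p : 0 <= t -> test_function psi ->
  T t (Lop psi) p = p.2 * T t (dx psi) p + T_dvv t psi p - p.2 * T_dv t psi p.
Proof.
move=> t0 Tp; case: p => x v.
have Tx := test_dx Tp; have Tv := test_dv Tp; have Tvv := test_dv Tv.
have comm : dx (dv psi) = dv (dx psi) by apply/funext => p; exact: dx_dvC.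
pose y := x + mt t * v; pose V := (1 - mt t) * v.
have [_ E] := E2_comb5 V (- V) (dt t) (- dt t) 1
  (quad_growth_test y V (at_ t) (bt t) (dt t) Tx)
  (quad_growth_test y V (at_ t) (bt t) (dt t) Tv)
  (quad_growth_test2 y V (at_ t) (bt t) (dt t) Tx)
  (quad_growth_test2 y V (at_ t) (bt t) (dt t) Tv)
  (quad_growth_test y V (at_ t) (bt t) (dt t) Tvv).
transitivity (E2 (fun z => comb5 V (- V) (dt t) (- dt t) 1
   (dx psi (aff y V (at_ t) (bt t) (dt t) z))
   (dv psi (aff y V (at_ t) (bt t) (dt t) z))
   (z.2 * dx psi (aff y V (at_ t) (bt t) (dt t) z))
   (z.2 * dv psi (aff y V (at_ t) (bt t) (dt t) z))
   (dv (dv psi) (aff y V (at_ t) (bt t) (dt t) z)))).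
  rewrite /T /W; congr E2; apply/funext => z; rewrite /Lop /= -/y -/V.
  rewrite {1 3}/aff /=.
  move: (dx psi _) (dv psi _) (dv (dv psi) _) => A B C; rewrite /comb5; ring.
rewrite E.
have W2 := W_snd y V (at_ t) (bt t) (dt t) Tx.
have W3 := W_snd y V (at_ t) (bt t) (dt t) Tv.
rewrite [X in comb5 _ _ _ _ _ _ _ X]W2 [X in comb5 _ _ _ _ _ _ _ _ X]W3 comm.
have := Lop_algebra (at_ t) v (W (dx psi) y V (at_ t) (bt t) (dt t))
 (W (dv psi) y V (at_ t) (bt t) (dt t)) (W (dx (dx psi)) y V (at_ t) (bt t) (dt t))
 (W (dv (dx psi)) y V (at_ t) (bt t) (dt t)) (W (dv (dv psi)) y V (at_ t) (bt t) (dt t))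
 (bt_dt t0) (dt_sqr t0).
rewrite -/V /T_dvv /T_dv /T comm => ->.
by [].
Qed.

(** The hypotheses give half the derivative of each variance and the full derivative of the
    covariance, matching the heat equation that a Gaussian average satisfies in its covariance
    matrix. *)
Let time_algebra (m a b d a' b' d' V Wx Wv Wxx X Wvv : R) :
  a' * a + b' * b = m ^+ 2 -> b' * d + d' * b = 2 * m * (1 - m) ->
  d' * d = (1 - m) ^+ 2 ->
  comb5 ((1 - m) * V) (- ((1 - m) * V)) a' b' d' Wx Wv (a * Wxx) (b * Wxx + d * X)
    (b * X + d * Wvv) =
  V * Wx + (m * (m * Wxx + (1 - m) * X) + (1 - m) * (m * X + (1 - m) * Wvv)) -
    V * (m * Wx + (1 - m) * Wv).
Proof.
move=> e1 e2 e3; rewrite /comb5.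
transitivity ((1 - m) * V * Wx - (1 - m) * V * Wv + (a' * a + b' * b) * Wxx +
  (b' * d + d' * b) * X + (d' * d) * Wvv); first by ring.
by rewrite e1 e2 e3; ring.
Qed.

(** Kolmogorov's equation. Time is positive because the noise coefficients are square roots that
    vanish at 0. *)
Lemma is_derive_T_dt t psi x v : 0 < t -> test_function psi ->
  is_derive t 1 (fun s => T s psi (x, v)) (T t (Lop psi) (x, v)).
Proof.
move=> t0 Tp; rewrite (T_Lop _ (ltW t0) Tp) /=.
have comm : dx (dv psi) = dv (dx psi) by apply/funext => p; exact: dx_dvC.
have [a' [b' [d' [da db dd e1 [e2 e3]]]]] := covariance_derivatives t0.
have d0 (c : R) := is_derive_cst c t 1.
have dm := is_derive_mt t.
have d1 : is_derive t 1 (fun s => x + mt s * v) ((1 - mt t) * v).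
  apply: (is_derive_eq (is_deriveD (d0 x) (is_deriveM1 dm (d0 v)))).
  by rewrite /cst mulr0 addr0 add0r.
have d2 : is_derive t 1 (fun s => (1 - mt s) * v) (- ((1 - mt t) * v)).
  apply: (is_derive_eq (is_deriveM1 (is_deriveB (d0 1) dm) (d0 v))).
  by rewrite /cst mulr0 addr0 sub0r mulNr.
have := W_curve Tp d1 d2 da db dd.
rewrite /W_gradient comm.
rewrite (time_algebra v (W (dx psi) _ _ _ _ _) (W (dv psi) _ _ _ _ _)
  (W (dx (dx psi)) _ _ _ _ _) (W (dv (dx psi)) _ _ _ _ _)
  (W (dv (dv psi)) _ _ _ _ _) e1 e2 e3).
by rewrite /T_dvv /T_dv /T comm.
Qed.

Lemma T_lipschitz t psi : test_function psi -> 0 <= t -> exists2 K, 0 <= K &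
  forall x v y w, `|T t psi (y, w) - T t psi (x, v)| <= K * (`|y - x| + 2 * `|w - v|).
Proof.
move=> Tp t0; have [K K0 KP] := test_lipschitz Tp; exists K => // x v y w.
have m0 := mt_ge0 t0; have m1 := mt_lt1 t.
rewrite /T /W -(E2B (quad_growth_test _ _ _ _ _ Tp) (quad_growth_test _ _ _ _ _ Tp)).
apply: E2_bounded => [z|z].
  apply: cvgB; exact: (@continuous_test_aff _ psi _ _ _ _ _ Tp z).
rewrite /aff /=; set x' := x + _ + _ + _; set v' := (1 - mt t) * v + _.
have -> : y + mt t * w + at_ t * z.1 + bt t * z.2 = x' + ((y - x) + mt t * (w - v)).
  by rewrite /x'; ring.
have -> : (1 - mt t) * w + dt t * z.2 = v' + (1 - mt t) * (w - v).
  by rewrite /v'; ring.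
apply: (le_trans (KP _ _ _ _)); rewrite ler_wpM2l//.
have := ler_normD (y - x) (mt t * (w - v)).
rewrite !normrM (ger0_norm m0) (@ger0_norm _ (1 - mt t)) ?subr_ge0 ?(ltW m1)//.
have := normr_ge0 (w - v); move: `|y - x + _| `|y - x| `|w - v| => C A B B0 h0.
have h1 : mt t * B <= 1 * B by apply: ler_wpM2r => //; exact: ltW.
have h2 : (1 - mt t) * B <= 1 * B by apply: ler_wpM2r => //; rewrite gerBl.
by clear -h0 h1 h2; lra.
Qed.

Lemma continuous_T t psi : 0 <= t -> test_function psi -> continuous (T t psi).
Proof.
move=> t0 Tp [x v]; have [K K0 KP] := T_lipschitz Tp t0.
apply: (@cvg_of_le _ _ _ _ (T t psi)
  (fun p => K * (`|p.1 - x| + 2 * `|p.2 - v|)) (T t psi (x, v))).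
  by move=> [y w]; exact: KP.
have -> : (0 : R) = K * (`|x - x| + 2 * `|v - v|).
  by rewrite !subrr !normr0 mulr0 addr0 mulr0.
apply: cvgM; first exact: cvg_cst.
apply: cvgD.
  by apply: cvg_norm; apply: cvgB; [exact: cvg_fst|exact: cvg_cst].
apply: cvgM; first exact: cvg_cst.
by apply: cvg_norm; apply: cvgB; [exact: cvg_snd|exact: cvg_cst].
Qed.

Let cvg_mul_to (f g : R -> R) (s l1 l2 : R) : f u @[u --> s] --> l1 -> g u @[u --> s] --> l2 ->
  f u * g u @[u --> s] --> l1 * l2.
Proof. exact: cvgM. Qed.

Lemma continuous_T_time psi x v : test_function psi ->
  continuous (fun t => T t psi (x, v)).
Proof.
move=> Tp t; have [K K0 KP] := W_taylor Tp.
pose fx s := x + mt s * v; pose fv s := (1 - mt s) * v.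
pose G ex ev ea eb ed := W_gradient psi (fx t) (fv t) (at_ t) (bt t) (dt t) ex ev ea eb ed.
pose ex s := fx s - fx t; pose ev s := fv s - fv t; pose ea s := at_ s - at_ t.
pose eb s := bt s - bt t; pose ed s := dt s - dt t.
have c0 (f : R -> R) : continuous f -> f s - f t @[s --> t] --> (0 : R).
  by move=> cf; rewrite -(subrr (f t)); apply: cvgB; [exact: cf|exact: cvg_cst].
have cx : ex s @[s --> t] --> (0 : R).
  apply: c0 => s; apply: cvgD; first exact: cvg_cst.
  by apply: cvgM; [exact: continuous_mt|exact: cvg_cst].
have cv : ev s @[s --> t] --> (0 : R).
  apply: c0 => s; apply: cvgM; last exact: cvg_cst.
  by apply: cvgB; [exact: cvg_cst|exact: continuous_mt].
have ca := c0 _ (@continuous_at R); have cb := c0 _ (@continuous_bt R).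
have cd := c0 _ (@continuous_dt R).
apply: (@cvg_of_le _ _ _ _ (fun t => T t psi (x, v)) (fun s =>
  `|G (ex s) (ev s) (ea s) (eb s) (ed s)| +
  K * (ex s ^+ 2 + ev s ^+ 2 + ea s ^+ 2 + eb s ^+ 2 + ed s ^+ 2))).
  move=> s; have := KP (fx t) (fv t) (at_ t) (bt t) (dt t) (ex s) (ev s) (ea s) (eb s) (ed s).
  have e (y z : R) : y + (z - y) = z by ring.
  rewrite /ex /ev /ea /eb /ed !e /T /= -/(fx s) -/(fx t) -/(fv s) -/(fv t) -/(G _ _ _ _ _).
  move: (G _ _ _ _ _) (W psi (fx s) _ _ _ _) (W psi (fx t) _ _ _ _) (K * _) => g w1 w2 k H.
  have -> : w1 - w2 = (w1 - (w2 + g)) + g by ring.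
  by rewrite (le_trans (ler_normD _ _))// addrC lerD2l.
have sq (f : R -> R) : f s @[s --> t] --> (0 : R) -> f s ^+ 2 @[s --> t] --> (0 : R).
  by move=> cf; rewrite -(mulr0 (0 : R)); exact: (cvg_mul_to cf cf).
have cst0 (f : R -> R) (k : R) : f s @[s --> t] --> (0 : R) -> f s * k @[s --> t] --> (0 : R).
  by move=> cf; rewrite -(mul0r k); apply: (cvg_mul_to cf); exact: cvg_cst.
have add0 (f g : R -> R) : f s @[s --> t] --> (0 : R) -> g s @[s --> t] --> (0 : R) ->
   f s + g s @[s --> t] --> (0 : R).
  by move=> cf cg; rewrite -(addr0 (0 : R)); exact: (cvgD cf cg).
apply: (add0 (fun s => `|_|) (fun s => K * _)).
  rewrite -(normr0 R); apply: cvg_norm; rewrite /G /W_gradient /comb5.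
  by do 4! (apply: (add0 _ _); last exact: (cst0 _ _)); exact: cst0.
rewrite -(mulr0 K); apply: cvgM; first exact: cvg_cst.
by do 4! (apply: (add0 _ _); last exact: (sq _)); exact: sq.
Qed.

Let itv_gt0 (t r s : R) : 0 <= t -> s \in `]t, r[ -> 0 < s.
Proof. by rewrite in_itv /= => t0 /andP[ts _]; exact: le_lt_trans ts. Qed.

Lemma T_increment t (r : R) psi (K : R) p : 0 <= t -> 0 <= r -> test_function psi ->
  (forall q, `|Lop psi q| <= K) ->
  `|T (t + r) psi p - T t psi p| <= K * r.
Proof.
case: p => x v; move=> t0; rewrite le_eqVlt => /predU1P[<- _ _|r0 Tp HK].
  by rewrite addr0 subrr normr0 mulr0.
have tr : t < t + r by rewrite ltrDl.
have [s _] := MVT tr (fun s (hs : s \in `]t, t + r[) =>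
  @is_derive_T_dt s psi x v (itv_gt0 t0 hs) Tp)
  (continuous_subspaceT (@continuous_T_time psi x v Tp)).
rewrite addKl => ->; rewrite normrM (gtr0_norm r0) ler_wpM2r ?(ltW r0)//.
by apply: T_bounded => //; exact: test_Lop.
Qed.

(** The remainder that [semigroup_duality] asks for: the mean value theorem replaces the increment
    by r T s (Lop psi) with s between t and t + r, and [T_increment] for [Lop psi] compares s with
    t. *)
Lemma T_step t (r : R) psi (K : R) p : 0 <= t -> 0 <= r -> test_function psi ->
  (forall q, `|Lop (Lop psi) q| <= K) ->
  `|T (t + r) psi p - T t psi p - r * T t (Lop psi) p| <= K * r ^+ 2.
Proof.
case: p => x v; move=> t0; rewrite le_eqVlt => /predU1P[<- _ _|r0 Tp HK].
  by rewrite addr0 subrr mul0r subr0 normr0 expr0n mulr0.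
have K0 : 0 <= K by exact: le_trans (HK (0, 0)).
have tr : t < t + r by rewrite ltrDl.
have [s] := MVT tr (fun s (hs : s \in `]t, t + r[) =>
  @is_derive_T_dt s psi x v (itv_gt0 t0 hs) Tp)
  (continuous_subspaceT (@continuous_T_time psi x v Tp)).
rewrite in_itv/= => /andP[ts sr]; rewrite addKl => ->.
rewrite [r * _]mulrC -mulrBl normrM (gtr0_norm r0) expr2 mulrA.
rewrite ler_wpM2r ?(ltW r0)//.
have -> : s = t + (s - t) by ring.
have st : 0 <= s - t by rewrite subr_ge0 ltW.
apply: le_trans (T_increment _ t0 st (test_Lop Tp) HK) _.
by rewrite ler_wpM2l//; lra.
Qed.

End AdjointSemigroup.

(** * Duality *)

Section Adjoint.
Context {R : realType}.
Local Notation T2 := (measurableTypeR R * measurableTypeR R)%type.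
Local Notation mu := (@munu R).
Implicit Types (F G h : R * R -> R).

(** The coefficient v in [Lop] and [P_smooth] turns bounded functions into functions of linear
    growth in v, which still lie in L2(munu). *)
Definition linear_growth F := continuous F /\
  exists C, forall p, `|F p| <= C * (1 + `|p.2|).

Lemma linear_growth_bounded F C : continuous F -> (forall p, `|F p| <= C) ->
  linear_growth F.
Proof.
move=> cF FC; split=> //; exists C => p; rewrite (le_trans (FC p))//.
by rewrite ler_peMr ?lerDl// (le_trans _ (FC (0, 0))).
Qed.

Lemma linear_growth_snd F C : continuous F -> (forall p, `|F p| <= C) ->
  linear_growth (fun p => p.2 * F p).
Proof.
move=> cF FC; split; first by move=> p; apply: cvgM; [exact: cvg_snd|exact: cF].
exists C => p; rewrite normrM mulrC ler_pM// lerDr//.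
Qed.

Lemma linear_growthD F G : linear_growth F -> linear_growth G ->
  linear_growth (fun p => F p + G p).
Proof.
move=> [cF [C FC]] [cG [D GD]]; split; first by move=> p; exact: cvgD (cF p) (cG p).
exists (C + D) => p; rewrite (le_trans (ler_normD _ _))// mulrDl.
by rewrite lerD.
Qed.

Lemma linear_growthZ c F : linear_growth F -> linear_growth (fun p => c * F p).
Proof.
move=> [cF [C FC]]; split; first by move=> p; apply: cvgM; [exact: cvg_cst|exact: cF].
by exists (`|c| * C) => p; rewrite normrM -mulrA ler_wpM2l.
Qed.

Lemma linear_growthN F : linear_growth F -> linear_growth (fun p => - F p).
Proof.
move=> [cF [C FC]]; split; first by move=> p; exact: cvgN (cF p).
by exists C => p; rewrite normrN.
Qed.

Lemma linear_growthB F G : linear_growth F -> linear_growth G ->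
  linear_growth (fun p => F p - G p).
Proof. by move=> lF lG; apply: linear_growthD => //; exact: linear_growthN. Qed.

Lemma linear_growth_L2 F : linear_growth F -> F \in Lfun mu 2%:E.
Proof.
move=> [cF [C FC]]; have mF := continuous_measurable2 cF; apply: Lfun2P => //.
have i2 : mu.-integrable [set: T2] (fun p => (F p ^+ 2)%:E).
  apply: (@integrable_growth_snd _ _ _ (2 * C ^+ 2)).
    by apply: measurable_funX; exact: mF.
  move=> p; rewrite ger0_norm ?sqr_ge0// -[F p ^+ 2]real_normK ?num_real//.
  have C0 : 0 <= C by have := FC (0, 0); rewrite normr0 addr0 mulr1; exact: le_trans.
  apply: (@le_trans _ _ ((C * (1 + `|p.2|)) ^+ 2)).
    by rewrite ler_pXn2r// nnegrE mulr_ge0// addr_ge0.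
  rewrite exprMn (_ : 2 * C ^+ 2 * (1 + p.2 ^+ 2) = C ^+ 2 * (2 * (1 + p.2 ^+ 2))); last by ring.
  apply: ler_wpM2l; first exact: sqr_ge0.
  by have := sqr_sum2_le 1 `|p.2|; rewrite expr1n real_normK ?num_real.
move/integrableP : i2 => [_]; apply: le_lt_trans.
rewrite le_eqVlt; apply/orP; left; apply/eqP; apply: eq_integral => p _.
by rewrite gee0_abs// lee_fin sqr_ge0.
Qed.

(** Total, with value 0 outside L2, so that a function can be used as a vector without carrying a
    membership proof; [mkL2E] discharges the default case. *)
Definition mkL2 F : @L2 R :=
  if pselect (F \in Lfun mu 2%:E) is left h then Lfun_Sub (lee1n 2) h else 0.

Lemma mkL2E F : linear_growth F -> mkL2 F = F :> (R * R -> R).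
Proof. by move=> /linear_growth_L2 lF; rewrite /mkL2; case: pselect. Qed.

Lemma L2ip_mkL2 F G : linear_growth F -> linear_growth G ->
  L2ip (mkL2 F) (mkL2 G) = (\int[mu]_p (F p * G p))%R.
Proof. by move=> lF lG; rewrite /L2ip !mkL2E. Qed.

(** The common ground of test functions and of [T t psi], which need not have compact support:
    bounded derivatives and matching values at x = 0 and x = 1 are enough to integrate by parts. *)
Record regular h hx hv hvv : Prop := Regular {
  reg_cont : [/\ continuous h, continuous hx, continuous hv & continuous hvv] ;
  reg_dx : forall x v, is_derive (x : R) 1 (fun s => h (s, v)) (hx (x, v)) ;
  reg_dv : forall x v, is_derive (v : R) 1 (fun s => h (x, s)) (hv (x, v)) ;
  reg_dvv : forall x v, is_derive (v : R) 1 (fun s => hv (x, s)) (hvv (x, v)) ;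
  reg_periodic : forall v, h (1, v) = h (0, v) ;
  reg_bounded : exists C, forall p,
    [/\ `|h p| <= C, `|hx p| <= C, `|hv p| <= C & `|hvv p| <= C] }.

Lemma regular_test phi : test_function phi ->
  regular phi (dx phi) (dv phi) (dv (dv phi)).
Proof.
move=> Tp; have Tx := test_dx Tp; have Tv := test_dv Tp; have Tvv := test_dv Tv.
split.
- by split; exact: test_continuous.
- by move=> x v; exact: test_dxE.
- by move=> x v; exact: test_dvE.
- by move=> x v; exact: test_dvE.
- by move=> v; rewrite -[1]add0r test_periodic.
have [K1 p1 h1] := test_bounded Tp; have [K2 p2 h2] := test_bounded Tx.
have [K3 p3 h3] := test_bounded Tv; have [K4 p4 h4] := test_bounded Tvv.
exists (K1 + K2 + K3 + K4) => p.
have := h1 p; have := h2 p; have := h3 p; have := h4 p.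
move: `|_| `|_| `|_| `|_| => a b c d *; split; lra.
Qed.

Lemma regular_T t psi : 0 <= t -> test_function psi ->
  regular (T t psi) (T t (dx psi)) (T_dv t psi) (T_dvv t psi).
Proof.
move=> t0 Tp; have Tx := test_dx Tp; have Tv := test_dv Tp.
have c_dv f : test_function f -> continuous (T_dv t f).
  move=> Tf p; apply: cvgD; (apply: cvgM; first exact: cvg_cst).
    exact: (continuous_T t0 (test_dx Tf)).
  exact: (continuous_T t0 (test_dv Tf)).
have m0 := mt_ge0 t0; have m1 := mt_lt1 t.
have conv K a b : `|a| <= K -> `|b| <= K -> `|mt t * a + (1 - mt t) * b| <= K.
  move=> aK bK; rewrite (le_trans (ler_normD _ _))//.
  have m1' : 0 <= 1 - mt t by rewrite subr_ge0 ltW.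
  rewrite !normrM (ger0_norm m0) (ger0_norm m1').
  have -> : K = mt t * K + (1 - mt t) * K by rewrite -mulrDl addrC subrK mul1r.
  by apply: lerD; apply: ler_wpM2l.
split.
- split; try exact: continuous_T.
    exact: c_dv.
  move=> p; apply: cvgD; (apply: cvgM; first exact: cvg_cst).
    exact: (c_dv _ Tx).
  exact: (c_dv _ Tv).
- by move=> x v; exact: is_derive_T_dx.
- by move=> x v; exact: is_derive_T_dv.
- by move=> x v; exact: is_derive_T_dvv.
- by move=> v; rewrite -[1 in LHS]add0r T_periodic.
have [K1 p1 h1] := test_bounded Tp; have [K2 p2 h2] := test_bounded Tx.
have [K3 p3 h3] := test_bounded Tv; have [K4 p4 h4] := test_bounded (test_dx Tx).
have [K5 p5 h5] := test_bounded (test_dv Tx); have [K6 p6 h6] := test_bounded (test_dx Tv).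
have [K7 p7 h7] := test_bounded (test_dv Tv).
pose K := K1 + K2 + K3 + K4 + K5 + K6 + K7.
have bd f Kf : test_function f -> (forall p, `|f p| <= Kf) -> Kf <= K ->
    forall p, `|T t f p| <= K.
  move=> Tf fK KK p; apply: le_trans KK; exact: T_bounded.
have b1 := bd _ K1 Tp h1 ltac:(rewrite /K; lra).
have b2 := bd _ K2 Tx h2 ltac:(rewrite /K; lra).
have b3 := bd _ K3 Tv h3 ltac:(rewrite /K; lra).
have b4 := bd _ K4 (test_dx Tx) h4 ltac:(rewrite /K; lra).
have b5 := bd _ K5 (test_dv Tx) h5 ltac:(rewrite /K; lra).
have b6 := bd _ K6 (test_dx Tv) h6 ltac:(rewrite /K; lra).
have b7 := bd _ K7 (test_dv Tv) h7 ltac:(rewrite /K; lra).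
exists K => p; split; [exact: b1|exact: b2|exact: (conv _ _ _ (b2 p) (b3 p))|].
exact: (conv _ _ _ (conv _ _ _ (b4 p) (b5 p)) (conv _ _ _ (b6 p) (b7 p))).
Qed.

Lemma regular_cst c : regular (fun=> c) (fun=> 0) (fun=> 0) (fun=> 0).
Proof.
split=> [|x v|x v|x v|//|]; try exact: is_derive_cst.
  by split; exact: cst_continuous.
by exists `|c| => p; rewrite normr0.
Qed.

Lemma integrable_linear_growth F : linear_growth F ->
  mu.-integrable [set: T2] (fun p => (F p)%:E).
Proof.
move=> [cF [C FC]]; apply: (@integrable_growth_snd _ _ _ (2 * C)).
  exact: continuous_measurable2.
move=> p; have C0 : 0 <= C by have := FC (0, 0); rewrite normr0 addr0 mulr1; exact: le_trans.
exact: (lin_growth_sqr C0 (FC p)).1.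
Qed.

Let int_ibp F F' C : continuous F -> continuous F' ->
  (forall x v : R, is_derive v 1 (fun s => F (x, s)) (F' (x, v))) ->
  (forall p, `|F p| <= C) -> (forall p, `|F' p| <= C) ->
  linear_growth (fun p => p.2 * F p - F' p) /\
  (\int[mu]_p (p.2 * F p - F' p) = 0)%R.
Proof.
move=> cF cF' dF FC F'C.
have l1 := linear_growth_snd cF FC; have l2 := linear_growth_bounded cF' F'C.
split; first exact: linear_growthB.
have CC (v : R) : C <= C * (1 + `|v|).
  by rewrite ler_peMr ?lerDl// (le_trans _ (FC (0, 0))).
rewrite RintegralB//; try exact: integrable_linear_growth.
rewrite (@gauss_ibp_snd R muT F F' C)//; first by rewrite subrr.
  by move=> x v; exact: le_trans (FC _) (CC v).
by move=> x v; exact: le_trans (F'C _) (CC v).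
Qed.

(** The pairing of P f with h, for both functions in the larger class; the last factor on the right
    is [Lop h] written with the given derivatives. *)
Lemma integral_adjoint f fx fv fvv h hx hv hvv :
  regular f fx fv fvv -> regular h hx hv hvv ->
  (\int[mu]_p ((p.2 * fx p - fvv p + p.2 * fv p) * h p) =
   - \int[mu]_p (f p * (p.2 * hx p + hvv p - p.2 * hv p)))%R.
Proof.
move=> [[cf cfx cfv cfvv] dfx dfv dfvv f10 [K fK]] [[ch chx chv chvv] dhx dhv dhvv h10 [M hM]].
have b (a c : R) : `|a| <= K -> `|c| <= M -> `|a * c| <= K * M.
  by move=> ? ?; rewrite normrM ler_pM.
have bD (a c : R) : `|a| <= K * M -> `|c| <= K * M -> `|a + c| <= 2 * (K * M).
  by move=> ? ?; rewrite (le_trans (ler_normD _ _))//; lra.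
have KM : 0 <= K * M.
  have [f1 _ _ _] := fK (0, 0); have [h1 _ _ _] := hM (0, 0).
  by rewrite mulr_ge0// ?(le_trans _ f1)// (le_trans _ h1).
have w a : a <= K * M -> a <= 2 * (K * M) by lra.
have cM (F G : R * R -> R) : continuous F -> continuous G -> continuous (fun p => F p * G p).
  by move=> cF cG p; exact: cvgM (cF p) (cG p).
have cD (F G : R * R -> R) : continuous F -> continuous G -> continuous (fun p => F p + G p).
  by move=> cF cG p; exact: cvgD (cF p) (cG p).
have [l1 i1] : linear_growth (fun p => p.2 * (fv p * h p) - (fvv p * h p + fv p * hv p)) /\
   (\int[mu]_p (p.2 * (fv p * h p) - (fvv p * h p + fv p * hv p)) = 0)%R.
  apply: (@int_ibp (fun p => fv p * h p) (fun p => fvv p * h p + fv p * hv p) (2 * (K * M))).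
  - exact: cM.
  - by apply: cD; exact: cM.
  - by move=> x v; exact: is_deriveM1.
  - by move=> p; have [? ? ? ?] := fK p; have [? ? ? ?] := hM p; apply/w/b.
  - by move=> p; have [? ? ? ?] := fK p; have [? ? ? ?] := hM p; apply: bD; exact: b.
have [l2 i2] : linear_growth (fun p => p.2 * (f p * hv p) - (fv p * hv p + f p * hvv p)) /\
   (\int[mu]_p (p.2 * (f p * hv p) - (fv p * hv p + f p * hvv p)) = 0)%R.
  apply: (@int_ibp (fun p => f p * hv p) (fun p => fv p * hv p + f p * hvv p) (2 * (K * M))).
  - exact: cM.
  - by apply: cD; exact: cM.
  - by move=> x v; exact: is_deriveM1.
  - by move=> p; have [? ? ? ?] := fK p; have [? ? ? ?] := hM p; apply/w/b.
  - by move=> p; have [? ? ? ?] := fK p; have [? ? ? ?] := hM p; apply: bD; exact: b.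
have c3 : continuous (fun p => fx p * h p + f p * hx p) by apply: cD; exact: cM.
have b3 p : `|fx p * h p + f p * hx p| <= 2 * (K * M).
  by have [? ? ? ?] := fK p; have [? ? ? ?] := hM p; apply: bD; exact: b.
have l3 := linear_growth_snd c3 b3.
have i3 : (\int[mu]_p (p.2 * (fx p * h p + f p * hx p)) = 0)%R.
  have [cl3 [D l3D]] := l3.
  apply: (@Rintegral_dx R (fun p => p.2 * (f p * h p)) _ D) => //.
  - move=> x v; have := is_deriveM1 (is_derive_cst v x 1) (is_deriveM1 (dfx x v) (dhx x v)).
    by rewrite /cst mul0r add0r.
  - by move=> v; rewrite /= f10 h10.
have lM (F G : R * R -> R) : linear_growth F -> continuous G -> (exists C, forall p, `|G p| <= C) ->
    linear_growth (fun p => F p * G p).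
  move=> [cF [C FC]] cG [D GD]; split; first exact: cM.
  exists (C * D) => q; rewrite normrM mulrAC; exact: ler_pM.
have lf : exists C, forall p, `|f p| <= C by exists K => p; have [] := fK p.
have lh : exists C, forall p, `|h p| <= C by exists M => p; have [] := hM p.
have bdd (F1 F2 F3 : R * R -> R) (C : R) : continuous F1 -> continuous F2 -> continuous F3 ->
  (forall p, [/\ `|F1 p| <= C, `|F2 p| <= C & `|F3 p| <= C]) ->
  linear_growth (fun p => p.2 * F1 p - F2 p + p.2 * F3 p).
  move=> c1 c2 c3' FC; apply: linear_growthD; last first.
    by apply: (linear_growth_snd (C := C)) => // p; have [] := FC p.
  apply: linear_growthB; first by apply: (linear_growth_snd (C := C)) => // p; have [] := FC p.
  by apply: (linear_growth_bounded (C := C)) => // p; have [] := FC p.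
have lA : linear_growth (fun p => p.2 * fx p - fvv p + p.2 * fv p).
  by apply: (bdd _ _ _ K) => // p; have [] := fK p.
have lB : linear_growth (fun p => p.2 * hx p + hvv p - p.2 * hv p).
  have -> : (fun p => p.2 * hx p + hvv p - p.2 * hv p) =
      fun p => p.2 * hx p - (- hvv p) + p.2 * - hv p.
    by apply/funext => p; rewrite opprK mulrN.
  apply: (bdd hx (fun p => - hvv p) (fun p => - hv p) M chx) => [p|p|p].
  - exact: cvgN (chvv p).
  - exact: cvgN (chv p).
  - by rewrite !normrN; have [] := hM p.
have iA := integrable_linear_growth (lM _ _ lA ch lh).
have lB' : linear_growth (fun p => f p * (p.2 * hx p + hvv p - p.2 * hv p)).
  rewrite (_ : (fun p => _) = (fun p => (p.2 * hx p + hvv p - p.2 * hv p) * f p)).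
    exact: lM.
  by apply/funext => p; rewrite mulrC.
have iB := integrable_linear_growth lB'.
apply/eqP; rewrite -addr_eq0 -RintegralD//; apply/eqP.
(* The sum of the two integrands is a combination of exact terms: Gaussian divergences in v of fv h
   and f hv, and v times the x-derivative of the periodic function f h. *)
transitivity (\int[mu]_p ((p.2 * (fv p * h p) - (fvv p * h p + fv p * hv p)) -
    (p.2 * (f p * hv p) - (fv p * hv p + f p * hvv p)) +
    p.2 * (fx p * h p + f p * hx p)))%R.
  by apply: eq_Rintegral => p _; ring.
have li1 := integrable_linear_growth l1; have li2 := integrable_linear_growth l2.
rewrite RintegralD//; last 2 first.
- exact: integrable_linear_growth (linear_growthB l1 l2).
- exact: integrable_linear_growth.
by rewrite RintegralB// i1 i2 i3 subrr addr0.
Qed.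

Let Rintegral_subZ F G h c : linear_growth F -> linear_growth G -> linear_growth h ->
  (\int[mu]_p h p = 0)%R ->
  (\int[mu]_p F p - \int[mu]_p G p = \int[mu]_p (F p - G p - c * h p))%R.
Proof.
move=> lF lG lh h0; have iF := integrable_linear_growth lF.
have iG := integrable_linear_growth lG; have ih := integrable_linear_growth lh.
rewrite [RHS]RintegralB//; last 2 first.
- exact: (integrable_linear_growth (linear_growthB lF lG)).
- exact: (integrable_linear_growth (linear_growthZ c lh)).
by rewrite RintegralB// RintegralZl// h0 mulr0 subr0.
Qed.

(** Invariance of the measure: the increment in time is r times a function of mean zero, up to a
    quadratic remainder, and [telescoping_const] applies. *)
Lemma integral_T t psi : 0 <= t -> test_function psi ->
  (\int[mu]_p T t psi p = \int[mu]_p psi p)%R.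
Proof.
move=> t0 Tp; rewrite -[in RHS](T0 psi).
apply: (telescoping_const (F := fun t => (\int[mu]_p T t psi p)%R) t0) => e e0.
have [K K0 KP] := test_bounded (test_Lop (test_Lop Tp)).
have lT s f : 0 <= s -> test_function f -> linear_growth (T s f).
  move=> s0 Tf; have [C _ fC] := test_bounded Tf.
  by apply: (@linear_growth_bounded _ C); [exact: continuous_T|move=> p; exact: T_bounded].
exists (e / (K + 1)) => [|s r s0 r0 rd sr]; first by rewrite divr_gt0// ltr_wpDl.
(* P annihilates constants, so pairing with 1 shows that Lop (T s psi), which is T s (Lop psi), has
   mean zero. *)
have iL : (\int[mu]_p T s (Lop psi) p = 0)%R.
  have := integral_adjoint (regular_cst 1) (regular_T s0 Tp).
  rewrite (_ : (\int[mu]_p _)%R = 0)%R.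
    move=> /esym/eqP; rewrite oppr_eq0 => /eqP E; rewrite -[RHS]E.
    by apply: eq_Rintegral => p _; rewrite mul1r T_Lop.
  rewrite (_ : (fun p => _) = cst 0); last by apply/funext => p /=; rewrite !mulr0 subrr addr0 mul0r.
  by rewrite /Rintegral integral0.
have sr0 : 0 <= s + r by rewrite addr_ge0// ltW.
have l3 := lT _ _ s0 (test_Lop Tp).
have l12 := linear_growthB (lT _ _ sr0 Tp) (lT _ _ s0 Tp).
have lD := linear_growthB l12 (linear_growthZ r l3).
rewrite (Rintegral_subZ r (lT _ _ sr0 Tp) (lT _ _ s0 Tp) l3 iL).
apply: (@le_trans _ _ (\int[mu]_p (cst (K * r ^+ 2) p))%R).
  apply: le_trans (le_normr_Rintegral _ _) _ => //; first exact: integrable_linear_growth.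
  apply: le_Rintegral => //.
  - by have := integrable_norm (integrable_linear_growth lD); apply: eq_integrable.
  - exact: (@finite_measure_integrable_cst _ T2 R (mu : probability T2 R)).
  - by move=> p _; rewrite /=; apply: T_step => //; exact: ltW.
rewrite (@Rintegral_cst _ T2 R (mu : probability T2 R))//.
have P1 := @probability_setT _ T2 R (mu : probability T2 R).
rewrite [X in _ * X <= _](congr1 fine P1) mulr1 expr2 mulrA ler_wpM2r ?(ltW r0)//.
rewrite ltr_pdivlMr ?ltr_wpDl// in rd.
by apply: ltW; apply: le_lt_trans rd; rewrite mulrC ler_wpM2l ?(ltW r0)// lerDl.
Qed.

End Adjoint.

Section Duality.
Context {R : realType}.
Local Notation T2 := (measurableTypeR R * measurableTypeR R)%type.
Local Notation mu := (@munu R).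
Local Notation L2 := (@L2 R).
Local Notation ip := (@L2ip _ _ R mu).
Local Notation N := (fun f : L2 => Num.sqrt (L2ip f f)).
Implicit Types (f g : L2) (psi : R * R -> R) (s t : R).

Lemma L2normE f : L2norm f = N f.
Proof. exact: Lnorm_sqrt. Qed.

Let NZ a f : N (a *: f) = `|a| * N f. Proof. exact: (nrmZ (@L2ipC _ _ _ mu) (@L2ipP _ _ _ mu)). Qed.
Let CS f g : `|ip f g| <= N f * N g.
Proof. exact: (cauchy_schwarz (@L2ipC _ _ _ mu) (@L2ipP _ _ _ mu) (@L2ip_ge0 _ _ _ mu)). Qed.
Let ipB f g h : ip (f - g) h = ip f h - ip g h. Proof. exact: (ipBl (@L2ipP _ _ _ mu)). Qed.
Let ipN f h : ip (- f) h = - ip f h. Proof. exact: (ipNl (@L2ipP _ _ _ mu)). Qed.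

Lemma L2_bounded_nrm f C : 0 <= C -> (forall p, `|f p| <= C) -> N f <= C.
Proof.
move=> C0 fC; rewrite -(@ler_pXn2r _ 2)// ?nnegrE ?sqrtr_ge0// sqr_sqrtr ?L2ip_ge0//.
have -> : C ^+ 2 = (\int[mu]_p (cst (C ^+ 2) p))%R.
  rewrite (@Rintegral_cst _ T2 R (mu : probability T2 R))//.
  have P1 := @probability_setT _ T2 R (mu : probability T2 R).
  by rewrite [X in _ = _ * X](congr1 fine P1) mulr1.
apply: le_Rintegral => //.
- exact: L2_mul_integrable.
- exact: (@finite_measure_integrable_cst _ T2 R (mu : probability T2 R)).
- move=> p _ /=; rewrite -expr2 -real_normK ?num_real//.
  by rewrite ler_pXn2r// nnegrE.
Qed.

Lemma linear_growth_T s psi : 0 <= s -> test_function psi -> linear_growth (T s psi).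
Proof.
move=> s0 Tp; have [C _ fC] := test_bounded Tp.
by apply: (@linear_growth_bounded _ _ C); [exact: continuous_T|move=> p; exact: T_bounded].
Qed.

Lemma linear_growth_test psi : test_function psi -> linear_growth psi.
Proof. by rewrite -{2}(T0 psi); exact: linear_growth_T. Qed.

Lemma P_smooth_adjoint (phi Pphi : L2) s psi : 0 <= s -> test_function psi ->
  test_function phi -> Pphi =1 P_smooth phi ->
  ip Pphi (mkL2 (T s psi)) = - ip phi (mkL2 (T s (Lop psi))).
Proof.
move=> s0 Tp Tphi E.
have := integral_adjoint (regular_test Tphi) (regular_T s0 Tp).
rewrite /L2ip !mkL2E; try (exact: linear_growth_T); last exact: (linear_growth_T s0 (test_Lop Tp)).
move=> H; transitivity (\int[mu]_p ((p.2 * dx phi p - dv (dv phi) p + p.2 * dv phi p) * T s psi p))%R.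
  by apply: eq_Rintegral => p _; rewrite E /P_smooth /dv_adj addrA.
by rewrite H; congr (- _); apply: eq_Rintegral => p _; rewrite T_Lop.
Qed.

Let sum_bound (x y u w d : R) : 0 <= u -> 0 <= w -> 0 <= d -> x < d -> y < d ->
  x * u + y * w <= d * (u + w + 1).
Proof.
move=> u0 w0 d0 /ltW xd /ltW yd; have := ler_wpM2r u0 xd; have := ler_wpM2r w0 yd.
lra.
Qed.

(** The identity holds for smooth compactly supported functions and passes to the closure, each side
    being continuous in (f, g). The sign is there because the generator is -P. *)
Lemma P_graph_adjoint f g s psi : 0 <= s -> test_function psi -> P_graph f (- g) ->
  ip g (mkL2 (T s psi)) = ip f (mkL2 (T s (Lop psi))).
Proof.
move=> s0 Tp fg; set H := mkL2 _; set K := mkL2 _.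
apply/eqP; rewrite -subr_eq0 -normr_eq0 eq_le normr_ge0 andbT.
apply/ler_addgt0Pr => e e0; rewrite add0r.
have c0 : 0 < N H + N K + 1 by rewrite ltr_wpDl// addr_ge0 ?sqrtr_ge0.
have [phi [Pphi [Tphi E]]] := fg _ (divr_gt0 e0 c0).
rewrite !L2normE => f1 g1.
have A : ip Pphi H = - ip phi K := P_smooth_adjoint s0 Tp Tphi E.
have -> : ip g H - ip f K = - ip (- g - Pphi) H - ip (f - phi) K.
  rewrite (ipB (- g) Pphi H) (ipB f phi K) (ipN g H) A.
  by move: (ip g H) (ip f K) (ip phi K) => a b c; ring.
apply: (le_trans (ler_normB _ _)); rewrite normrN.
apply: (le_trans (lerD (CS _ _) (CS _ _))).
apply: (@le_trans _ _ (e / (N H + N K + 1) * (N H + N K + 1))); last by rewrite divfK ?gt_eqF.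
apply: sum_bound.
- exact: sqrtr_ge0.
- exact: sqrtr_ge0.
- by rewrite divr_ge0// ltW.
- exact: g1.
- exact: f1.
Qed.

Lemma cvg_right0P (F : R -> R) : F h @[h --> 0^'+] --> (0 : R) <->
  forall e : R, 0 < e -> exists2 d : R, 0 < d & forall h, 0 < h -> h < d -> `|F h| < e.
Proof.
split=> [/cvgrPdist_lt F0 e /F0 [d /= d0 dP]|F0].
  exists d => // h h0 hd; have := dP h; rewrite /= !sub0r !normrN; apply => //.
  by rewrite gtr0_norm.
apply/cvgrPdist_lt => e /F0[d d0 dP]; exists d => //= h; rewrite /= !sub0r !normrN => hd h0.
by apply: dP => //; rewrite gtr0_norm in hd.
Qed.

Section WithSemigroup.
Variable S : R -> L2 -> L2.
Hypothesis hS : exp_mtP S.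

Let hC := hS.1.

Lemma exp_contr t f : 0 <= t -> N (S t f) <= N f.
Proof. by move=> t0; have := semigroup_contraction hC t0 f; rewrite !L2normE. Qed.

Lemma exp_gen f g : gen ip S f g -> P_graph f (- g).
Proof.
move=> fg; apply/hS.2/cvg_right0P => e e0.
have e2 : 0 < e / 2 by rewrite divr_gt0.
have [d d0 dP] := fg _ e2; exists d => // h h0 hd.
rewrite L2normE ger0_norm ?sqrtr_ge0//.
have -> : h^-1 *: (S h f - f) - g = h^-1 *: (S h f - f - h *: g).
  by rewrite [in RHS]scalerBr scalerA mulVf ?scale1r// gt_eqF.
have -> : Num.sqrt (ip (h^-1 *: (S h f - f - h *: g)) (h^-1 *: (S h f - f - h *: g))) =
    h^-1 * N (S h f - f - h *: g).
  by rewrite (NZ h^-1 (S h f - f - h *: g)) gtr0_norm// invr_gt0.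
rewrite mulrC ltr_pdivrMr//; apply: le_lt_trans (dP h h0 hd) _.
by rewrite ltr_pM2r// ltr_pdivrMr// ltr_pMr// ltr1n.
Qed.

(** The smoothing estimates know the semigroup S only through this identity. *)
Lemma exp_duality t f psi : 0 <= t -> test_function psi ->
  ip (S t f) (mkL2 psi) = ip f (mkL2 (T t psi)).
Proof.
move=> t0 Tp; have [K K0 KP] := test_bounded (test_Lop (test_Lop Tp)).
have [M M0 MP] := test_bounded Tp.
rewrite -{1}(T0 psi).
apply: (@semigroup_duality R L2 ip (@L2ipC _ _ _ mu) (@L2ipP _ _ _ mu)
  (@L2ip_ge0 _ _ _ mu) (@L2_complete _ _ _ mu) S _ _ _ _ _
  (fun s => mkL2 (T s psi)) (fun s => mkL2 (T s (Lop psi))) M K t t0 K0).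
- move=> s s0 a f' g z.
  by rewrite -L2ipP; apply: L2ip_ae; exact: semigroup_linear.
- by move=> s s0 g; exact: exp_contr.
- by move=> g z; apply: L2ip_ae; exact: semigroup_0.
- by move=> s r s0 r0 g z; apply: L2ip_ae; exact: semigroup_add.
- move=> g e e0; have /cvg_right0P/(_ _ e0)[d d0 dP] := semigroup_continuous hC g.
  exists d => // h h0 hd; have := dP h h0 hd; rewrite L2normE ger0_norm ?sqrtr_ge0//.
- by move=> s s0 st f' g' /exp_gen; exact: P_graph_adjoint.
- move=> s s0 st; apply: L2_bounded_nrm => // p.
  by rewrite mkL2E; [exact: T_bounded|exact: linear_growth_T].
- move=> s r s0 r0 srt; apply: L2_bounded_nrm => [|p]; first by rewrite mulr_ge0 ?sqr_ge0.
  have l1 := linear_growth_T (addr_ge0 s0 r0) Tp; have l2 := linear_growth_T s0 Tp.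
  have l3 := linear_growth_T s0 (test_Lop Tp).
  have -> : (mkL2 (T (s + r) psi) - mkL2 (T s psi) - r *: mkL2 (T s (Lop psi))) p =
      mkL2 (T (s + r) psi) p - mkL2 (T s psi) p - r * mkL2 (T s (Lop psi)) p by [].
  have key (a b c a' b' c' B : R) : a = a' -> b = b' -> c = c' ->
      `|a' - b' - r * c'| <= B -> `|a - b - r * c| <= B by move=> -> -> ->.
  exact: (key _ _ _ _ _ _ _ (congr1 (@^~ p) (mkL2E l1)) (congr1 (@^~ p) (mkL2E l2))
    (congr1 (@^~ p) (mkL2E l3)) (T_step p s0 r0 Tp KP)).
Qed.

End WithSemigroup.
End Duality.

(** * Smoothing estimates *)

Section WeightedNorms.
Context {R : realType}.
Local Notation T2 := (measurableTypeR R * measurableTypeR R)%type.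
Local Notation mu := (@munu R).
Local Notation L2 := (@L2 R).
Local Notation ip := (@L2ip _ _ R mu).
Local Notation N := (fun f : L2 => Num.sqrt (L2ip f f)).
Implicit Types (F G H psi : R * R -> R) (s t : R).

Definition fnrm F : R := N (mkL2 F).

Let L2nrmD := nrmD (@L2ipC _ _ R mu) (@L2ipP _ _ R mu) (@L2ip_ge0 _ _ R mu).
Let L2nrmZ := nrmZ (@L2ipC _ _ R mu) (@L2ipP _ _ R mu).

Lemma L2_ext (f g : L2) : (forall p, f p = g p) -> f = g.
Proof. by move=> fg; apply/LfuneqP. Qed.

Lemma mkL2D F G : linear_growth F -> linear_growth G ->
  mkL2 (fun p => F p + G p) = mkL2 F + mkL2 G.
Proof.
move=> lF lG; apply: L2_ext => p.
have key (a b c a' b' c' : R) : a = a' -> b = b' -> c = c' -> a' = b' + c' -> a = b + c.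
  by move=> -> -> ->.
exact: (key _ _ _ _ _ _ (congr1 (@^~ p) (mkL2E (linear_growthD lF lG)))
  (congr1 (@^~ p) (mkL2E lF)) (congr1 (@^~ p) (mkL2E lG)) erefl).
Qed.

Lemma mkL2Z c F : linear_growth F -> mkL2 (fun p => c * F p) = c *: mkL2 F.
Proof.
move=> lF; apply: L2_ext => p.
have key (a b a' b' : R) : a = a' -> b = b' -> a' = c * b' -> a = c * b.
  by move=> -> ->.
exact: (key _ _ _ _ (congr1 (@^~ p) (mkL2E (linear_growthZ c lF)))
  (congr1 (@^~ p) (mkL2E lF)) erefl).
Qed.

Lemma fnrm_sum F G a b : linear_growth F -> linear_growth G -> fnrm F <= a -> fnrm G <= b ->
  fnrm (fun p => F p + G p) <= a + b.
Proof.
move=> lF lG Fa Gb; rewrite /fnrm (mkL2D lF lG).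
exact: le_trans (L2nrmD _ _) (lerD Fa Gb).
Qed.

Lemma fnrm_scale c F a : linear_growth F -> fnrm F <= a ->
  fnrm (fun p => c * F p) <= `|c| * a.
Proof.
move=> lF Fa; rewrite /fnrm (mkL2Z c lF).
have key (x y : R) : x = `|c| * y -> y <= a -> x <= `|c| * a.
  by move=> -> ya; rewrite ler_wpM2l.
exact: (key _ _ (L2nrmZ c (mkL2 F)) Fa).
Qed.

Lemma fnrm_ge0 F : 0 <= fnrm F. Proof. exact: sqrtr_ge0. Qed.

Lemma fnrm_sqr F : linear_growth F -> fnrm F ^+ 2 = (\int[mu]_p (F p * F p))%R.
Proof.
by move=> lF; rewrite /fnrm sqr_sqrtr; [exact: L2ip_mkL2|exact: L2ip_ge0].
Qed.

(** By parts, |v h|^2 = |h|^2 + 2 <v h, h'>. With X = |v h|, a = |h| and b = |h'| this gives (X -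
    b)^2 <= a^2 + b^2 <= (a + b)^2. *)
Lemma fnrm_snd h h' C : continuous h -> continuous h' ->
  (forall x v, is_derive (v : R) 1 (fun s => h (x, s)) (h' (x, v))) ->
  (forall p, `|h p| <= C) -> (forall p, `|h' p| <= C) ->
  fnrm (fun p => p.2 * h p) <= fnrm h + 2 * fnrm h'.
Proof.
move=> ch ch' dh hC h'C.
have lh := linear_growth_bounded ch hC; have lh' := linear_growth_bounded ch' h'C.
have lv := linear_growth_snd ch hC.
have C0 : 0 <= C := le_trans (normr_ge0 _) (hC (0, 0)).
have CC a b : `|a| <= C -> `|b| <= C -> `|a * b| <= C * C.
  by move=> *; rewrite normrM ler_pM.
have cM (F G : R * R -> R) : continuous F -> continuous G -> continuous (fun p => F p * G p).
  by move=> cF cG p; exact: cvgM (cF p) (cG p).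
have cD (F G : R * R -> R) : continuous F -> continuous G -> continuous (fun p => F p + G p).
  by move=> cF cG p; exact: cvgD (cF p) (cG p).
have csnd : continuous (fun p : R * R => p.2) by move=> p; exact: cvg_snd.
have lhh : linear_growth (fun p => h p * h p).
  by apply: (linear_growth_bounded (C := C * C)); [exact: cM|move=> p; exact: CC].
have lhh' : linear_growth (fun p => p.2 * (h' p * h p + h p * h' p)).
  apply: (linear_growth_snd (C := C * C + C * C)); first by apply: cD; exact: cM.
  by move=> p; rewrite (le_trans (ler_normD _ _))// lerD// CC.
have [cF [K1 FK1]] : linear_growth (fun p => p.2 * (h p * h p)).
  by apply: (linear_growth_snd (C := C * C)); [exact: cM|move=> p; exact: CC].
have [cF' [K2 FK2]] := linear_growthD lhh lhh'.
have ibp : (\int[mu]_p (p.2 * (p.2 * (h p * h p))) =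
    \int[mu]_p (h p * h p + p.2 * (h' p * h p + h p * h' p)))%R.
  apply: (@gauss_ibp_snd R muT (fun p => p.2 * (h p * h p))
    (fun p => h p * h p + p.2 * (h' p * h p + h p * h' p)) (`|K1| + `|K2|) cF cF').
  - move=> x v; apply: (is_derive_eq (is_deriveM1 (is_derive_id v 1) (is_deriveM1 (dh x v) (dh x v)))).
    by rewrite mul1r.
  - move=> x v; apply: (le_trans (FK1 (x, v))); rewrite ler_wpM2r// ?addr_ge0//.
    by rewrite (le_trans (ler_norm _))// lerDl.
  - move=> x v; apply: (le_trans (FK2 (x, v))); rewrite ler_wpM2r// ?addr_ge0//.
    by rewrite (le_trans (ler_norm _))// lerDr.
have E : fnrm (fun p => p.2 * h p) ^+ 2 =
    fnrm h ^+ 2 + 2 * ip (mkL2 (fun p => p.2 * h p)) (mkL2 h').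
  rewrite (fnrm_sqr lv) (fnrm_sqr lh) (L2ip_mkL2 lv lh').
  have -> : (\int[mu]_p (p.2 * h p * (p.2 * h p)) = \int[mu]_p (p.2 * (p.2 * (h p * h p))))%R.
    by apply: eq_Rintegral => p _; ring.
  rewrite ibp RintegralD//; try exact: integrable_linear_growth.
  congr (_ + _).
  have i1 : mu.-integrable [set: T2] (fun p => (p.2 * h p * h' p)%:E).
    have := L2_mul_integrable (mkL2 (fun p => p.2 * h p)) (mkL2 h').
    by rewrite (mkL2E lv) (mkL2E lh').
  rewrite -RintegralZl//; apply: eq_Rintegral => p _; ring.
have := cauchy_schwarz (@L2ipC _ _ R mu) (@L2ipP _ _ R mu) (@L2ip_ge0 _ _ R mu)
  (mkL2 (fun p => p.2 * h p)) (mkL2 h').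
move=> /(le_trans (ler_norm _)); rewrite -/(fnrm (fun p => p.2 * h p)) -/(fnrm h').
have := fnrm_ge0 (fun p => p.2 * h p); have := fnrm_ge0 h; have := fnrm_ge0 h'.
move: E; move: (fnrm (fun p => p.2 * h p)) (fnrm h) (fnrm h') (ip _ _).
clear => X a b i E b0 a0 X0 iX.
have : (X - b) ^+ 2 <= (a + b) ^+ 2.
  have ab : 0 <= a * b by exact: mulr_ge0.
  rewrite sqrrB sqrrD E; lra.
have [Xb|Xb] := leP X b; first by lra.
by rewrite ler_pXn2r ?nnegrE//; lra.
Qed.

(** Expand the average of (c L - Q F)^2 >= 0 with c the average of L F. An upper bound Q > 0 on the
    second moment of L replaces its exact value. *)
Lemma E2_cauchy_schwarz (L F : R * R -> R) (Q : R) : 0 < Q ->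
  quad_growth (fun z => L z ^+ 2) -> quad_growth (fun z => L z * F z) ->
  quad_growth (fun z => F z * F z) -> E2 (fun z => L z ^+ 2) <= Q ->
  E2 (fun z => L z * F z) ^+ 2 <= Q * E2 (fun z => F z * F z).
Proof.
move=> Q0 q1 q2 q3 LQ; set c := E2 (fun z => L z * F z).
have p1 := quad_growthZ (c ^+ 2) q1; have p2 := quad_growthZ (- (2 * c * Q)) q2.
have p3 := quad_growthZ (Q ^+ 2) q3; have p12 := quad_growthD p1 p2.
have qc : quad_growth (fun _ : R * R => (0 : R)).
  by apply: (@quad_growth_bounded R _ 0) => [|z]; [exact: cst_continuous|rewrite normr0].
have := E2_le qc (quad_growthD p12 p3).
rewrite (E2_cst (0 : R)) (E2D p12 p3) (E2D p1 p2) (E2Z _ q1) (E2Z _ q2) (E2Z _ q3) -/c.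
have pos z : 0 <= c ^+ 2 * L z ^+ 2 + - (2 * c * Q) * (L z * F z) + Q ^+ 2 * (F z * F z).
  have := sqr_ge0 (c * L z - Q * F z); congr (0 <= _); ring.
move=> /(_ pos); move: LQ; move: (E2 _) (E2 _) => e l lQ h.
have cl : c ^+ 2 * l <= c ^+ 2 * Q by rewrite ler_wpM2l ?sqr_ge0.
rewrite -(ler_pM2l Q0).
have e1 : - (2 * c * Q) * c = - 2 * (c ^+ 2 * Q) by ring.
have e2 : Q * (Q * e) = Q ^+ 2 * e by ring.
have e3 : Q * c ^+ 2 = c ^+ 2 * Q by ring.
rewrite e1 in h; rewrite e2 e3; clear -cl h; lra.
Qed.

(** A single bound for the second moments of the weights 1, X and Y; its value is 3. *)
Definition Q2 : R := E2 (fun z : R * R => 1 + z.1 ^+ 2 + z.2 ^+ 2).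

Lemma Q2_gt0 : 0 < Q2.
Proof.
have q1 : quad_growth (fun _ : R * R => (1 : R)).
  by apply: (@quad_growth_bounded R _ 1) => [|z]; [exact: cst_continuous|rewrite normr1].
apply: (lt_le_trans ltr01); rewrite -(E2_cst (1 : R)).
apply: E2_le => // [|z]; first exact: quad_growth_quad.
by rewrite -addrA lerDl addr_ge0 ?sqr_ge0.
Qed.

(** By [W_fst] this is the average of psi against X, hence bounded by |psi| uniformly in t; by
    [W_snd], [U2] is the average against Y. *)
Definition U1 t psi : R * R -> R := fun p => at_ t * T t (dx psi) p.

Definition U2 t psi : R * R -> R := fun p => bt t * T t (dx psi) p + dt t * T t (dv psi) p.

Let quad_sqr (i : R * R -> R) : measurable_fun [set: T2] (i : T2 -> R) ->
  (forall z, i z ^+ 2 <= 1 + z.1 ^+ 2 + z.2 ^+ 2) ->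
  quad_growth (fun z => i z ^+ 2) /\ E2 (fun z => i z ^+ 2) <= Q2.
Proof.
move=> mi iz; have q : quad_growth (fun z => i z ^+ 2).
  split; first by apply: measurable_funX; exact: mi.
  by exists 1 => z; rewrite mul1r ger0_norm// sqr_ge0.
by split=> //; apply: E2_le => //; exact: quad_growth_quad.
Qed.

(* The three pointwise estimates below are Cauchy-Schwarz for the Gaussian
   average defining T t. *)
Lemma fnrm_average t psi F : 0 <= t -> test_function psi -> linear_growth F ->
  (forall p, F p ^+ 2 <= Q2 * T t (fun q => psi q * psi q) p) ->
  fnrm F <= Num.sqrt Q2 * fnrm psi.
Proof.
move=> t0 Tp lF FT.
have Tpp := test_sqr Tp.
have key (x y X Y Q : R) : 0 <= x -> 0 <= y -> 0 <= Q -> x ^+ 2 = X -> y ^+ 2 = Y ->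
    X <= Q * Y -> x <= Num.sqrt Q * y.
  move=> x0 y0 Q0 <- <- xy.
  by rewrite -(@ler_pXn2r _ 2)// ?nnegrE ?mulr_ge0 ?sqrtr_ge0// exprMn sqr_sqrtr.
apply: (key _ _ _ _ _ (fnrm_ge0 F) (fnrm_ge0 psi) (ltW Q2_gt0) (fnrm_sqr lF)
  (etrans (fnrm_sqr (linear_growth_test Tp)) (esym (integral_T t0 Tpp)))).
have lT := linear_growth_T t0 Tpp; have iT := integrable_linear_growth lT.
rewrite -RintegralZl//; apply: le_Rintegral => //.
- by have := L2_mul_integrable (mkL2 F) (mkL2 F); rewrite (mkL2E lF).
- exact: (integrable_linear_growth (linear_growthZ Q2 lT)).
- by move=> p _; rewrite -expr2; exact: FT.
Qed.

Lemma linear_growth_U1 t psi : 0 <= t -> test_function psi -> linear_growth (U1 t psi).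
Proof. by move=> t0 Tp; apply: linear_growthZ; apply: linear_growth_T => //; exact: test_dx. Qed.

Lemma linear_growth_U2 t psi : 0 <= t -> test_function psi -> linear_growth (U2 t psi).
Proof.
move=> t0 Tp; apply: linear_growthD; apply: linear_growthZ; apply: linear_growth_T => //.
  exact: test_dx.
exact: test_dv.
Qed.

Lemma fnrm_U1 t psi : 0 <= t -> test_function psi ->
  fnrm (U1 t psi) <= Num.sqrt Q2 * fnrm psi.
Proof.
move=> t0 Tp; apply: (fnrm_average t0 Tp); first exact: linear_growth_U1.
move=> p; have [q1 q2] : quad_growth (fun z : R * R => z.1 ^+ 2) /\ E2 (fun z : R * R => z.1 ^+ 2) <= Q2.
  apply: (quad_sqr (i := fun z => z.1)) => [|z]; first exact: measurable_fst.
  by rewrite addrAC lerDr addr_ge0 ?sqr_ge0.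
rewrite /U1 /T -(W_fst _ _ _ _ _ Tp).
apply: E2_cauchy_schwarz => //; first exact: Q2_gt0.
  exact: quad_growth_test1.
exact: (quad_growth_test _ _ _ _ _ (test_sqr Tp)).
Qed.

Lemma fnrm_U2 t psi : 0 <= t -> test_function psi ->
  fnrm (U2 t psi) <= Num.sqrt Q2 * fnrm psi.
Proof.
move=> t0 Tp; apply: (fnrm_average t0 Tp); first exact: linear_growth_U2.
move=> p; have [q1 q2] : quad_growth (fun z : R * R => z.2 ^+ 2) /\ E2 (fun z : R * R => z.2 ^+ 2) <= Q2.
  apply: (quad_sqr (i := fun z => z.2)) => [|z]; first exact: measurable_snd.
  by rewrite lerDr addr_ge0 ?sqr_ge0.
rewrite /U2 /T -(W_snd _ _ _ _ _ Tp).
apply: E2_cauchy_schwarz => //; first exact: Q2_gt0.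
  exact: quad_growth_test2.
exact: (quad_growth_test _ _ _ _ _ (test_sqr Tp)).
Qed.

Lemma fnrm_T t psi : 0 <= t -> test_function psi ->
  fnrm (T t psi) <= Num.sqrt Q2 * fnrm psi.
Proof.
move=> t0 Tp; apply: (fnrm_average t0 Tp); first exact: linear_growth_T.
move=> p; have [q1 q2] : quad_growth (fun z : R * R => (1 : R) ^+ 2) /\ E2 (fun z : R * R => (1 : R) ^+ 2) <= Q2.
  apply: (quad_sqr (i := fun z => 1)) => [|z]; first exact: measurable_cst.
  by rewrite expr1n -addrA lerDl addr_ge0 ?sqr_ge0.
have E : T t psi p = E2 (fun z => 1 * psi (aff (p.1 + mt t * p.2) ((1 - mt t) * p.2) (at_ t) (bt t) (dt t) z)).
  by rewrite /T /W; congr E2; apply/funext => z; rewrite mul1r.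
rewrite E; apply: (@E2_cauchy_schwarz (fun=> 1)) => //; first exact: Q2_gt0.
  exact: (quad_growthZ 1 (quad_growth_test _ _ _ _ _ Tp)).
exact: (quad_growth_test _ _ _ _ _ (test_sqr Tp)).
Qed.

End WeightedNorms.

Section SmoothingBounds.
Context {R : realType}.
Implicit Types (F psi : R * R -> R) (s t : R).

(* Minus the adjoint of dv in L2(munu). *)
Definition dv_gauss psi : R * R -> R := fun p => dv psi p + (-1) * (p.2 * psi p).

Lemma test_dv_gauss psi : test_function psi -> test_function (dv_gauss psi).
Proof.
move=> Tp; apply: test_add; first exact: test_dv.
by apply: test_scale; exact: test_snd.
Qed.

Local Notation kap := (Num.sqrt (@Q2 R)).

Let kap0 : 0 <= kap. Proof. exact: sqrtr_ge0. Qed.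

Let fnrm0 psi : 0 <= kap * fnrm psi. Proof. exact: mulr_ge0 kap0 (fnrm_ge0 psi). Qed.

Let fnrm_lin2 c1 c2 F G a : linear_growth F -> linear_growth G -> 0 <= a ->
  fnrm F <= a -> fnrm G <= a ->
  fnrm (fun p => c1 * F p + c2 * G p) <= (`|c1| + `|c2|) * a.
Proof.
move=> lF lG a0 Fa Ga; rewrite mulrDl.
apply: fnrm_sum; try exact: linear_growthZ; exact: fnrm_scale.
Qed.

Lemma fnrm_T_dx t psi : 0 < t -> test_function psi ->
  fnrm (T t (dx psi)) <= (at_ t)^-1 * (kap * fnrm psi).
Proof.
move=> t0 Tp; have a0 := at_gt0 t0; have t0' := ltW t0.
have -> : T t (dx psi) = fun p => (at_ t)^-1 * U1 t psi p.
  by apply/funext => p; exact: (esym (mulKf (lt0r_neq0 a0) _)).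
have := fnrm_scale (at_ t)^-1 (linear_growth_U1 t0' Tp) (fnrm_U1 t0' Tp).
by rewrite ger0_norm// invr_ge0 ltW.
Qed.

(** [U2] mixes both derivatives; subtracting q / a times [U1] from [U2] / d cancels the
    x-derivative, since b / d = q. *)
Lemma fnrm_T_dv t psi : 0 < t -> test_function psi ->
  fnrm (T t (dv psi)) <= ((dt t)^-1 + qt t / at_ t) * (kap * fnrm psi).
Proof.
move=> t0 Tp; have a0 := at_gt0 t0; have d0 := dt_gt0 t0; have t0' := ltW t0.
have alg (a b d q x y : R) : a != 0 -> d != 0 -> b / d = q ->
    y = d^-1 * (b * x + d * y) + - (q / a) * (a * x).
  by move=> ? ? <-; field; apply/andP.
have -> : T t (dv psi) = fun p => (dt t)^-1 * U2 t psi p + - (qt t / at_ t) * U1 t psi p.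
  apply/funext => p; apply: alg; [by rewrite gt_eqF|by rewrite gt_eqF|exact: bt_ratio].
have q0 : 0 <= qt t / at_ t by rewrite divr_ge0 ?qt_ge0// ltW.
have -> : (dt t)^-1 + qt t / at_ t = `|(dt t)^-1| + `|- (qt t / at_ t)|.
  by rewrite normrN (ger0_norm q0) ger0_norm// invr_ge0 ltW.
apply: fnrm_lin2.
- exact: linear_growth_U2.
- exact: linear_growth_U1.
- exact: fnrm0.
- exact: fnrm_U2.
- exact: fnrm_U1.
Qed.

(** At the averaged point the velocity is (1 - m) v + d Y, and the average of Y psi is [U2]. *)
Lemma T_snd t psi p : 0 <= t -> test_function psi ->
  T t (fun q => q.2 * psi q) p = (1 - mt t) * (p.2 * T t psi p) + dt t * U2 t psi p.
Proof.
move=> t0 Tp; rewrite /U2 /T -(W_snd _ _ _ _ _ Tp) mulrA /W.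
set y := p.1 + _; set V := _ * p.2.
have q1 := quad_growth_test y V (at_ t) (bt t) (dt t) Tp.
have q2 := quad_growth_test2 y V (at_ t) (bt t) (dt t) Tp.
rewrite -(E2Z V q1) -(E2Z (dt t) q2) -(E2D (quad_growthZ V q1) (quad_growthZ (dt t) q2)).
by congr E2; apply/funext => z; rewrite {1}/aff /= mulrDl mulrA.
Qed.

Definition snd_bound t : R :=
  1 + 2 * (mt t / at_ t + ((dt t)^-1 + qt t / at_ t)).

Let snd_bound_alg (X Y Z k b m i : R) : 0 <= m -> 0 <= b -> 0 <= k ->
  X <= Y + 2 * Z -> Z <= m * (i * k) + (1 - m) * (b * k) -> Y <= k ->
  X <= (1 + 2 * (m * i + b)) * k.
Proof.
move=> m0 b0 k0 h1 h2 h3.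
have mbk : 0 <= m * (b * k) by rewrite !mulr_ge0.
lra.
Qed.

(** [fnrm_snd] trades the factor v for the v-derivative of T t psi, that is m T (dx psi) + (1 - m) T
    (dv psi), and both terms are already bounded. *)
Lemma fnrm_snd_T t psi : 0 < t -> test_function psi ->
  fnrm (fun p => p.2 * T t psi p) <= snd_bound t * (kap * fnrm psi).
Proof.
move=> t0 Tp; have a0 := at_gt0 t0; have d0 := dt_gt0 t0; have t0' := ltW t0.
have m0 := mt_ge0 t0'; have m1 := mt_lt1 t; have q0 := qt_ge0 t0'.
have [[c _ cv _] _ dT _ _ [C CP]] := regular_T t0' Tp.
have h1 : fnrm (fun p => p.2 * T t psi p) <= fnrm (T t psi) + 2 * fnrm (T_dv t psi).
  by apply: (fnrm_snd (C := C) c cv dT) => p; have [] := CP p.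
have lx := linear_growth_T t0' (test_dx Tp); have lv := linear_growth_T t0' (test_dv Tp).
have h2 : fnrm (T_dv t psi) <= `|mt t| * ((at_ t)^-1 * (kap * fnrm psi)) +
    `|1 - mt t| * (((dt t)^-1 + qt t / at_ t) * (kap * fnrm psi)).
  apply: fnrm_sum; try exact: linear_growthZ.
    exact: fnrm_scale (fnrm_T_dx t0 Tp).
  exact: fnrm_scale (fnrm_T_dv t0 Tp).
have h3 := fnrm_T t0' Tp; have k0 := fnrm0 psi.
have da : 0 <= (dt t)^-1 + qt t / at_ t.
  by apply: addr_ge0; [rewrite invr_ge0 ltW|rewrite divr_ge0// ltW].
have m1' : 0 <= 1 - mt t by rewrite subr_ge0 ltW.
rewrite (ger0_norm m0) (ger0_norm m1') in h2.
exact: (snd_bound_alg m0 da k0 h1 h2 h3).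
Qed.

Definition dv_bound t : R := (dt t)^-1 + qt t / at_ t + (snd_bound t + dt t).

Lemma dv_bound_ge0 t : 0 < t -> 0 <= dv_bound t.
Proof.
move=> t0; have t0' := ltW t0; have a0 := ltW (at_gt0 t0); have d0 := ltW (dt_gt0 t0).
have m0 := mt_ge0 t0'; have q0 := qt_ge0 t0'.
have da : 0 <= (dt t)^-1 + qt t / at_ t
  by apply: addr_ge0; [rewrite invr_ge0|exact: divr_ge0].
apply: addr_ge0 => //; apply: addr_ge0 => //; apply: addr_ge0 => //.
by apply: mulr_ge0 => //; apply: addr_ge0 => //; exact: divr_ge0.
Qed.

(** Since T t does not commute with multiplication by v, [T_snd] first splits T (v psi) into a
    multiple of v T psi and the bounded term d U2. *)
Lemma fnrm_T_dv_gauss t psi : 0 < t -> test_function psi ->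
  fnrm (T t (dv_gauss psi)) <= dv_bound t * (kap * fnrm psi).
Proof.
move=> t0 Tp; have t0' := ltW t0; have d0 := dt_gt0 t0.
have m0 := mt_ge0 t0'; have m1 := mt_lt1 t.
have Tv := test_dv Tp; have Ts := test_snd Tp.
have -> : T t (dv_gauss psi) = fun p => T t (dv psi) p +
    (- (1 - mt t) * (p.2 * T t psi p) + - dt t * U2 t psi p).
  apply/funext => p; rewrite /dv_gauss (TD _ _ Tv (test_scale (-1) Ts)).
  have -> := TZ t (-1) p Ts; rewrite (T_snd p t0' Tp).
  by move: (T t (dv psi) p) (p.2 * T t psi p) (U2 t psi p) => a b c; ring.
have [[c _ _ _] _ _ _ _ [C CP]] := regular_T t0' Tp.
have ls : linear_growth (fun p => p.2 * T t psi p).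
  by apply: (linear_growth_snd (C := C)) => // p; have [] := CP p.
have lu := linear_growth_U2 t0' Tp.
rewrite /dv_bound [leRHS]mulrDl [(snd_bound t + _) * _]mulrDl.
have k0 := fnrm0 psi.
apply: fnrm_sum.
- exact: linear_growth_T.
- by apply: linear_growthD; exact: linear_growthZ.
- exact: fnrm_T_dv.
apply: fnrm_sum; try exact: linear_growthZ.
- apply: (le_trans (fnrm_scale (- (1 - mt t)) ls (fnrm_snd_T t0 Tp))).
  rewrite normrN ger0_norm ?subr_ge0 ?(ltW m1)//.
  apply: ler_piMl; last by lra.
  exact: le_trans (fnrm_ge0 _) (fnrm_snd_T t0 Tp).
- have h := fnrm_scale (- dt t) lu (fnrm_U2 t0' Tp).
  by rewrite normrN (gtr0_norm d0) in h.
Qed.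

(* For 0 < t <= 1: 1 / at_ t = O(t^(-3/2)), qt t <= mt t <= t and
   1 / dt t = O(t^(-1/2)). *)
Lemma small_time_bounds t : 0 < t -> t <= 1 ->
  (at_ t)^-1 <= 33 / Num.sqrt t ^+ 3 /\ dv_bound t <= 33 / Num.sqrt t.
Proof.
move=> t0 t1; have t0' := ltW t0.
set s := Num.sqrt t.
have s0 : 0 < s by rewrite sqrtr_gt0.
have s2 : s ^+ 2 = t by rewrite sqr_sqrtr.
have s1 : s <= 1 by rewrite -sqrtr1 ler_sqrt.
have m0 := mt_ge0 t0'; have m1 := mt_lt1 t; have mle := mt_le t; have mh := mt_ge_half t0 t1.
have q0 := qt_ge0 t0'; have ql := qt_le t0'.
have a0 := at_gt0 t0; have d0 := dt_gt0 t0.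
have sqr_le (x y : R) : 0 <= x -> 0 <= y -> x ^+ 2 <= y ^+ 2 -> x <= y.
  by move=> x0 y0; rewrite ler_pXn2r.
(* a^2 >= t^3 / 24, weakened to the perfect square (s^3 / 5)^2 = t^3 / 25. *)
have alow : s ^+ 3 / 5 <= at_ t.
  apply: sqr_le; [by rewrite divr_ge0// exprn_ge0// ltW|exact: ltW|].
  rewrite /at_ sqr_sqrtr ?(ltW (at_arg_gt0 t0))//.
  apply: le_trans (at_arg_lower t0 t1); rewrite -s2 exprMn.
  have -> : (s ^+ 3) ^+ 2 = (s ^+ 2) ^+ 3 by rewrite -!exprM.
  have : 0 <= (s ^+ 2) ^+ 3 by rewrite !exprn_ge0// ltW.
  by move: ((s ^+ 2) ^+ 3) => u u0; rewrite expr2; lra.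
have ainv : (at_ t)^-1 <= 5 / s ^+ 3.
  have e : 5 / s ^+ 3 = (s ^+ 3 / 5)^-1 by rewrite invf_div.
  by rewrite e lef_pV2 ?posrE// divr_gt0// exprn_gt0.
have dinv : (dt t)^-1 <= 2 / s.
  have e : 2 / s = (s / 2)^-1 by rewrite invf_div.
  rewrite e lef_pV2 ?posrE ?divr_gt0//.
  apply: sqr_le; [by rewrite divr_ge0// ltW|exact: ltW|].
  rewrite (dt_sqr t0') exprMn s2; move: m0 m1 mh; move: (mt t) => m m0 m1 mh.
  have : 0 <= m * (1 - m) by rewrite mulr_ge0// subr_ge0 ltW.
  rewrite [2^-1 ^+ 2]expr2; lra.
have d1 : dt t <= 1.
  apply: sqr_le; [exact: ltW|exact: ler01|].
  rewrite (dt_sqr t0') expr1n; have := sqr_ge0 (mt t - 1); rewrite sqrrB; lra.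
have sinv : 1 <= s^-1 by rewrite -invr1 lef_pV2 ?posrE.
have ta : t / at_ t <= 5 / s.
  have -> : 5 / s = t * (5 / s ^+ 3) by rewrite -s2; field; rewrite gt_eqF.
  by rewrite ler_wpM2l.
have iv : 0 <= (at_ t)^-1 by rewrite invr_ge0 ltW.
have ma : mt t / at_ t <= 5 / s by apply: le_trans ta; rewrite ler_wpM2r.
have qa : qt t / at_ t <= 5 / s.
  by apply: le_trans ta; rewrite ler_wpM2r// (le_trans ql).
split.
  apply: (le_trans ainv); rewrite ler_wpM2r ?invr_ge0 ?exprn_ge0 ?(ltW s0)//.
  by rewrite ler_nat.
(* In units of 1 / s >= 1 the terms add up to 2 + 5 + (1 + 2 (5 + 2 + 5)) + 1 = 33. *)
rewrite /dv_bound /snd_bound.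
move: ma qa dinv d1 sinv; move: (mt t / _) (qt t / _) (dt t)^-1 (dt t) s^-1.
clear => *; lra.
Qed.

End SmoothingBounds.

(** * Weak derivatives *)

Section WeakDerivatives.
Context {R : realType}.
Local Notation T2 := (measurableTypeR R * measurableTypeR R)%type.
Local Notation mu := (@munu R).
Local Notation leb2 := (@dxdv R).
Local Notation L2 := (@L2 R).
Local Notation ip := (@L2ip _ _ R mu).
Implicit Types (f g : L2) (psi phi : R * R -> R) (t : R).

(** Weak derivatives are tested against Lebesgue measure, duality holds in L2(munu); dividing a test
    function by the Gaussian density passes from one to the other and keeps it a test function. *)
Definition inv_gauss : R * R -> R := fun p => (gauss p.2)^-1.

Let gauss_neq0 (y : R) : gauss y != 0. Proof. by rewrite gt_eqF// gauss_gt0. Qed.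

Let continuous_inv_gauss : continuous inv_gauss.
Proof.
move=> p; apply: (@cvgV _ _ _ _ (fun q : R * R => gauss q.2) (gauss p.2)) => //.
apply: (@cvg_comp _ _ _ (fun q : R * R => q.2) gauss _ (nbhs p.2)); first exact: cvg_snd.
exact: continuous_gauss.
Qed.

Let is_derive_inv_gauss (v : R) :
  is_derive v 1 (fun s => (gauss s)^-1) (v * (gauss v)^-1).
Proof.
apply: (is_derive_eq (@is_deriveV _ gauss v _ 1 (gauss_neq0 v) (is_derive_gauss v))).
by rewrite /GRing.scale /=; field.
Qed.

(** The v-derivative is v times the function itself, so regularity of order k yields order k + 1. *)
Lemma Ck_inv_gauss k : [/\ Ck k.+1 inv_gauss, dx inv_gauss = (fun=> 0) &
  dv inv_gauss = fun p => p.2 * inv_gauss p].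
Proof.
have step j : Ck j inv_gauss -> [/\ Ck j.+1 inv_gauss, dx inv_gauss = (fun=> 0) &
    dv inv_gauss = fun p => p.2 * inv_gauss p].
  move=> Cj; apply: CkS_intro; first exact: continuous_inv_gauss.
  - by move=> x v; exact: (is_derive_cst (gauss v)^-1 x 1).
  - by move=> x v; exact: is_derive_inv_gauss.
  - exact: Ck_cst.
  - by apply: CkM => //; exact: Ck_snd.
suff Cj j : Ck j inv_gauss by exact: step (Cj k).
by elim: j => [|j IH]; [split|have [] := step _ IH].
Qed.

Lemma test_inv_gauss phi : test_function phi ->
  test_function (fun p => inv_gauss p * phi p).
Proof.
move=> Tp; apply: test_mul => // k.
by have [C _ _] := Ck_inv_gauss k; exact: CkW.
Qed.

Lemma dx_inv_gauss phi : test_function phi ->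
  dx (fun p => inv_gauss p * phi p) = fun p => inv_gauss p * dx phi p.
Proof.
move=> /test_Ck1 Cp; have [C E _] := Ck_inv_gauss 0.
by rewrite (dxM C Cp) E; apply/funext => p; rewrite mul0r add0r.
Qed.

(** The derivative v / gauss of the weight cancels the term - v of [dv_gauss], leaving the plain
    v-derivative that the weak formulation tests. *)
Lemma dv_gauss_inv_gauss phi : test_function phi ->
  dv_gauss (fun p => inv_gauss p * phi p) = fun p => inv_gauss p * dv phi p.
Proof.
move=> /test_Ck1 Cp; have [C _ E] := Ck_inv_gauss 0.
rewrite /dv_gauss (dvM C Cp) E; apply/funext => p.
by move: (dv phi p) => c; ring.
Qed.

Let measurable_gauss2 :
  measurable_fun [set: T2] (fun p : T2 => (gauss p.2)%:E).
Proof. by apply: (measurableT_comp (@measurable_gaussE R)); exact: measurable_snd. Qed.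

Lemma ge0_integral_munu (G : T2 -> \bar R) : measurable_fun setT G ->
  (forall p, 0 <= G p)%E ->
  (\int[mu]_p G p = \int[leb2]_p (G p * (gauss p.2)%:E))%E.
Proof.
move=> mG G0.
rewrite (fubini_tonelli1 _ mG G0) (@fubini_tonelli1 _ _ _ _ R muT lebesgue_measure).
- apply: eq_integral => x _; rewrite /fubini_F ge0_integral_nuG//.
  exact: measurable_fun_pair2.
- by apply: emeasurable_funM => //; exact: measurable_gauss2.
- by move=> p; rewrite mule_ge0// lee_fin ltW// gauss_gt0.
Qed.

Lemma integral_munu (G : T2 -> \bar R) : measurable_fun setT G ->
  (\int[mu]_p G p = \int[leb2]_p (G p * (gauss p.2)%:E))%E.
Proof.
move=> mG; rewrite integralE [RHS]integralE.
rewrite !ge0_integral_munu//; last 2 first.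
- exact: measurable_funeneg.
- exact: measurable_funepos.
have g0 (p : T2) := ltW (gauss_gt0 p.2).
congr (_ - _)%E; apply: eq_integral => p _.
  transitivity ((fun z => (gauss p.2)%:E * G z)^\+ p)%E.
    by rewrite ge0_funeposM// muleC.
  by rewrite !funeposE muleC.
transitivity ((fun z => (gauss p.2)%:E * G z)^\- p)%E.
  by rewrite ge0_funenegM// muleC.
by rewrite !funenegE muleC.
Qed.

Lemma Rintegral_dxdv f psi : test_function psi ->
  (\int[leb2]_p (f p * psi p) = ip f (mkL2 (fun p => inv_gauss p * psi p)))%R.
Proof.
move=> Tp; have lp := linear_growth_test (test_inv_gauss Tp).
rewrite /L2ip (mkL2E lp) /Rintegral integral_munu; last first.
  apply: measurable_EFin_comp; apply: measurable_funM; first exact: L2_measurable.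
  by apply: continuous_measurable2; case: lp.
congr fine; apply: eq_integral => p _; rewrite -EFinM; congr EFin.
by rewrite /inv_gauss; move: (f p) (psi p) => a b; field.
Qed.

(** Stated for an operator D so as to serve for both derivatives: [dx], which does not see the
    weight, and [dv_gauss], which absorbs it. *)
Lemma riesz_dual S f0 f t (D : (R * R -> R) -> R * R -> R) (B : R) :
  exp_mtP S -> 0 <= t -> 0 <= B -> f = S t f0 %[ae mu] ->
  (forall psi, test_function psi -> test_function (D psi)) ->
  (forall a phi psi, test_function phi -> test_function psi ->
    D (fun p => a * phi p + psi p) = fun p => a * D phi p + D psi p) ->
  (forall psi, test_function psi -> fnrm (T t (D psi)) <= B * fnrm psi) ->
  exists2 g, (forall psi, test_function psi ->
    ip g (mkL2 psi) = - ip f (mkL2 (D psi))) & L2norm g <= B * L2norm f0.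
Proof.
move=> hS t0 B0 fS TD DP DB.
pose Dom (h : L2) := exists2 psi, test_function psi & h = mkL2 psi.
(* Vectors being functions, [mkL2 psi] determines psi, so l is well defined on [Dom] by applying D
   to the vector itself. *)
pose l (h : L2) := - ip f (mkL2 (D h)).
have lE psi : test_function psi -> l (mkL2 psi) = - ip f (mkL2 (D psi)).
  by move=> Tp; rewrite /l (mkL2E (linear_growth_test Tp)).
have lin a phi psi : test_function phi -> test_function psi ->
    mkL2 (fun p => a * phi p + psi p) = a *: mkL2 phi + mkL2 psi.
  move=> Tphi Tpsi; have lphi := linear_growth_test Tphi; have lpsi := linear_growth_test Tpsi.
  by rewrite (mkL2D (linear_growthZ a lphi) lpsi) (mkL2Z a lphi).
have test_lin a phi psi : test_function phi -> test_function psi ->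
    test_function (fun p => a * phi p + psi p).
  by move=> ? ?; apply: test_add => //; exact: test_scale.
have [|||||g gP gN] := riesz (@L2ipC _ _ R mu) (@L2ipP _ _ R mu) (@L2ip_ge0 _ _ R mu)
  (@L2_complete _ _ R mu) (D := Dom) (l := l) (M := B * L2norm f0).
- by rewrite mulr_ge0// L2normE sqrtr_ge0.
- exists (fun=> 0); first exact: test0.
  by apply: L2_ext => p; rewrite mkL2E//; exact: (linear_growth_test (@test0 R)).
- move=> a _ _ [phi Tphi ->] [psi Tpsi ->]; exists (fun p => a * phi p + psi p).
    exact: test_lin.
  by rewrite lin.
- move=> a _ _ [phi Tphi ->] [psi Tpsi ->].
  rewrite -(lin a _ _ Tphi Tpsi) (lE _ (test_lin a _ _ Tphi Tpsi)) (lE _ Tphi) (lE _ Tpsi).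
  rewrite (DP a _ _ Tphi Tpsi) (lin a _ _ (TD _ Tphi) (TD _ Tpsi)).
  rewrite (ipDr (@L2ipC _ _ R mu) (@L2ipP _ _ R mu)) (ipZr (@L2ipC _ _ R mu) (@L2ipP _ _ R mu)).
  by move: (ip _ _) (ip _ _) => x y; ring.
- move=> _ [psi Tpsi ->]; rewrite (lE _ Tpsi) normrN (L2ip_ae _ fS).
  rewrite (exp_duality hS f0 t0 (TD _ Tpsi)).
  apply: (le_trans (cauchy_schwarz (@L2ipC _ _ R mu) (@L2ipP _ _ R mu) (@L2ip_ge0 _ _ R mu) _ _)).
  rewrite L2normE [B * _]mulrC -mulrA; apply: ler_wpM2l; first exact: sqrtr_ge0.
  exact: DB.
exists g; last by rewrite L2normE.
by move=> psi Tpsi; rewrite -(lE _ Tpsi); apply: gP; exists psi.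
Qed.

Lemma dx_lin a phi psi : test_function phi -> test_function psi ->
  dx (fun p => a * phi p + psi p) = fun p => a * dx phi p + dx psi p.
Proof.
move=> Tphi Tpsi; rewrite (dxD (test_Ck1 (test_scale a Tphi)) (test_Ck1 Tpsi)).
by rewrite dx_scale.
Qed.

Lemma dv_gauss_lin a phi psi : test_function phi -> test_function psi ->
  dv_gauss (fun p => a * phi p + psi p) = fun p => a * dv_gauss phi p + dv_gauss psi p.
Proof.
move=> Tphi Tpsi; rewrite /dv_gauss (dvD (test_Ck1 (test_scale a Tphi)) (test_Ck1 Tpsi)).
rewrite dv_scale//; apply/funext => p.
by move: (dv phi p) (dv psi p) => x y; ring.
Qed.

Lemma weak_dx_exp S f0 f t : exp_mtP S -> 0 < t -> f = S t f0 %[ae mu] ->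
  exists2 g, weak_dx f g & L2norm g <= (at_ t)^-1 * Num.sqrt (@Q2 R) * L2norm f0.
Proof.
move=> hS t0 fS.
have [|psi Tp|g gP gN] := riesz_dual hS (ltW t0) _ fS (@test_dx R) dx_lin
  (B := (at_ t)^-1 * Num.sqrt (@Q2 R)).
- by rewrite mulr_ge0 ?invr_ge0 ?sqrtr_ge0.
- by rewrite -mulrA; exact: fnrm_T_dx.
exists g => // phi Tphi.
rewrite (Rintegral_dxdv f (test_dx Tphi)) (Rintegral_dxdv g Tphi).
by rewrite (gP _ (test_inv_gauss Tphi)) opprK (dx_inv_gauss Tphi).
Qed.

Lemma weak_dv_exp S f0 f t : exp_mtP S -> 0 < t -> f = S t f0 %[ae mu] ->
  exists2 g, weak_dv f g & L2norm g <= dv_bound t * Num.sqrt (@Q2 R) * L2norm f0.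
Proof.
move=> hS t0 fS.
have [|psi Tp|g gP gN] := riesz_dual hS (ltW t0) _ fS test_dv_gauss dv_gauss_lin
  (B := dv_bound t * Num.sqrt (@Q2 R)).
- rewrite mulr_ge0 ?sqrtr_ge0//; exact: dv_bound_ge0.
- by rewrite -mulrA; exact: fnrm_T_dv_gauss.
exists g => // phi Tphi.
rewrite (Rintegral_dxdv f (test_dv Tphi)) (Rintegral_dxdv g Tphi).
by rewrite (gP _ (test_inv_gauss Tphi)) opprK (dv_gauss_inv_gauss Tphi).
Qed.

End WeakDerivatives.

Theorem theorem1p2 (R : realType) :
  exists2 C : R, 0 < C &
    forall (f0 : @L2 R) (f : R -> @L2 R), solution f0 f ->
      (forall t : R, 0 < t -> in_H1 (f t)) /\
      (forall t : R, 0 < t -> t <= 1 ->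
        (exists2 g : @L2 R, weak_dv (f t) g &
           L2norm g <= C / t `^ (1 / 2) * L2norm f0) /\
        (exists2 g : @L2 R, weak_dx (f t) g &
           L2norm g <= C / t `^ (3 / 2) * L2norm f0)).
Proof.
have k0 : 0 < Num.sqrt (@Q2 R) by rewrite sqrtr_gt0 Q2_gt0.
(* 33 is the constant of [small_time_bounds] and the square root that of the Gaussian Cauchy-Schwarz
   bound; the value is 33 sqrt 3. *)
exists (33 * Num.sqrt (@Q2 R)); first by rewrite mulr_gt0.
move=> f0 f [S hS fS]; split=> t t0.
  have [g1 w1 _] := weak_dx_exp hS t0 (fS t (ltW t0)).
  have [g2 w2 _] := weak_dv_exp hS t0 (fS t (ltW t0)).
  by split; [exists g1|exists g2].
move=> t1; have t0' := ltW t0; have [b1 b2] := small_time_bounds t0 t1.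
have p1 : t `^ (1 / 2) = Num.sqrt t by rewrite mul1r powR12_sqrt.
have p3 : t `^ (3 / 2) = Num.sqrt t ^+ 3.
  by rewrite mulrC powRrM powR12_sqrt// powR_mulrn// sqrtr_ge0.
have n0 : 0 <= L2norm f0 by rewrite L2normE sqrtr_ge0.
have key (a b k n x : R) : 0 <= k -> 0 <= n -> a <= 33 / b -> x <= a * k * n ->
    x <= 33 * k / b * n.
  move=> k0' n0' ab /le_trans; apply; rewrite ler_wpM2r//.
  by rewrite mulrAC ler_wpM2r.
split.
  have [g w gN] := weak_dv_exp hS t0 (fS t (ltW t0)).
  by exists g => //; rewrite p1; exact: key (ltW k0) n0 b2 gN.
have [g w gN] := weak_dx_exp hS t0 (fS t (ltW t0)).
by exists g => //; rewrite p3; exact: key (ltW k0) n0 b1 gN.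
Qed.
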